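(* Consider a sequence of experiments as described in the context (independent groups $i=1,\dots,m$, the $i$-th consisting of $n_i$ i.i.d. observations with mean $\mu_i$ and variance $\sigma_i^2$; $n=\max_i n_i$, $m=m_n$, $m,n\to\infty$). Fix $\alpha\in(0,1)$ and assume the following, where all constants are fixed along the sequence. (1) There exist $0<c_L\le 1\le c_U$ such that $c_L\le \sigma_i^2/\sigma_j^2\le c_U$ and $c_L\le n_i/n_j\le c_U$ for all $1\le i\ne j\le m$. (2) For some constants $r,C,\nu,K>0$, $m\le C n^r$ and $\max_{1\le i\le m}\mathbb{E}\left|(X_{1i}-\mu_i)/\sigma_i\right|^{2+4r+\nu}\le K$. (3) For all $i<j$, the reference null distribution functions $F_{ij}$ (possibly depending on $m,n_1,\dots,n_m$) are monotone increasing distribution functions with $F_{ij}(t)=1-F_{ij}(-t)$ for $t\ge 0$, and for some $c>0$, $$\max_{1\le i<j\le m}\ \sup_{0\le t\le 2\sqrt{\log m}}\left|\frac{1-F_{ij}(t)}{\bar\Phi(t)}-1\right|=O(n^{-c})\quad\text{as } m,n\to\infty.$$ (4) $$\mathrm{Card}\left\{(i,j):1\le i<j\le m,\ \frac{|\mu_i-\mu_j|}{\sqrt{\sigma_i^2/n_i+\sigma_j^2/n_j}}\ge 8c_U^2\sqrt{\log m}\right\}\ge 1.$$ Let $q=m(m-1)/2$, $\mathcal{H}_0=\{(i,j): i<j,\ \mu_i-\mu_j=0\}$ and $q_0=|\mathcal{H}_0|$. Then the level-$\alpha$ Benjamini–Hochberg procedure with sign declaration for pairwise comparisons (defined in the context)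 satisfies $$\limsup_{m,n\to\infty}\frac{dFDR}{\frac{\alpha}{2}\left(1+\frac{q_0}{q}\right)}\le 1,$$ and for every $\epsilon>0$, $$P\left(dFDP<\frac{\alpha}{2}\left(1+\frac{q_0}{q}\right)+\epsilon\right)\longrightarrow 1\quad\text{as } m,n\to\infty.$$
   Context: Setting. For each experiment in a sequence there are $m$ independent groups of observations $\{X_{ki}:1\le k\le n_i\}$, $1\le i\le m$; within group $i$ the $X_{ki}$ are i.i.d. with mean $\mu_i$ and variance $\sigma_i^2>0$, and $n_i\ge 2$. Put $n=\max_i n_i$; $m=m_n$ depends on $n$, and asymptotics are as $m,n\to\infty$. The quantities $n_i,\mu_i,\sigma_i$ and the distributions may vary along the sequence. Notation. $\Phi$ is the standard normal c.d.f. and $\bar\Phi=1-\Phi$. $\bar X_i=n_i^{-1}\sum_{k=1}^{n_i}X_{ki}$, $\hat\sigma_i^2=(n_i-1)^{-1}\sum_{k=1}^{n_i}(X_{ki}-\bar X_i)^2$, and $$T_{ij}=\frac{\bar X_i-\bar X_j}{\sqrt{\hat\sigma_i^2/n_i+\hat\sigma_j^2/n_j}},\quad i\neq j$$ (set to $0$ if the denominator vanishes). The null hypotheses are $H_{ij}:\mu_i=\mu_j$, $1\le i<j\le m$. Given reference distribution functions $F_{ij}$ (not necessarily the exact null distributions of the $T_{ij}$), for $i<j$ let $p_{ij,U}=1-F_{ij}(T_{ij})$, $p_{ij,L}=F_{ij}(T_{ij})$, and $p_{|ij|}=2\min(p_{ij,L},p_{ij,U})$. Level-$\alpha$ BH procedure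 with sign declaration. Sort the $q=m(m-1)/2$ two-sided p-values $p_{|ij|}$ as $p_{(1)}\le\dots\le p_{(q)}$. Let $\hat k=\max\{k:p_{(k)}\le k\alpha/q\}$ and reject $H_{ij}$ whenever $p_{|ij|}\le p_{(\hat k)}$; if no such $k$ exists, reject nothing. For each rejected $H_{ij}$, declare $\mathrm{sgn}(\mu_i-\mu_j)>0$ if $T_{ij}>0$ and declare $\mathrm{sgn}(\mu_i-\mu_j)<0$ if $T_{ij}<0$. Directional errors. A directional error for $H_{ij}$ is made if either $\mu_i-\mu_j\ne0$, $H_{ij}$ is rejected and $\mathrm{sgn}(\mu_i-\mu_j)$ is incorrectly declared, or $\mu_i-\mu_j=0$ and $H_{ij}$ is rejected. The directional false discovery proportion is $$dFDP=\frac{\#\{(i,j):i<j,\text{ a directional error is made for }(i,j)\}}{\#\{(i,j):i<j,\ H_{ij}\text{ is rejected}\}},$$ with $dFDP=0$ when there are no rejections, and $dFDR=\mathbb{E}[dFDP]$. *)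

(* Defs.v *)
From HB Require Import structures.
From mathcomp Require Export all_boot all_order all_algebra.
From mathcomp Require Export all_classical all_reals all_analysis.

Set Implicit Arguments.
Unset Strict Implicit.
Unset Printing Implicit Defensive.

Export Order.TTheory GRing.Theory Num.Theory.
Export numFieldNormedType.Exports.

Local Open Scope classical_set_scope.
Local Open Scope ring_scope.

Definition mutually_independent (d : measure_display) (T : measurableType d)
    (R : realType) (P : probability T R) (I : finType)
    (X : I -> {RV P >-> R}) : Prop :=
  forall (J : {set I}) (B : I -> set R), (forall a, measurable (B a)) ->
    P (\bigcap_(a in [set` J]) (X a @^-1` B a)) =
    (\prod_(a in J) P (X a @^-1` B a))%E.

Definition identically_distributed (d : measure_display) (T : measurableType d)
    (R : realType) (P : probability T R) (X Y : {RV P >-> R}) : Prop :=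
  forall B : set R, measurable B -> distribution P X B = distribution P Y B.

(* [obs i k] is the (k+1)-st observation of the (i+1)-st group.  Independent
   groups, each made of independent observations, amount to the mutual
   independence of the family of all observations.  Since [obs i k] is required
   to be integrable, its expectation and its variance have their usual
   meaning. *)
Record experiment (R : realType) := Experiment {
  disp : measure_display;
  space : measurableType disp;
  prob : probability space R;
  ngroups : nat;
  nobs : 'I_ngroups -> nat;
  obs : forall i : 'I_ngroups, 'I_(nobs i) -> {RV prob >-> R};
  mean : 'I_ngroups -> R;
  sd : 'I_ngroups -> R;
  nobs_ge2 : forall i, (2 <= nobs i)%N;
  sd_gt0 : forall i, 0 < sd i;
  obs_independent :
    mutually_independent
      (fun a : {i : 'I_ngroups & 'I_(nobs i)} => obs (tagged a));
  obs_identical : forall i (k k' : 'I_(nobs i)),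
    identically_distributed (obs k) (obs k');
  obs_integrable : forall i (k : 'I_(nobs i)),
    prob.-integrable setT (EFin \o obs k);
  obs_mean : forall i (k : 'I_(nobs i)), ('E_prob[obs k] = (mean i)%:E)%E;
  obs_variance : forall i (k : 'I_(nobs i)),
    ('V_prob[obs k] = ((sd i) ^+ 2)%:E)%E
}.

Definition max_nobs (R : realType) (E : experiment R) : nat :=
  \max_(i < ngroups E) nobs i.

Definition Phi (R : realType) (t : R) : R :=
  fine (normal_prob 0 1 `]-oo, t]%classic).

Definition Phibar (R : realType) (t : R) : R := 1 - Phi t.

Section pairwise_comparisons.
Context (R : realType) (E : experiment R).
Local Notation m := (ngroups E).
Local Notation Omega := (space E).

Definition standardized_moment (i : 'I_m) (k : 'I_(nobs i)) (p : R) : \bar R :=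
  ('E_(prob E)[fun w => (`|(obs k w - mean i) / sd i| `^ p)%R])%E.

Definition sample_mean (i : 'I_m) (w : Omega) : R :=
  (nobs i)%:R^-1 * \sum_(k < nobs i) obs k w.

Definition sample_var (i : 'I_m) (w : Omega) : R :=
  ((nobs i)%:R - 1)^-1 * \sum_(k < nobs i) (obs k w - sample_mean i w) ^+ 2.

(* Division by 0 yields 0, as required when the denominator vanishes. *)
Definition tstat (i j : 'I_m) (w : Omega) : R :=
  (sample_mean i w - sample_mean j w) /
  Num.sqrt (sample_var i w / (nobs i)%:R + sample_var j w / (nobs j)%:R).

Definition pairs : {set 'I_m * 'I_m} := [set x : 'I_m * 'I_m | (x.1 < x.2)%N]%SET.

Definition npairs : nat := (m * (m - 1)) %/ 2.

Definition null_pairs : {set 'I_m * 'I_m} :=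
  [set x in pairs | mean x.1 == mean x.2]%SET.

Definition standardized_diff (i j : 'I_m) : R :=
  `|mean i - mean j| /
  Num.sqrt ((sd i) ^+ 2 / (nobs i)%:R + (sd j) ^+ 2 / (nobs j)%:R).

Definition separated_pairs (b : R) : {set 'I_m * 'I_m} :=
  [set x in pairs | b <= standardized_diff x.1 x.2]%SET.

(* Reference null distribution functions; only the values at i < j matter. *)
Context (F : 'I_m -> 'I_m -> cumulativeBounded (0 : R) (1 : R)).

Definition ref_deviation : \bar R :=
  ereal_sup [set y | exists (i j : 'I_m) (t : R),
    [/\ (i < j)%N, 0 <= t <= 2 * Num.sqrt (ln m%:R) &
        y = `|(1 - F i j t) / Phibar t - 1|%:E]].

Definition pval_upper (i j : 'I_m) (w : Omega) : R := 1 - F i j (tstat i j w).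

Definition pval_lower (i j : 'I_m) (w : Omega) : R := F i j (tstat i j w).

Definition pval (i j : 'I_m) (w : Omega) : R :=
  2 * Num.min (pval_lower i j w) (pval_upper i j w).

Definition sorted_pvals (w : Omega) : seq R :=
  sort <=%R [seq pval x.1 x.2 w | x in pairs].

(* p_(k), for 1 <= k <= npairs *)
Definition order_pval (w : Omega) (k : nat) : R :=
  nth 0 (sorted_pvals w) k.-1.

Context (alpha : R).

(* Equal to 0 when no k satisfies the condition. *)
Definition bh_index (w : Omega) : nat :=
  \max_(1 <= k < npairs.+1 | order_pval w k <= k%:R * alpha / npairs%:R) k.

Definition rejected (i j : 'I_m) (w : Omega) : bool :=
  (0 < bh_index w)%N && (pval i j w <= order_pval w (bh_index w)).

Definition wrong_sign (i j : 'I_m) (w : Omega) : bool :=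
  (0 < tstat i j w) && (mean i - mean j < 0) ||
  (tstat i j w < 0) && (0 < mean i - mean j).

Definition directional_error (i j : 'I_m) (w : Omega) : bool :=
  [&& mean i - mean j != 0, rejected i j w & wrong_sign i j w] ||
  (mean i - mean j == 0) && rejected i j w.

(* With no rejection this is 0 / 0 = 0. *)
Definition dFDP (w : Omega) : R :=
  #|[set x in pairs | directional_error x.1 x.2 w]%SET|%:R /
  #|[set x in pairs | rejected x.1 x.2 w]%SET|%:R.

Definition dFDR : \bar R := ('E_(prob E)[dFDP])%E.

Definition dFDR_target : R :=
  alpha / 2 * (1 + #|null_pairs|%:R / npairs%:R).

End pairwise_comparisons.

(* Main.v *)
From HB Require Import structures.
Require Import Defs.
From mathcomp Require Import measurable_realfun lebesgue_measure.
From mathcomp Require Import ring lra zify.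

(* A directional error at a pair declares the sign of [mean i - mean j] against, or in
   the absence of, a true difference, so the errors are among the ordered pairs with
   [mean i <= mean j] and [tstat i j] large.  There are q + q0 such ordered pairs, and for
   each of them P(tstat i j >= z) is at most about [Phibar z], uniformly for
   z = O(sqrt (ln m)).  Hence at a rejection level u the number of errors should not exceed
   (q + q0) u / 2 by much, whereas the Benjamini-Hochberg rule makes at least u q / alpha
   rejections: the ratio is the target.

   Three points make this rigorous.  (1) Truncating the observations at N^(1/2 - a) turns
   the numerator of tstat into a sum of independent variables that are small and bounded;
   a Lindeberg exchange argument along the heat semigroup, with the errors weighted by the
   exponential moments of the partial sums, gives the moderate deviation bound
   P(S >= t) <= (1 + o(1)) Phibar(t), and Chernoff bounds control the sample variances.
   (2) The separated pair assumed to exist separates one of its two groups from every other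
   group, so at least m - 1 pairs are rejected and u >= 2 alpha / m.  Therefore only
   O(ln m) levels of a geometric grid matter.  (3) At each level the number of exceedances
   concentrates by Chebyshev's inequality: pairs without a common group are independent,
   and two distinct ordered pairs sharing a group have correlation at most
   kap = cU^2 / (1 + cU^2) < 1, so that their joint exceedance probability, of order
   exp(- z^2 / (1 + kap)), is negligible against the squared expectation. *)

Set Implicit Arguments.
Unset Strict Implicit.
Unset Printing Implicit Defensive.

Local Open Scope classical_set_scope.
Local Open Scope ring_scope.

(** * The standard normal distribution *)

Section standard_normal.
Context {R : realType}.
Implicit Types t d z : R.

(** The probabilities to be compared with [Phibar z] are as small as [alpha / m], so an additive
    error of Berry-Esseen type would be useless: every loss has to be a factor 1 + o(1). For this
    reason the Lindeberg errors carry the weight exp(- t (y - x)), whose average over a partial sum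
    is of order exp(- t^2 / 2), that is of order [Phibar t] up to a factor 1 + t. The step size
    [beta] is a negative power of n whereas 1 + z is O(sqrt (ln m)), so powers of 1 + z are harmless
    and a single bound on [beta * (1 + z) ^+ 8] pays for all of them. The random rejection level is
    rounded to a deterministic grid of ratio [lam]. One factor [lam] is lost by the rounding and a
    second one by replacing the reference tails with [Phibar]. The separation 8 cU^2 sqrt (ln m) is
    2 cU times 4 cU sqrt (ln m). The factor 2 cU is spent on the triangle inequality and on
    comparing standard errors, and the fluctuation of the sample means takes 9/4 sqrt (ln m). This
    leaves statistics above 17/10 sqrt (ln m), where the normal tail is o(1 / m). *)

Definition phi (z : R) : R := normal_peak 1 * expR (- (z ^+ 2 / 2)).

Lemma normal_pdf01 : normal_pdf 0 1 = phi.
Proof.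
rewrite normal_pdfE ?oner_eq0//; apply/funext => x.
by rewrite /normal_fun subr0 expr1n mulNr.
Qed.

Lemma normal_peak1_gt0 : 0 < normal_peak 1 :> R.
Proof. exact/normal_peak_gt0/oner_neq0. Qed.

Lemma normal_peak1_le1 : normal_peak 1 <= 1 :> R.
Proof.
rewrite /normal_peak invf_le1; last first.
  by rewrite sqrtr_gt0 expr1n mul1r pmulrn_rgt0// pi_gt0.
rewrite -[leLHS]sqrtr1 ler_wsqrtr// expr1n mul1r mulr2n.
by have := pi_ge2 R; lra.
Qed.

Lemma phi_gt0 z : 0 < phi z.
Proof. by rewrite mulr_gt0 ?normal_peak1_gt0 ?expR_gt0. Qed.

Lemma phi_le z : phi z <= expR (- (z ^+ 2 / 2)).
Proof. by rewrite ler_piMl ?expR_ge0// normal_peak1_le1. Qed.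

Lemma is_derive_phi z : is_derive z 1 phi (- (z * phi z)).
Proof.
have d1 : is_derive z 1 (fun x : R => - (x ^+ 2 / 2)) (- z).
  rewrite (_ : (fun _ => _) = (- (1 / 2) : R) *: (id * id : R -> R)); last first.
    by apply/funext => x; rewrite !fctE -![_ *: _]/(_ * _); field.
  by apply: is_derive_eq; rewrite -![_ *: _]/(_ * _); field.
have d2 := is_derive_expR (- (z ^+ 2 / 2)).
have d3 := @is_derive1_comp _ (@expR R) (fun x : R => - (x ^+ 2 / 2)) z _ _ d2 d1.
have := is_deriveZ (normal_peak 1) d3.
move/is_derive_eq; apply.
by rewrite -![_ *: _]/(_ * _) /phi; ring.
Qed.

Lemma is_derive_Phi t : is_derive t 1 (@Phi R) (phi t).
Proof.
have PhiE : @Phi R = fun x =>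
    (\int[lebesgue_measure]_(u in [set` Interval -oo%O (BRight x)]) phi u)%R.
  by apply/funext => x; rewrite /Phi /normal_prob normal_pdf01.
have t1 : t < t + 1 by rewrite ltrDl.
have intphi : lebesgue_measure.-integrable [set` Interval -oo%O (BRight (t + 1))]
    (EFin \o phi).
  apply: (@integrableS _ _ _ _ setT) => //.
  by have := @integrable_normal_pdf R 0 1; rewrite normal_pdf01.
have [|| dP dPE] := @continuous_FTC1 R phi -oo%O t (t + 1) t1 intphi.
- by rewrite /Order.lt/=.
- by rewrite -normal_pdf01; apply: continuous_normal_pdf; exact: oner_neq0.
rewrite PhiE; apply: DeriveDef; first exact: dP.
by rewrite -derive1E; exact: dPE.
Qed.

Lemma Phi_ge0 t : 0 <= Phi t.
Proof. by rewrite fine_ge0. Qed.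

Lemma Phi_le1 t : Phi t <= 1.
Proof.
by rewrite -lee_fin fineK ?fin_num_measure//; exact: probability_le1.
Qed.

Lemma Phibar_ge0 t : 0 <= Phibar t.
Proof. by rewrite subr_ge0 Phi_le1. Qed.

Lemma Phibar_le1 t : Phibar t <= 1.
Proof. by rewrite lerBlDr lerDl Phi_ge0. Qed.

Lemma is_derive_Phibar t : is_derive t 1 (@Phibar R) (- phi t).
Proof.
have := is_derive_Phi t => ?.
rewrite (_ : @Phibar R = cst 1 - @Phi R)//.
by apply: is_derive_eq; rewrite sub0r.
Qed.

Lemma continuous_Phibar : continuous (@Phibar R).
Proof.
move=> t; apply: differentiable_continuous; apply/derivable1_diffP.
by have [] := is_derive_Phibar t.
Qed.

Lemma Phibar_MVT t d : 0 <= d ->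
  exists2 c, t <= c <= t + d & Phibar t - Phibar (t + d) = phi c * d.
Proof.
move=> d0; have td : t <= t + d by rewrite lerDl.
have [||c] := @MVT_segment R (@Phibar R) (fun x => - phi x) _ _ td.
- by move=> x _; exact: is_derive_Phibar.
- exact/continuous_subspaceT/continuous_Phibar.
rewrite in_itv/= => ctd E; exists c => //.
by rewrite -opprB E mulNr opprK addrAC subrr add0r.
Qed.

Lemma Phibar_nincr : {homo (@Phibar R) : x y / x <= y >-> y <= x}.
Proof.
move=> x y xy; have [|c _] := @Phibar_MVT x (y - x); first by rewrite subr_ge0.
rewrite subrKC => E; rewrite -subr_ge0 E.
by rewrite mulr_ge0 ?subr_ge0// ltW// phi_gt0.
Qed.

Let idTR : measurableTypeR R -> R := idfun.

#[local] HB.instance Definition _ :=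
  @isMeasurableFun.Build _ _ _ _ idTR (@measurable_id _ _ setT).

Let idR : {RV (normal_prob 0 1 : probability _ R) >-> R} := idTR.

Lemma cvg_Phi_pinfty : (@Phi R) x @[x --> +oo] --> (1 : R).
Proof. by apply: fine_cvg; exact: (cvg_cdfy1 idR). Qed.

Lemma cvg_Phi_ninfty : (@Phi R) x @[x --> -oo] --> (0 : R).
Proof. by apply: fine_cvg; exact: (cvg_cdfNy0 idR). Qed.

(** Since [phi] is even, the sum has derivative 0; its constant value is its limit at infinity. *)
Lemma Phi_add_opp t : Phi t + Phi (- t) = 1.
Proof.
pose f (x : R) := Phi x + Phi (- x).
have df (x : R) : is_derive x 1 f 0.
  have := is_derive_Phi x => ?; have := is_derive_Phi (- x) => H.
  have ? : is_derive x 1 (@Phi R \o -%R) (- phi x).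
    by apply: is_derive_eq; rewrite /phi sqrrN mulrN1.
  by rewrite (_ : f = @Phi R + (@Phi R \o -%R))//; apply: is_derive_eq; rewrite subrr.
have fc (x y : R) : f x = f y.
  exact: is_derive_0_is_cst.
have fl : f x @[x --> +oo] --> (1 : R).
  rewrite -[1]addr0; apply: cvgD; first exact: cvg_Phi_pinfty.
  apply: (@cvg_comp _ _ _ -%R (@Phi R) _ -oo _ _ cvg_Phi_ninfty).
  move=> A [M [Mr HM]]; exists (- M); split; first by rewrite realN.
  by move=> x Mx; apply: HM; rewrite ltrNl.
have fl2 : f x @[x --> +oo] --> f t.
  by rewrite (_ : f = cst (f t)); [exact: cvg_cst|apply/funext => x; exact: fc].
exact: (cvg_unique _ fl2 fl).
Qed.

Lemma Phibar0 : Phibar (0 : R) = 1 / 2.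
Proof. by have := Phi_add_opp 0; rewrite oppr0 /Phibar; lra. Qed.

(** A lower bound of Mills type: [Phibar t] is at least the mass of an interval of length 1 / (1 +
    t) starting at t, on which [x ^+ 2 / 2] exceeds [t ^+ 2 / 2] by at most 1 + 1/2. It converts
    Gaussian exponentials back into multiples of [Phibar]. *)
Lemma phi_le_Phibar t : 0 <= t ->
  normal_peak 1 * expR (- (3/2)) * expR (- (t ^+ 2 / 2)) <= (1 + t) * Phibar t.
Proof.
move=> t0; have t1 : 0 < 1 + t by lra.
have d0 : 0 <= (1 + t)^-1 by rewrite invr_ge0 ltW.
have [c /andP[c1 c2] E] := Phibar_MVT t d0.
have : phi c * (1 + t)^-1 <= Phibar t.
  by rewrite -E lerBlDr lerDl Phibar_ge0.
rewrite ler_pdivrMr// mulrC => /(le_trans _); apply.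
rewrite /phi -mulrA ler_pM2l ?normal_peak1_gt0// -expRD ler_expR.
have td : t * (1 + t)^-1 <= 1 by rewrite ler_pdivrMr//; lra.
have d1 : (1 + t)^-1 <= 1 by rewrite invf_le1//; lra.
have c2' : c ^+ 2 <= (t + (1 + t)^-1) ^+ 2.
  by rewrite ler_sqr ?nnegrE//; [lra|rewrite addr_ge0].
have : (1 + t)^-1 ^+ 2 <= 1 by rewrite expr_le1.
move: c2'; set e := (1 + t)^-1 in td d1 *; nra.
Qed.

Lemma Phibar_gt0 t : 0 < Phibar t.
Proof.
wlog t0 : t / 0 <= t => [wh|].
  apply: (lt_le_trans (wh `|t| _)) => //.
  by apply: Phibar_nincr; exact: ler_norm.
have := phi_le_Phibar t0.
rewrite -(pmulr_rgt0 _ (_ : 0 < 1 + t)); last by lra.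
apply: lt_le_trans; rewrite !mulr_gt0 ?expR_gt0//; exact: normal_peak1_gt0.
Qed.

Lemma Phibar_decr : {homo (@Phibar R) : x y / x < y >-> y < x}.
Proof.
move=> x y xy; have [|c _] := @Phibar_MVT x (y - x); first by rewrite subr_ge0 ltW.
rewrite subrKC => E; rewrite -subr_gt0 E.
by rewrite mulr_gt0 ?subr_gt0// phi_gt0.
Qed.

Lemma Phibar_le_expR t : 0 <= t -> Phibar t <= expR (1/2) * expR (- (t ^+ 2 / 2)).
Proof.
move=> t0; have [t1|/ltW t1] := leP t 1.
  apply: (le_trans (Phibar_le1 t)); rewrite -expRD -[leLHS]expR0 ler_expR.
  have : t ^+ 2 <= 1 by rewrite expr_le1.
  lra.
apply: (@le_trans _ _ (phi t)); last first.
  rewrite (le_trans (phi_le t))// ler_peMl ?expR_ge0//.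
  by rewrite -[leLHS]expR0 ler_expR; lra.
rewrite /Phibar lerBlDr.
(* Beyond 1 the function [Phi + phi] has derivative [(1 - x) * phi x <= 0]. Letting u tend to
   infinity gives [Phibar t <= phi t]. *)
have key u : t <= u -> Phi u <= phi t + Phi t.
  move=> tu; have [||c] := @MVT_segment R (@Phi R + phi) (fun x => phi x - x * phi x) _ _ tu.
  - move=> x _; have := is_derive_Phi x => ?.
    have ? := is_derive_phi x.
    exact: is_deriveD.
  - apply: continuous_subspaceT => x; apply: continuousD.
      apply: differentiable_continuous; apply/derivable1_diffP.
      by have [] := is_derive_Phi x.
    by rewrite -normal_pdf01; apply: continuous_normal_pdf; exact: oner_neq0.
  rewrite in_itv/= => /andP[tc _] E.
  have : (phi c - c * phi c) * (u - t) <= 0.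
    rewrite -[X in (X - _)]mul1r -mulrBl -mulrA mulr_le0_ge0//.
      by rewrite subr_le0 (le_trans t1).
    by rewrite mulr_ge0 ?subr_ge0// ltW// phi_gt0.
  rewrite -E !fctE; have := phi_gt0 u; lra.
apply: (cvgr_to_le cvg_Phi_pinfty).
near=> u; apply: key; near: u; apply: nbhs_pinfty_ge; exact: num_real.
Unshelve. all: by end_near. Qed.

(** A shift that is small against 1 / (1 + t) costs only a factor: the mean value theorem gives
    [phi c * d] with [c >= t - d], and [phi_le_Phibar] absorbs the exponential. *)
Lemma Phibar_shift (eps : R) : 0 < eps -> exists2 eta : R, 0 < eta &
  forall t d, 0 <= t -> 0 <= d -> d * (1 + t) <= eta ->
    Phibar (t - d) <= (1 + eps) * Phibar t.
Proof.
(* In the exponent 5/2, 1 pays for [c >= t - d] with [t * d <= 1], and 3/2 is the loss in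
   [phi_le_Phibar]. *)
move=> eps0; pose K : R := expR (5/2).
have K0 : 0 < K := expR_gt0 _.
exists (Num.min 1 (eps / K)); first by rewrite lt_min ltr01 divr_gt0.
move=> t d t0 d0; rewrite le_min => /andP[dt1 dt2].
have [c /andP[c1 c2]] := Phibar_MVT (t - d) d0.
rewrite subrK => E.
rewrite mulrDl mul1r -lerBlDl E.
have cE : phi c <= normal_peak 1 * expR 1 * expR (- (t ^+ 2 / 2)).
  rewrite /phi -mulrA ler_pM2l ?normal_peak1_gt0// -expRD ler_expR.
  have : t * d <= 1 by nra.
  have [td|td] := leP 0 (t - d); nra.
have := phi_le_Phibar t0.
set p := normal_peak 1 in cE *; set e := expR (- (t ^+ 2 / 2)) in cE * => H.
have H2 : p * expR 1 * e <= K * ((1 + t) * Phibar t).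
  apply: le_trans (ler_wpM2l (ltW K0) H).
  rewrite -!mulrA (mulrCA K) ler_pM2l ?normal_peak1_gt0// (mulrA K) /K -expRD.
  by rewrite ler_pM2r ?expR_gt0// ler_expR; lra.
have PB := Phibar_ge0 t.
apply: (le_trans (ler_wpM2r d0 (le_trans cE H2))).
have : d * (1 + t) * K <= eps by rewrite -ler_pdivlMr.
nra.
Qed.

End standard_normal.

(** * Taylor bounds and the heat semigroup *)

Lemma eqW (R : realType) (x y : R) : x = y -> x <= y.
Proof. by move=> ->. Qed.

Section taylor_bounds.
Context {R : realType}.
Implicit Types x h v A : R.

(** Both orientations are allowed because the increment [h] will be the value of a centred random
    variable. *)
Definition between x h z := (x <= z <= x + h) || (x + h <= z <= x).

Lemma between_trans x h z w : between x h z -> between x (z - x) w -> between x h w.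
Proof.
by rewrite /between => /orP[]/andP[? ?] /orP[]/andP[? ?]; apply/orP; (have [?|?] := leP 0 h); (try by left; apply/andP; split; lra); right; apply/andP; split; lra.
Qed.

Lemma between_norm x h z : between x h z -> `|z - x| <= `|h|.
Proof.
move=> /orP[]/andP[? ?].
  by rewrite !ger0_norm; lra.
by rewrite !ler0_norm; lra.
Qed.

Lemma between_refl x h : between x h x.
Proof. by rewrite /between; have [?|?] := leP 0 h; apply/orP; [left|right]; apply/andP; split; lra. Qed.

Lemma mvt_bound (g dg : R -> R) x h A :
  (forall z, between x h z -> is_derive z 1 g (dg z)) ->
  (forall z, between x h z -> `|dg z| <= A) ->
  `|g (x + h) - g x| <= A * `|h|.
Proof.
move=> dgE dgA.
have cont a b : (forall z, a <= z <= b -> between x h z) ->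
    {within `[a, b], continuous g}.
  move=> ab; apply: derivable_within_continuous => z; rewrite in_itv/= => zab.
  by have [] := dgE _ (ab _ zab).
have [h0|/ltW h0] := leP 0 h.
  have xh : x <= x + h by rewrite lerDl.
  have sub z : x <= z <= x + h -> between x h z by move=> zh; apply/orP; left.
  have [||c] := @MVT_segment R g dg _ _ xh; last first.
  - rewrite in_itv/= => /sub xc ->; rewrite normrM addrAC subrr add0r.
    by rewrite ler_wpM2r// dgA.
  - exact: cont.
  - by move=> z; rewrite in_itv/= => /andP[z1 z2]; apply/dgE/sub; rewrite !ltW.
have xh : x + h <= x by rewrite gerDl.
have sub z : x + h <= z <= x -> between x h z by move=> zh; apply/orP; right.
have [||c] := @MVT_segment R g dg _ _ xh; last first.
- rewrite in_itv/= => /sub xc; rewrite distrC => ->; rewrite normrM.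
  by rewrite opprD addrA subrr add0r normrN ler_wpM2r// dgA.
- exact: cont.
- by move=> z; rewrite in_itv/= => /andP[z1 z2]; apply/dgE/sub; rewrite !ltW.
Qed.

Lemma taylor2_bound (f f1 f2 : R -> R) x h A :
  (forall z, between x h z -> is_derive z 1 f (f1 z)) ->
  (forall z, between x h z -> is_derive z 1 f1 (f2 z)) ->
  (forall z, between x h z -> `|f2 z| <= A) ->
  `|f (x + h) - f x - h * f1 x| <= A * `|h| ^+ 2.
Proof.
move=> df df1 f2A.
have A0 : 0 <= A by apply: le_trans (f2A x _); rewrite // between_refl.
have f1B z : between x h z -> `|f1 z - f1 x| <= A * `|h|.
  move=> zx; apply: (@le_trans _ _ (A * `|z - x|)); last first.
    by rewrite ler_wpM2l// between_norm.
  rewrite -{1}(subrKC x z); apply: (@mvt_bound f1 f2) => y yz.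
  - exact/df1/(between_trans zx).
  - exact/f2A/(between_trans zx).
have dg z : between x h z ->
    is_derive z 1 (fun w => f w - f1 x * w) (f1 z - f1 x).
  move=> zx; have ? := df z zx.
  rewrite (_ : (fun _ => _) = f - (f1 x \*: id))//.
  by apply: is_derive_eq; rewrite -![_ *: _]/(_ * _) mulr1.
have := mvt_bound dg f1B.
rewrite expr2 mulrA; apply: le_trans.
by apply: eqW; congr (`|_|); ring.
Qed.

Lemma taylor3_bound (f f1 f2 f3 : R -> R) x h A :
  (forall z : R, is_derive z 1 f (f1 z)) ->
  (forall z : R, is_derive z 1 f1 (f2 z)) ->
  (forall z : R, is_derive z 1 f2 (f3 z)) ->
  (forall z, between x h z -> `|f3 z| <= A) ->
  `|f (x + h) - f x - h * f1 x - h ^+ 2 / 2 * f2 x| <= A * `|h| ^+ 3.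
Proof.
move=> df df1 df2 f3A.
have A0 : 0 <= A by apply: le_trans (f3A x _); rewrite // between_refl.
have f1B z : between x h z ->
    `|f1 z - f1 x - (z - x) * f2 x| <= A * `|h| ^+ 2.
  move=> zx; apply: (@le_trans _ _ (A * `|z - x| ^+ 2)); last first.
    by apply: ler_wpM2l => //; rewrite lerXn2r ?nnegrE// between_norm.
  rewrite -{1}(subrKC x z); apply: (@taylor2_bound f1 f2 f3) => // y yz.
  exact/f3A/(between_trans zx).
have dg z : between x h z ->
    is_derive z 1 (fun w => f w - f1 x * w - f2 x / 2 * ((w - x) * (w - x)))
      (f1 z - f1 x - (z - x) * f2 x).
  move=> zx; have ? := df z.
  rewrite (_ : (fun _ => _) =
    f - (f1 x \*: id) - (f2 x / 2 \*: ((id - cst x) * (id - cst x))))//.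
  by apply: is_derive_eq; rewrite -![_ *: _]/(_ * _) !fctE; field.
have H := mvt_bound dg f1B.
rewrite [X in _ <= _ * X]exprSr mulrA; apply: le_trans H.
by apply: eqW; congr (`|_|); field.
Qed.

End taylor_bounds.

Section heat.
Context {R : realType}.
Variable y : R.
Implicit Types s x z t h v lam beta xi : R.

(** For s > 0 this is the probability that x + sqrt(s) Z >= y with Z standard normal, i.e. the heat
    semigroup at time s applied to the indicator of the half-line from y. *)
Definition heat s x : R := Phibar ((y - x) / Num.sqrt s).

Let arg s x := (y - x) / Num.sqrt s.

Let is_derive_arg s x : is_derive x 1 (arg s) (- (Num.sqrt s)^-1).
Proof.
rewrite (_ : arg s = (Num.sqrt s)^-1 \*: (cst y - id)); last first.
  by apply/funext => z; rewrite /arg mulrC.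
by apply: is_derive_eq; rewrite -![_ *: _]/(_ * _) sub0r mulrN1.
Qed.

Let is_derive_zphi z : is_derive z 1 (fun z : R => z * phi z) ((1 - z ^+ 2) * phi z).
Proof.
have ? := is_derive_phi z.
rewrite (_ : (fun _ => _) = id * phi)//; apply: is_derive_eq.
by rewrite -![_ *: _]/(_ * _); ring.
Qed.

Definition heat_x s x := phi (arg s x) / Num.sqrt s.
Definition heat_xx s x := arg s x * phi (arg s x) / Num.sqrt s ^+ 2.
Definition heat_xxx s x := (arg s x ^+ 2 - 1) * phi (arg s x) / Num.sqrt s ^+ 3.
Definition heat_ss s x :=
  (arg s x ^+ 3 - 3 * arg s x) * phi (arg s x) / (4 * s ^+ 2).

Lemma is_derive_heat s x : is_derive x 1 (heat s) (heat_x s x).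
Proof.
rewrite (_ : heat s = @Phibar R \o arg s)//.
have := is_derive1_comp (is_derive_Phibar (arg s x)) (is_derive_arg s x).
by move/is_derive_eq; apply; rewrite mulrNN.
Qed.

Lemma is_derive_heat_x s x : is_derive x 1 (heat_x s) (heat_xx s x).
Proof.
rewrite (_ : heat_x s = (Num.sqrt s)^-1 \*: (phi \o arg s)); last first.
  by apply/funext => z; rewrite /heat_x mulrC.
have := is_derive1_comp (is_derive_phi (arg s x)) (is_derive_arg s x).
move/(is_deriveZ (Num.sqrt s)^-1)/is_derive_eq; apply.
by rewrite -![_ *: _]/(_ * _) /heat_xx -exprVn; ring.
Qed.

Lemma is_derive_heat_xx s x : is_derive x 1 (heat_xx s) (heat_xxx s x).
Proof.
rewrite (_ : heat_xx s = (Num.sqrt s ^+ 2)^-1 \*: ((fun z => z * phi z) \o arg s)); last first.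
  by apply/funext => z; rewrite /heat_xx mulrC.
have := is_derive1_comp (is_derive_zphi (arg s x)) (is_derive_arg s x).
move/(is_deriveZ (Num.sqrt s ^+ 2)^-1)/is_derive_eq; apply.
by rewrite -![_ *: _]/(_ * _) /heat_xxx -!exprVn; ring.
Qed.

Let is_derive_arg_s s x : 0 < s ->
  is_derive s 1 (arg^~ x) (- (arg s x / (2 * s))).
Proof.
move=> s0; have s'0 : Num.sqrt s != 0 by rewrite gt_eqF// sqrtr_gt0.
have d := is_derive1_sqrt s0.
have := is_deriveZ (y - x) (is_deriveV s'0 d).
rewrite (_ : (_ \*: _) = arg^~ x) //; move/is_derive_eq; apply.
rewrite -![_ *: _]/(_ * _) /arg -{4}(@sqr_sqrtr _ s) ?ltW//.
by field.
Qed.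

(** The heat equation. It makes the second-order terms cancel when a variable is exchanged for heat
    time equal to its variance. *)
Lemma is_derive_heat_s s x : 0 < s ->
  is_derive s 1 (heat^~ x) (heat_xx s x / 2).
Proof.
move=> s0; have s'0 : Num.sqrt s != 0 by rewrite gt_eqF// sqrtr_gt0.
rewrite (_ : heat^~ x = @Phibar R \o arg^~ x)//.
have := @is_derive1_comp _ (@Phibar R) (arg^~ x) s _ _
  (is_derive_Phibar (arg s x)) (is_derive_arg_s x s0).
move/is_derive_eq; apply; rewrite /heat_xx sqr_sqrtr ?ltW//.
by field; exact: lt0r_neq0.
Qed.

Lemma is_derive_heat_ss s x : 0 < s ->
  is_derive s 1 (fun s => heat_xx s x / 2) (heat_ss s x).
Proof.
move=> s0.
have sn0 : s != 0 := lt0r_neq0 s0.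
have d1 := @is_derive1_comp _ (fun z => z * phi z) (arg^~ x) s _ _
  (is_derive_zphi (arg s x)) (is_derive_arg_s x s0).
have d2 := is_deriveV sn0 (is_derive_id s (1 : R)).
have := is_deriveM d1 d2.
have near_eq : \forall u \near s, heat_xx u x / 2 =
    1 / 2 * (arg u x * phi (arg u x) * u^-1).
  near=> u; have u0 : 0 < u by near: u; exact: lt_nbhsr.
  rewrite /heat_xx sqr_sqrtr ?ltW//; field.
  exact: lt0r_neq0.
move/(is_deriveZ (1/2)) => d3.
have near_eq' : \forall u \near s, 1 / 2 * (arg u x * phi (arg u x) * u^-1) = heat_xx u x / 2.
  by near=> u; symmetry; near: u; exact: near_eq.
have d4 := near_eq_is_derive near_eq' d3.
apply: (is_derive_eq d4); rewrite -![_ *: _]/(_ * _) /heat_ss !fctE; field.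
exact: sn0.
Unshelve. all: by end_near. Qed.

(** Gaussian decay is traded for exponential decay of rate [lam] by completing the square; the
    polynomial is absorbed by the remaining Gaussian in z - lam, since (1 + d)^3 <= exp(3 d) and 3 d
    <= d^2 / 2 + 9 / 2. *)
Lemma hermite_phi_bound z lam : 0 <= lam ->
  (1 + `|z|) ^+ 3 * phi z <=
  expR (9/2) * (1 + lam) ^+ 3 * expR (- (lam * z) + lam ^+ 2 / 2).
Proof.
move=> lam0; set d : R := `|z - lam|; have d0 : 0 <= d := normr_ge0 _.
have zd : 1 + `|z| <= (1 + lam) * (1 + d).
  have : `|z| <= d + lam.
    by rewrite -{1}(subrK lam z) (le_trans (ler_normD _ _))// (ger0_norm lam0).
  nra.
have d2 : d ^+ 2 = (z - lam) ^+ 2 by rewrite real_normK ?num_real.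
have e3 : (1 + d) ^+ 3 <= expR (9/2) * expR (d ^+ 2 / 2).
  apply: (@le_trans _ _ (expR d ^+ 3)).
    by rewrite lerXn2r ?nnegrE ?expR_ge0//; [lra|exact: expR_ge1Dx].
  by rewrite -expRM_natr -expRD ler_expR; have := sqr_ge0 (d - 3); lra.
apply: (@le_trans _ _ (((1 + lam) * (1 + d)) ^+ 3 * expR (- (z ^+ 2 / 2)))).
  apply: ler_pM (phi_le _); rewrite ?exprn_ge0 ?(ltW (phi_gt0 _)) ?addr_ge0//.
  by rewrite lerXn2r ?nnegrE// ?addr_ge0// mulr_ge0// addr_ge0.
rewrite exprMn (mulrC (expR (9/2))) -[leLHS]mulrA -[leRHS]mulrA.
rewrite ler_wpM2l ?exprn_ge0 ?addr_ge0//.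
 apply: (le_trans (ler_wpM2r (expR_ge0 _) e3)).
by rewrite -!expRD ler_expR d2; lra.
Qed.

(** One constant for the third space derivative and the second time derivative when the time is at
    least h^2. The power of h covers both s^(3/2) and s^2; the exponent 6 is 9/2 plus room for
    moving the base point along the Taylor segment. *)
Definition heat_cst t h : R := expR 6 * (2 * (1 + t)) ^+ 3 / h ^+ 4.

Lemma heat_cst_ge0 t h : 0 <= t -> 0 < h -> 0 <= heat_cst t h.
Proof.
move=> t0 h0; rewrite /heat_cst; rewrite divr_ge0 ?exprn_ge0 ?(ltW h0)//.
by rewrite mulr_ge0 ?expR_ge0// exprn_ge0// mulr_ge0// addr_ge0.
Qed.

(** Taken at [lam := t * Num.sqrt s], so that [lam * arg s x] becomes [t * (y - x)]: an exponential
    weight in x, which factorizes over independent summands. *)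
Let heat_gauss_bound s x t h : 0 <= t -> 0 < h -> h ^+ 2 <= s -> s <= 4 ->
  (1 + `|arg s x|) ^+ 3 * phi (arg s x) <=
  expR (9/2) * (2 * (1 + t)) ^+ 3 * expR (- (t * (y - x)) + t ^+ 2 * s / 2).
Proof.
move=> t0 h0 hs s4.
have s0 : 0 < s by apply: lt_le_trans hs; exact: exprn_gt0.
have r0 : 0 < Num.sqrt s by rewrite sqrtr_gt0.
have r2 : Num.sqrt s <= 2.
  by rewrite -(@ler_pXn2r _ 2) ?nnegrE ?(ltW r0)// sqr_sqrtr ?(ltW s0)//; lra.
have lam0 : 0 <= t * Num.sqrt s by rewrite mulr_ge0// ltW.
apply: (le_trans (hermite_phi_bound (arg s x) lam0)).
have -> : t * Num.sqrt s * arg s x = t * (y - x).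
  by rewrite /arg; field; rewrite gt_eqF.
rewrite exprMn sqr_sqrtr ?(ltW s0)// ler_wpM2r ?expR_ge0//.
rewrite ler_wpM2l ?expR_ge0// lerXn2r ?nnegrE//; [by rewrite addr_ge0|by rewrite mulr_ge0// addr_ge0|nra].
Qed.

Let heat_xxx_bound s x t h : 0 <= t -> 0 < h -> h <= 1 -> h ^+ 2 <= s -> s <= 4 ->
  `|heat_xxx s x| <= expR (9/2) * (2 * (1 + t)) ^+ 3 / h ^+ 4
    * expR (- (t * (y - x)) + t ^+ 2 * s / 2).
Proof.
move=> t0 h0 h1 hs s4.
have s0 : 0 < s by apply: lt_le_trans hs; exact: exprn_gt0.
have hr : h <= Num.sqrt s.
  by rewrite -(@ler_pXn2r _ 2) ?nnegrE ?sqrtr_ge0 ?(ltW h0)// sqr_sqrtr ?(ltW s0).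
have r0 : 0 < Num.sqrt s by apply: lt_le_trans hr.
rewrite /heat_xxx normrM normrM (gtr0_norm (phi_gt0 _)).
rewrite (@ger0_norm _ (_^-1)) ?invr_ge0 ?exprn_ge0 ?(ltW r0)//.
rewrite [leRHS]mulrAC; apply: ler_pM; rewrite ?invr_ge0 ?exprn_ge0 ?(ltW r0)//.
  by rewrite mulr_ge0// ltW ?phi_gt0.
  apply: le_trans (heat_gauss_bound _ t0 h0 hs s4).
  rewrite ler_wpM2r ?(ltW (phi_gt0 _))//.
  rewrite (le_trans (ler_normB _ _))// normrX normr1.
  have := normr_ge0 (arg s x); set z := `|_|; nra.
rewrite lef_pV2 ?posrE ?exprn_gt0// (@le_trans _ _ (h ^+ 3))//.
  by rewrite exprS ler_piMl// exprn_ge0 ?ltW.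
by rewrite lerXn2r ?nnegrE ?(ltW h0) ?(ltW r0).
Qed.

Let heat_ss_bound s x t h : 0 <= t -> 0 < h -> h ^+ 2 <= s -> s <= 4 ->
  `|heat_ss s x| <= expR (9/2) * (2 * (1 + t)) ^+ 3 / h ^+ 4
    * expR (- (t * (y - x)) + t ^+ 2 * s / 2).
Proof.
move=> t0 h0 hs s4.
have s0 : 0 < s by apply: lt_le_trans hs; exact: exprn_gt0.
rewrite /heat_ss 2!normrM (gtr0_norm (phi_gt0 _)).
have s20 : 0 < 4 * s ^+ 2 by rewrite mulr_gt0// exprn_gt0.
rewrite (@ger0_norm _ (_^-1)) ?invr_ge0 ?(ltW s20)//.
rewrite [leRHS]mulrAC; apply: ler_pM; rewrite ?invr_ge0 ?(ltW s20)//.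
  by rewrite mulr_ge0// ltW ?phi_gt0.
  apply: le_trans (heat_gauss_bound _ t0 h0 hs s4).
  rewrite ler_wpM2r ?(ltW (phi_gt0 _))//.
  rewrite (le_trans (ler_normB _ _))// normrX (normrM 3) normr_nat.
  have := normr_ge0 (arg s x); set z := `|_|; nra.
rewrite lef_pV2 ?posrE ?exprn_gt0//.
have : h ^+ 4 <= s ^+ 2 by rewrite (exprM h 2 2) lerXn2r ?nnegrE ?(sqr_ge0 h) ?(ltW s0).
nra.
Qed.

(** One exchange of the Lindeberg argument, pointwise in the increment [xi]: third-order expansion
    in space against second-order expansion in time. If [xi] has mean 0 and variance v, the terms in
    [heat_x] and [heat_xx] average to 0 and only the weighted error survives. *)
Lemma heat_step t h s v beta x xi :
  0 <= t -> 0 < h -> h <= 1 -> h ^+ 2 <= s -> 0 <= v -> s + v <= 4 ->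
  t * beta <= 1 -> v <= beta ^+ 2 -> `|xi| <= beta ->
  heat s (x + xi) <= heat (s + v) x + xi * heat_x s x
    + (xi ^+ 2 - v) / 2 * heat_xx s x
    + (`|xi| ^+ 3 + v ^+ 2) * (heat_cst t h * expR (- (t * (y - x)) + t ^+ 2 * s / 2)).
Proof.
move=> t0 h0 h1 hs v0 sv4 tb vb xb.
have s0 : 0 < s by apply: lt_le_trans hs; exact: exprn_gt0.
set B := heat_cst t h * _.
have H3 : `|heat s (x + xi) - heat s x - xi * heat_x s x - xi ^+ 2 / 2 * heat_xx s x|
    <= B * `|xi| ^+ 3.
  apply: (@taylor3_bound _ (heat s) (heat_x s) (heat_xx s) (heat_xxx s)).
  - exact: is_derive_heat.
  - exact: is_derive_heat_x.
  - exact: is_derive_heat_xx.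
  - move=> z /between_norm zx; apply: (le_trans (heat_xxx_bound _ t0 h0 h1 hs _)).
      lra.
    rewrite /B /heat_cst -[expR 6 * _ / _]mulrA -[expR (9/2) * _ / _]mulrA.
    rewrite ![expR _ * (_ / _)]mulrC -![_ / _ * _ * _]mulrA.
    rewrite ler_wpM2l ?divr_ge0 ?exprn_ge0 ?mulr_ge0 ?addr_ge0 ?(ltW h0)//.
    rewrite -!expRD ler_expR.
    have : t * (z - x) <= 1.
      have := ler_norm (z - x); nra.
    lra.
have H2 : `|heat (s + v) x - heat s x - v * (heat_xx s x / 2)| <= B * `|v| ^+ 2.
  have sz z : between s v z -> s <= z.
    by rewrite /between => /orP[]/andP[? ?]; lra.
  apply: (@taylor2_bound _ (heat^~ x) (fun s => heat_xx s x / 2) (heat_ss^~ x)).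
  - by move=> z /sz zs; apply: is_derive_heat_s; lra.
  - by move=> z /sz zs; apply: is_derive_heat_ss; lra.
  - move=> z zs; have sz' := sz _ zs.
    have vz : z <= s + v by case/orP : zs => /andP[? ?]; lra.
    apply: (le_trans (heat_ss_bound _ t0 h0 (le_trans hs sz') _)); first by lra.
    rewrite /B /heat_cst -[expR 6 * _ / _]mulrA -[expR (9/2) * _ / _]mulrA.
    rewrite ![expR _ * (_ / _)]mulrC -![_ / _ * _ * _]mulrA.
    rewrite ler_wpM2l ?divr_ge0 ?exprn_ge0 ?mulr_ge0 ?addr_ge0 ?(ltW h0)//.
    rewrite -!expRD ler_expR.
    have b0 : 0 <= beta by apply: le_trans xb.
    have : t ^+ 2 * (z - s) <= 1.
      apply: (@le_trans _ _ ((t * beta) ^+ 2)); last first.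
        by rewrite expr_le1// mulr_ge0.
      rewrite exprMn ler_wpM2l ?sqr_ge0//; lra.
    lra.
move: H3 H2; rewrite !ler_norml (ger0_norm v0) => /andP[_ H3] /andP[H2 _].
lra.
Qed.

End heat.

(** * Independence *)

Section independent_pair.
Context (d : measure_display) (T : measurableType d) (R : realType).
Variable P : probability T R.

Definition independent_pair d1 d2 (T1 : measurableType d1)
    (T2 : measurableType d2) (U : T -> T1) (V : T -> T2) : Prop :=
  forall A B, measurable A -> measurable B ->
    P (U @^-1` A `&` V @^-1` B) = (P (U @^-1` A) * P (V @^-1` B))%E.

(** Independence says that the joint law agrees with the product of the marginals on rectangles,
    hence everywhere. *)
Lemma independent_pair_tonelli d1 d2 (T1 : measurableType d1)
    (T2 : measurableType d2) (U : {RV P >-> T1}) (V : {RV P >-> T2})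
    (f : T1 * T2 -> \bar R) :
  independent_pair U V -> measurable_fun setT f -> (forall z, 0 <= f z)%E ->
  (\int[P]_w f (U w, V w) = \int[P]_w \int[P]_w' f (U w, V w'))%E.
Proof.
move=> UV mf f0.
have mUV : measurable_fun setT (fun w => (U w, V w)).
  exact/measurable_fun_pair.
pose UVf := mfun_Sub (mem_set mUV : _ \in mfun).
have joint A : measurable A ->
    (distribution P U \x distribution P V)%E A = distribution P UVf A.
  move=> mA; exact: product_measure_unique.
transitivity (\int[distribution P UVf]_z f z)%E.
  by rewrite ge0_integral_distribution.
transitivity (\int[distribution P U \x distribution P V]_z f z)%E.
  by apply: eq_measure_integral => A mA _; exact/esym/joint.
rewrite fubini_tonelli1//= ge0_integral_distribution//; last 2 first.
- exact: measurable_fun_fubini_tonelli_F.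
- by move=> x; exact: integral_ge0.
apply: eq_integral => w _ /=; rewrite /fubini_F ge0_integral_distribution//.
by apply: measurableT_comp => //; exact: measurable_pair1.
Qed.

Lemma independent_pair_tonelliD (U V : {RV P >-> R}) (f : R -> \bar R) :
  independent_pair U V -> measurable_fun setT f -> (forall z, 0 <= f z)%E ->
  (\int[P]_w f (U w + V w)%R = \int[P]_w \int[P]_w' f (U w + V w')%R)%E.
Proof.
move=> UV mf f0.
apply: (@independent_pair_tonelli _ _ _ _ U V (fun z => f (z.1 + z.2))) => //.
apply: measurableT_comp => //.
by apply: measurable_funD.
Qed.

End independent_pair.

Section blocks.
Context (d : measure_display) (T : measurableType d) (R : realType).
Variable P : probability T R.
Context (I : finType) (X : I -> {RV P >-> R}).
Hypothesis Xind : mutually_independent X.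
Implicit Types J : {set I}.

(** The pi-system of rectangles over the coordinates in [J], to which mutual independence applies as
    stated; it generates the sigma-algebra of the block. *)
Definition block_events J : set (set T) :=
  [set A | exists2 B : I -> set R, (forall a, measurable (B a)) &
           A = \bigcap_(a in [set` J]) (X a @^-1` B a)].

Lemma block_events_measurable J : block_events J `<=` measurable.
Proof.
move=> _ [B mB ->]; apply: fin_bigcap_measurable; first exact: finite_finset.
by move=> a _; rewrite -[_ @^-1` _]setTI; exact: measurable_funP.
Qed.

Lemma block_eventsT J : block_events J setT.
Proof. by exists (fun=> setT) => //; rewrite bigcapT. Qed.

Lemma block_events_setI J : setI_closed (block_events J).
Proof.
move=> _ _ [B mB ->] [B' mB' ->]; exists (fun a => B a `&` B' a).
  by move=> a; exact: measurableI.
by rewrite -bigcapI.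
Qed.

Lemma block_events_indep0 J1 J2 A1 A2 : {in J1, forall a, a \notin J2} ->
  block_events J1 A1 -> block_events J2 A2 ->
  P (A1 `&` A2) = (P A1 * P A2)%E.
Proof.
move=> J12 [B1 mB1 ->] [B2 mB2 ->].
pose B a := if a \in J1 then B1 a else B2 a.
have mB a : measurable (B a) by rewrite /B; case: ifP.
have B1E a : a \in J1 -> B a = B1 a by rewrite /B => ->.
have B2E a : a \in J2 -> B a = B2 a.
  by rewrite /B => aJ2; case: ifPn => // /J12; rewrite aJ2.
rewrite (_ : _ `&` _ = \bigcap_(a in [set` (J1 :|: J2)%SET]) (X a @^-1` B a)); last first.
  apply/seteqP; split => [w [w1 w2] a /=|w wB].
    rewrite inE => /orP[a1|a2]; first by rewrite B1E//; exact: w1.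
    by rewrite B2E//; exact: w2.
  split => a /= aJ; first by rewrite -B1E//; apply: wB; rewrite /= inE aJ.
  by rewrite -B2E//; apply: wB; rewrite /= inE aJ orbT.
rewrite !Xind//.
rewrite big_mkcond/= (bigID (mem J1))/= -!big_mkcondr/=.

congr (_ * _)%E.
  apply: eq_big => [a|a /andP[/B1E -> //]].
  by rewrite inE; case: (a \in J1).
apply: eq_big => [a|a /andP[aJ1]]; rewrite !inE.
  by case: (boolP (a \in J1)) => // /J12 /negbTE ->.
by rewrite (negbTE aJ1)/= => /B2E ->.
Qed.

(** With one event fixed, the restriction of P to it and a multiple of P are finite measures;
    agreeing on a pi-system they agree on the generated sigma-algebra. [step] does this for one
    block and is applied to each block in turn. *)
Lemma block_sigma_indep J1 J2 A1 A2 : {in J1, forall a, a \notin J2} ->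
  <<s block_events J1 >> A1 -> <<s block_events J2 >> A2 ->
  P (A1 `&` A2) = (P A1 * P A2)%E.
Proof.
have step J A : measurable A ->
    (forall C, block_events J C -> P (C `&` A) = (P C * P A)%E) ->
    forall C, <<s block_events J >> C -> P (C `&` A) = (P C * P A)%E.
  move=> mA H C sC.
  have PA0 : 0 <= fine (P A) by rewrite fine_ge0.
  pose m2 := mscale (NngNum PA0) P.
  have : mrestr P mA C = m2 C.
    apply: (@g_sigma_algebra_measure_unique _ _ _ (block_events J) _ (fun=> setT)) => //.
    - exact: block_events_measurable.
    - by move=> _; exact: block_eventsT.
    - by rewrite bigcup_const.
    - exact: block_events_setI.
    - move=> B JB; rewrite /m2 /= /mscale/= /mrestr H// muleC.
      by rewrite fineK// fin_num_measure.
    - move=> _; rewrite /mrestr (le_lt_trans (probability_le1 _ _)) ?ltry//.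
      by rewrite setTI.
  by rewrite /mrestr /m2 /mscale/= => ->; rewrite muleC fineK// fin_num_measure.
have sm J : <<s block_events J >> `<=` measurable.
  apply: smallest_sub; [exact: sigma_algebra_measurable|exact: block_events_measurable].
move=> J12 sA1 sA2; apply: (step J1) => //; first exact: (sm J2).
move=> C JC; rewrite setIC muleC; apply: (step J2) => //.
  exact: block_events_measurable JC.
move=> D JD; apply: (@block_events_indep0 J2 J1) => //.
by move=> a aJ2; apply/negP => /J12; rewrite aJ2.
Qed.

Definition block_measurable J (f : T -> R) : Prop :=
  @measurable_fun _ _ (g_sigma_algebraType (block_events J)) R setT f.

Lemma block_measurable_indep J1 J2 (f1 f2 : T -> R) :
  {in J1, forall a, a \notin J2} ->
  block_measurable J1 f1 -> block_measurable J2 f2 -> independent_pair P f1 f2.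
Proof.
move=> J12 m1 m2 A B mA mB; apply: (block_sigma_indep J12).
  by rewrite -[_ @^-1` _]setTI; exact: m1.
by rewrite -[_ @^-1` _]setTI; exact: m2.
Qed.

Lemma block_measurable_sum J (s : seq I) (g : I -> R -> R) :
  (forall a, measurable_fun setT (g a)) -> {subset s <= J} ->
  block_measurable J (fun w => \sum_(a <- s) g a (X a w)).
Proof.
move=> mg sJ; rewrite /block_measurable.
under eq_fun do rewrite big_seq big_mkcond/=.
apply: (@measurable_sum _ (g_sigma_algebraType (block_events J)) R setT I _
  (fun a w => if a \in s then g a (X a w) else 0)) => a.
case: (boolP (a \in s)) => [/sJ aJ|_]; last exact: measurable_cst.
apply: measurableT_comp => //.
move=> _ B mB; rewrite setTI; apply: sub_sigma_algebra.
exists (fun b => if b == a then B else setT); first by move=> b; case: ifP.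
apply/seteqP; split => [w wB b /= bJ|w /(_ a aJ)]; last by rewrite eqxx.
by case: ifPn => // /eqP ->.
Qed.

End blocks.

(** * Sums of bounded independent variables *)

Section expR_quadratic_bound.
Context {R : realType}.
Implicit Types y : R.

Let is_derive_expRN y : is_derive y 1 (fun x : R => expR (- x)) (- expR (- y)).
Proof.
have := @is_derive1_comp _ (@expR R) -%R y _ _ (is_derive_expR (- y))
  (is_deriveNid y 1).
by move/is_derive_eq; apply; rewrite mulrN1.
Qed.

Let is_derive_sqr2 y : is_derive y 1 (fun x : R => x ^+ 2 / 2) y.
Proof.
rewrite (_ : (fun _ => _) = (1 / 2 : R) \*: (id * id : R -> R)); last first.
  by apply/funext => x; rewrite -[RHS]/(1 / 2 * (x * x)); field.
by apply: is_derive_eq; rewrite -![_ *: _]/(_ * _); field.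
Qed.

Let derivable_cont (f df : R -> R) (A : set R) :
  (forall x : R, is_derive x 1 f (df x)) -> {within A, continuous f}.
Proof.
move=> df_; apply: continuous_subspaceT => x; apply: differentiable_continuous.
by apply/derivable1_diffP; have [] := df_ x.
Qed.

Let expR_quad_ge0 y : 0 <= y -> expR y <= 1 + y + y ^+ 2 / 2 * expR y.
Proof.
move=> y0; have e0 := expR_gt0 y.
(* Multiplied by [expR y], the inequality [h y >= h 0 = 1] is the claim. *)
pose h (x : R) : R := (1 + x) * expR (- x) + x ^+ 2 / 2.
have dh (x : R) : is_derive x 1 h (x * (1 - expR (- x))).
  have ? := is_derive_expRN x; have ? := is_derive_sqr2 x.
  rewrite (_ : h = (cst 1 + id) * (fun x : R => expR (- x)) + (fun x : R => x ^+ 2 / 2))//.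
  by apply: is_derive_eq; rewrite -![_ *: _]/(_ * _) !fctE; ring.
have [c] := @MVT_segment R h _ _ _ y0 (fun x _ => dh x) (derivable_cont dh).
rewrite in_itv/= => /andP[c0 _].
rewrite subr0 => H.
have h0 : h 0 = 1 by rewrite /h oppr0 expR0 expr0n/= mul0r !addr0 mul1r.
have : 0 <= c * (1 - expR (- c)) * y.
  by rewrite !mulr_ge0// subr_ge0 -[leRHS]expR0 ler_expR oppr_le0.
rewrite -H h0 subr_ge0 /h expRN -(ler_pM2r e0) mul1r mulrDl.
by rewrite -[_ / _ * expR y]mulrA mulVf ?gt_eqF// mulr1.
Qed.

Let expR_quad_le0 y : y <= 0 -> expR y <= 1 + y + y ^+ 2 / 2.
Proof.
move=> y0.
pose h (x : R) : R := (1 + x) + x ^+ 2 / 2 - expR x.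
have dh (x : R) : is_derive x 1 h (1 + x - expR x).
  have ? := is_derive_sqr2 x.
  rewrite (_ : h = (cst 1 + id) + (fun x : R => x ^+ 2 / 2) - expR)//.
  by apply: is_derive_eq; rewrite add0r.
have [c _] := @MVT_segment R h _ _ _ y0 (fun x _ => dh x) (derivable_cont dh).
rewrite /h expR0 expr0n/= mul0r !addr0 subrr sub0r => H.
have : (1 + c - expR c) * (0 - y) <= 0.
  by rewrite mulr_le0_ge0// ?sub0r ?oppr_ge0// subr_le0 expR_ge1Dx.
by rewrite -H; lra.
Qed.

(** The exponential factor stays on the quadratic term so that its coefficient tends to 1/2 for
    small y; a fixed larger constant would spoil the Gaussian exponent. *)
Lemma expR_le_quad y : expR y <= 1 + y + y ^+ 2 / 2 * expR `|y|.
Proof.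
have [y0|/ltW y0] := leP 0 y; first by rewrite ger0_norm// expR_quad_ge0.
apply: (le_trans (expR_quad_le0 y0)); rewrite lerD2l ler_peMr//.
  by rewrite divr_ge0 ?sqr_ge0.
by rewrite -[leLHS]expR0 ler_expR.
Qed.

End expR_quadratic_bound.

Section bounded_expectation.
Context (d : measure_display) (T : measurableType d) (R : realType).
Variable P : probability T R.
Implicit Types f g : T -> R.

(** Intended for bounded variables: after truncation everything averaged is bounded, so linearity
    and monotonicity ask only for [bounded_mfun]. *)
Definition Ex f : R := \int[P]_w f w.

Definition bounded_mfun f : Prop :=
  measurable_fun setT f /\ exists M, forall w, `|f w| <= M.

Lemma bounded_integrable f : bounded_mfun f -> P.-integrable setT (EFin \o f).
Proof.
move=> [mf [M fM]]; apply: measurable_bounded_integrable => //.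
  by rewrite (le_lt_trans (probability_le1 _ _)) ?ltry.
exists M; split; first exact: num_real.
by move=> N MN w _ /=; rewrite (le_trans (fM w))// ltW.
Qed.

Lemma bounded_mfun_cst (c : R) : bounded_mfun (fun=> c).
Proof. by split; [exact: measurable_cst|exists `|c|]. Qed.

Lemma bounded_mfunD f g :
  bounded_mfun f -> bounded_mfun g -> bounded_mfun (fun w => f w + g w).
Proof.
move=> [mf [M fM]] [mg [N gN]]; split; first exact: measurable_funD.
by exists (M + N) => w; rewrite (le_trans (ler_normD _ _))// lerD.
Qed.

Lemma bounded_mfunM f g :
  bounded_mfun f -> bounded_mfun g -> bounded_mfun (fun w => f w * g w).
Proof.
move=> [mf [M fM]] [mg [N gN]]; split; first exact: measurable_funM.
by exists (M * N) => w; rewrite normrM ler_pM.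
Qed.

Lemma bounded_mfunZ (c : R) f : bounded_mfun f -> bounded_mfun (fun w => c * f w).
Proof. by move=> bf; apply: bounded_mfunM => //; exact: bounded_mfun_cst. Qed.

Lemma bounded_mfun_indic (A : set T) : measurable A -> bounded_mfun (\1_A).
Proof.
move=> mA; split; first exact: measurable_indic.
by exists 1 => w; rewrite indicE; case: (_ \in _); rewrite ?normr1 ?normr0.
Qed.

Lemma bounded_mfun_sum (I : Type) (s : seq I) (F : I -> T -> R) :
  (forall i, bounded_mfun (F i)) -> bounded_mfun (fun w => \sum_(i <- s) F i w).
Proof.
move=> bF; elim: s => [|i s IH].
  by under eq_fun do rewrite big_nil; exact: bounded_mfun_cst.
by under eq_fun do rewrite big_cons; exact: bounded_mfunD.
Qed.

Lemma ExD f g : bounded_mfun f -> bounded_mfun g ->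
  Ex (fun w => f w + g w) = Ex f + Ex g.
Proof. by move=> bf bg; rewrite /Ex RintegralD//; exact: bounded_integrable. Qed.

Lemma ExZ (c : R) f : bounded_mfun f -> Ex (fun w => c * f w) = c * Ex f.
Proof. by move=> bf; rewrite /Ex RintegralZl//; exact: bounded_integrable. Qed.

Lemma Ex_cst (c : R) : Ex (fun=> c) = c.
Proof. by rewrite /Ex Rintegral_cst// [X in fine X]probability_setT mulr1. Qed.

Lemma Ex_le f g : bounded_mfun f -> bounded_mfun g -> (forall w, f w <= g w) ->
  Ex f <= Ex g.
Proof.
by move=> bf bg fg; apply: le_Rintegral => //; exact: bounded_integrable.
Qed.

Lemma Ex_ge0 f : (forall w, 0 <= f w) -> 0 <= Ex f.
Proof. by move=> f0; exact: Rintegral_ge0. Qed.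

Lemma Ex_sum (I : Type) (s : seq I) (F : I -> T -> R) :
  (forall i, bounded_mfun (F i)) ->
  Ex (fun w => \sum_(i <- s) F i w) = \sum_(i <- s) Ex (F i).
Proof.
move=> bF; elim: s => [|i s IH].
  by rewrite big_nil -[RHS]Ex_cst; congr Ex; apply/funext => w; rewrite big_nil.
rewrite big_cons -IH -ExD//; last exact: bounded_mfun_sum.
by congr Ex; apply/funext => w; rewrite big_cons.
Qed.

Lemma EFin_Ex f : bounded_mfun f -> (Ex f)%:E = (\int[P]_w (f w)%:E)%E.
Proof.
by move=> /bounded_integrable bf; rewrite fineK//; exact: integrable_fin_num.
Qed.

Lemma Ex_indic (A : set T) : measurable A -> (Ex \1_A)%:E = P A.
Proof.
by move=> mA; rewrite EFin_Ex ?integral_indic ?setIT//; exact: bounded_mfun_indic.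
Qed.

Lemma prob_le_Ex (A : set T) f : measurable A -> bounded_mfun f ->
  (forall w, 0 <= f w) -> (forall w, A w -> 1 <= f w) -> (P A <= (Ex f)%:E)%E.
Proof.
move=> mA bf f0 Af; rewrite -Ex_indic// lee_fin.
apply: Ex_le => //; first exact: bounded_mfun_indic.
move=> w; rewrite indicE; case: (boolP (w \in A)) => [|//].
by rewrite inE => /Af.
Qed.

Lemma bounded_mfun_preimage (U : T -> R) (f : R -> R) (M C : R) :
  measurable_fun setT U -> measurable_fun setT f ->
  (forall w, `|U w| <= M) -> (forall x, `|x| <= M -> `|f x| <= C) ->
  bounded_mfun (fun w => f (U w)).
Proof.
move=> mU mf UM fC; split; first exact: measurableT_comp.
by exists C => w; exact: fC.
Qed.

Lemma measurable_gt_set f (x : R) : measurable_fun setT f ->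
  measurable [set w | x < f w].
Proof.
move=> mf; rewrite (_ : [set _ | _] = f @^-1` `]x, +oo[%classic).
  by rewrite -[X in measurable X]setTI; exact: mf.
by apply/seteqP; split => w /=; rewrite in_itv/= andbT.
Qed.

Lemma measurable_lt_set f (x : R) : measurable_fun setT f ->
  measurable [set w | f w < x].
Proof.
move=> mf; rewrite (_ : [set _ | _] = f @^-1` `]-oo, x[%classic).
  by rewrite -[X in measurable X]setTI; exact: mf.
by apply/seteqP; split => w /=; rewrite in_itv.
Qed.

Lemma measurable_ge_set f (x : R) : measurable_fun setT f ->
  measurable [set w | x <= f w].
Proof.
move=> mf; rewrite (_ : [set _ | _] = f @^-1` `[x, +oo[); last first.
  by apply/seteqP; split => w /=; rewrite in_itv/= andbT.
by rewrite -[X in measurable X]setTI; exact: mf.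
Qed.

Lemma bounded_mfun_Ex (U V : T -> R) (f : R -> R) :
  bounded_mfun U -> bounded_mfun V ->
  measurable_fun setT f -> (forall x, 0 <= f x) ->
  (forall M, exists C, forall x, `|x| <= M -> `|f x| <= C) ->
  bounded_mfun (fun w => Ex (fun w' => f (U w + V w'))).
Proof.
move=> [mU [M UM]] [mV [N VN]] mf f0 fbd.
have [C fC] := fbd (M + N).
have bnd w w' : `|f (U w + V w')| <= C.
  by apply: fC; rewrite (le_trans (ler_normD _ _))// lerD.
have bin w : bounded_mfun (fun w' => f (U w + V w')).
  by split; [apply: measurableT_comp => //; exact: measurable_funD|exists C].
split; last first.
  exists C => w; rewrite ger0_norm ?Ex_ge0// -[leRHS]Ex_cst.
  apply: Ex_le => //; first exact: bounded_mfun_cst.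
  by move=> w'; rewrite (le_trans (ler_norm _)).
rewrite /Ex /Rintegral; apply: measurableT_comp => //.
have mF : measurable_fun setT (fun z : T * T => (f (U z.1 + V z.2))%:E).
  apply/measurable_EFinP; apply: measurableT_comp => //.
  by apply: measurable_funD; exact: measurableT_comp.
apply: (@measurable_fun_fubini_tonelli_F _ _ _ _ _ P _ mF) => z.
by rewrite lee_fin.
Qed.

Lemma Ex_tonelli (U V : T -> R) (f : R -> R) :
  bounded_mfun U -> bounded_mfun V -> independent_pair P U V ->
  measurable_fun setT f -> (forall x, 0 <= f x) ->
  (forall M, exists C, forall x, `|x| <= M -> `|f x| <= C) ->
  Ex (fun w => f (U w + V w)) = Ex (fun w => Ex (fun w' => f (U w + V w'))).
Proof.
move=> [mU [M UM]] [mV [N VN]] UV mf f0 fbd.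
have [C fC] := fbd (M + N).
have bnd w w' : `|f (U w + V w')| <= C.
  by apply: fC; rewrite (le_trans (ler_normD _ _))// lerD.
have bin w : bounded_mfun (fun w' => f (U w + V w')).
  by split; [apply: measurableT_comp => //; exact: measurable_funD|exists C].
have bdiag : bounded_mfun (fun w => f (U w + V w)).
  by split; [apply: measurableT_comp => //; exact: measurable_funD|exists C].
pose U' := mfun_Sub (mem_set mU : _ \in mfun).
pose V' := mfun_Sub (mem_set mV : _ \in mfun).
have := @independent_pair_tonelliD _ _ _ P U' V' (EFin \o f) UV _ _.
rewrite /Ex /Rintegral => ->//.
- congr fine; apply: eq_integral => w _ /=.
  by rewrite -EFin_Ex.
- exact/measurable_EFinP.
Qed.

End bounded_expectation.

Section bounded_independent_sums.
Context (d : measure_display) (T : measurableType d) (R : realType).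
Variable P : probability T R.
Context (I : finType) (X : I -> {RV P >-> R}) (g : I -> R -> R).
Hypothesis Xind : mutually_independent X.
Hypothesis mg : forall a, measurable_fun setT (g a).
Variable beta : R.
Local Notation zeta a := (fun w => g a (X a w)).
Local Notation E := (Ex P).
Hypothesis zeta_bnd : forall a w, `|zeta a w| <= beta.
Hypothesis zeta_mean : forall a, E (zeta a) = 0.
Local Notation v a := (E (fun w => zeta a w ^+ 2)).
Local Notation W s := (fun w => \sum_(a <- s) g a (X a w)).

Let bzeta a : bounded_mfun (zeta a).
Proof. by split; [exact: measurableT_comp|exists beta]. Qed.

Let bzeta2 a : bounded_mfun (fun w => zeta a w ^+ 2).
Proof. by under eq_fun do rewrite expr2; exact: bounded_mfunM. Qed.

Let bW s : bounded_mfun (W s).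
Proof. by apply: (@bounded_mfun_sum _ _ _ _ _ (fun a => zeta a)). Qed.

Let v_ge0 a : 0 <= v a.
Proof. by apply: Ex_ge0 => w; exact: sqr_ge0. Qed.

Lemma indep_sum_cons a s : a \notin s -> independent_pair P (W s) (zeta a).
Proof.
move=> as_; apply: (@block_measurable_indep _ _ _ P I X Xind [set x in s]%SET [set a]%SET).
- by move=> b; rewrite !inE => bs; apply: contra as_ => /eqP <-.
- by apply: block_measurable_sum => // b; rewrite inE.
- rewrite (_ : zeta a = W [:: a]); last by apply/funext => w; rewrite big_seq1.
  by apply: block_measurable_sum => // b; rewrite !inE.
Qed.

Let expR_loc_bounded (t M : R) :
  exists C : R, forall x : R, `|x| <= M -> `|expR (t * x)| <= C.
Proof.
exists (expR (`|t| * M)) => x xM; rewrite ger0_norm ?expR_ge0// ler_expR.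
by rewrite (le_trans (ler_norm _))// normrM ler_wpM2l.
Qed.

Let mexpRM (t : R) : measurable_fun setT (fun x => expR (t * x)).
Proof. by apply: measurableT_comp => //; exact: measurable_funM. Qed.

Let bexp s (t : R) : bounded_mfun (fun w => expR (t * W s w)).
Proof.
have [mW [M WM]] := bW s; have [C H] := expR_loc_bounded t M.
exact: (bounded_mfun_preimage mW (mexpRM t) WM H).
Qed.

Lemma zeta_mgf a (t : R) : 0 <= t ->
  E (fun w => expR (t * zeta a w)) <= expR (t ^+ 2 * expR (t * beta) / 2 * v a).
Proof.
move=> t0; apply: le_trans (expR_ge1Dx _).
set k := t ^+ 2 * expR (t * beta) / 2.
have -> : 1 + k * v a = E (fun w => 1 + (t * zeta a w + k * zeta a w ^+ 2)).
  rewrite ExD ?ExD ?ExZ ?Ex_cst ?zeta_mean ?mulr0 ?add0r//.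
  - exact: bounded_mfunZ.
  - exact: bounded_mfunZ.
  - exact: bounded_mfun_cst.
  - by apply: bounded_mfunD; exact: bounded_mfunZ.
apply: Ex_le.
- have := bexp [:: a] t; rewrite (_ : (fun w => _) = (fun w => expR (t * zeta a w)))//.
  by apply/funext => w; rewrite big_seq1.
- apply: bounded_mfunD; first exact: bounded_mfun_cst.
  by apply: bounded_mfunD; exact: bounded_mfunZ.
move=> w; apply: (le_trans (expR_le_quad _)); rewrite addrA lerD2l.
have -> : k * zeta a w ^+ 2 = (t * zeta a w) ^+ 2 / 2 * expR (t * beta).
  by rewrite /k; ring.
rewrite ler_wpM2l ?divr_ge0 ?sqr_ge0// ler_expR normrM (ger0_norm t0).
by rewrite ler_wpM2l.
Qed.

Lemma sum_mgf s (t : R) : uniq s -> 0 <= t ->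
  E (fun w => expR (t * W s w)) <=
  expR (t ^+ 2 * expR (t * beta) / 2 * \sum_(a <- s) v a).
Proof.
move=> + t0; elim: s => [_|a s IH /= /andP[as_ us]].
  rewrite big_nil mulr0 expR0 -[leRHS](Ex_cst P 1).
  apply: eqW; congr Ex.
  by apply/funext => w; rewrite big_nil mulr0 expR0.
have -> : (fun w => expR (t * W (a :: s) w)) =
          (fun w => (fun x => expR (t * x)) (W s w + zeta a w)).
  by apply/funext => w; rewrite big_cons addrC.
rewrite (@Ex_tonelli _ _ _ P (W s) (zeta a) (fun x => expR (t * x)))//; last exact: indep_sum_cons.
rewrite big_cons mulrDr expRD.
have -> : (fun w => E (fun w' => expR (t * (W s w + zeta a w')))) =
    (fun w => E (fun w' => expR (t * zeta a w')) * expR (t * W s w)).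
  apply/funext => w; rewrite mulrC -ExZ; last first.
    have := bexp [:: a] t; rewrite (_ : (fun w => _) = (fun w => expR (t * zeta a w)))//.
    by apply/funext => w'; rewrite big_seq1.
  by congr Ex; apply/funext => w'; rewrite mulrDr expRD.
rewrite ExZ//; apply: ler_pM.
- by apply: Ex_ge0 => w; exact: expR_ge0.
- by apply: Ex_ge0 => w; exact: expR_ge0.
- exact: zeta_mgf.
- exact: IH.
Qed.

Lemma chernoff_sum s (t x B : R) : uniq s -> 0 <= t ->
  \sum_(a <- s) v a <= B ->
  (P [set w | (x <= W s w)%R] <=
   (expR (- (t * x) + t ^+ 2 * expR (t * beta) / 2 * B))%:E)%E.
Proof.
move=> us t0 sB.
have [mW _] := bW s.
apply: (@le_trans _ _ (E (fun w => expR (- (t * x)) * expR (t * W s w)))%:E).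
  apply: prob_le_Ex.
  - exact: measurable_ge_set.
  - exact: bounded_mfunZ.
  - by move=> w; rewrite mulr_ge0 ?expR_ge0.
  - move=> w /= xW; rewrite -expRD -[leLHS]expR0 ler_expR.
    by rewrite addrC subr_ge0 ler_wpM2l.
rewrite lee_fin ExZ// expRD ler_wpM2l ?expR_ge0//.
apply: (le_trans (sum_mgf us t0)); rewrite ler_expR ler_wpM2l//.
by rewrite !mulr_ge0 ?sqr_ge0 ?expR_ge0// invr_ge0.
Qed.

Lemma zeta_var_le a : v a <= beta ^+ 2.
Proof.
rewrite -[leRHS](Ex_cst P); apply: Ex_le => //; first exact: bounded_mfun_cst.
by move=> w; rewrite -(real_normK (num_real (zeta a w))) lerXn2r ?nnegrE// (le_trans _ (zeta_bnd a w)).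
Qed.

Lemma measurable_heat (y s : R) : measurable_fun setT (heat y s).
Proof.
apply: continuous_measurable_fun => x; apply: differentiable_continuous.
by apply/derivable1_diffP; have [] := is_derive_heat y s x.
Qed.

Lemma heat_bounded (y s x : R) : `|heat y s x| <= 1.
Proof. by rewrite ger0_norm ?Phibar_ge0// Phibar_le1. Qed.

Lemma bounded_mfun_heat (y s : R) (f : T -> R) : measurable_fun setT f ->
  bounded_mfun (fun w => heat y s (f w)).
Proof.
move=> mf; split; last by exists 1 => w; exact: heat_bounded.
by apply: measurableT_comp => //; exact: measurable_heat.
Qed.

(** Induction on the summands: conditionally on the others, the first one is exchanged for heat time
    [v a], after which the induction hypothesis applies at time [tau + v a]. The floor
    [h ^+ 2 <= tau] persists since the time only grows. Each error weight is averaged over the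
    remaining sum with [sum_mgf]. *)
Lemma lindeberg_sum s (y t h tau : R) : uniq s ->
  0 <= t -> 0 < h -> h <= 1 -> h ^+ 2 <= tau -> tau + \sum_(a <- s) v a <= 4 ->
  t * beta <= 1 -> beta <= 1 ->
  E (fun w => heat y tau (W s w)) <=
  heat y (tau + \sum_(a <- s) v a) 0 + 2 * beta * (\sum_(a <- s) v a) *
    (heat_cst t h *
     expR (- (t * y) + t ^+ 2 * expR (t * beta) / 2 * (tau + \sum_(a <- s) v a))).
Proof.
move=> + t0 h0 h1 + + tb b1; elim: s tau => [|a s IH] tau.
  move=> _ _ _; rewrite big_nil addr0 mulr0 mul0r addr0 -[leRHS](Ex_cst P).
  apply: eqW; congr Ex.
  by apply/funext => w; rewrite big_nil.
move=> /= /andP[as_ us] htau; rewrite big_cons; set V := \sum_(_ <- s) _ => tau4.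
have va := zeta_var_le a; have va0 := v_ge0 a.
have V0 : 0 <= V by rewrite sumr_ge0.
have b0 : 0 <= beta by exact: le_trans (zeta_bnd a point).
pose B x := heat_cst t h * expR (- (t * (y - x)) + t ^+ 2 * tau / 2).
have BE x : B x = heat_cst t h * expR (- (t * y) + t ^+ 2 * tau / 2) * expR (t * x).
  by rewrite /B -[RHS]mulrA -expRD; congr (_ * expR _); ring.
have B0 x : 0 <= B x by rewrite mulr_ge0 ?expR_ge0// heat_cst_ge0.
(* [heat_step] integrated over [zeta a]: the linear term vanishes by centring, the quadratic one by
   the choice of the variance, and both [|xi| ^+ 3] and [v ^+ 2] cost at most [beta * v a]. *)
have step x : E (fun w => heat y tau (x + zeta a w)) <=
    heat y (tau + v a) x + 2 * beta * v a * B x.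
  apply: (@le_trans _ _ (E (fun w => (heat y (tau + v a) x
      + (v a ^+ 2 * B x - v a / 2 * heat_xx y tau x))
      + (heat_x y tau x * zeta a w
      + (heat_xx y tau x / 2 + beta * B x) * zeta a w ^+ 2)))).
    apply: Ex_le.
    - by apply: bounded_mfun_heat; apply: measurable_funD => //; case: (bzeta a).
    - apply: bounded_mfunD; first exact: bounded_mfun_cst.
      by apply: bounded_mfunD; exact: bounded_mfunZ.
    - move=> w; have zb := zeta_bnd a w.
      apply: (le_trans (heat_step y x t0 h0 h1 htau va0 _ tb va zb)); first by lra.
      rewrite -/(B x).
      have : `|zeta a w| ^+ 3 <= beta * zeta a w ^+ 2.
        rewrite exprS real_normK ?num_real//.
        by rewrite ler_wpM2r ?sqr_ge0.
      have := B0 x.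
      set u := `|_| ^+ 3; set bx := B x; set hxx := heat_xx _ _ _; set hx := heat_x _ _ _.
      set z := g a (X a w); set h' := heat _ _ _; nra.
  rewrite ExD; last 2 first.
  - exact: bounded_mfun_cst.
  - by apply: bounded_mfunD; exact: bounded_mfunZ.
  rewrite Ex_cst ExD; last 2 first.
  - exact: bounded_mfunZ.
  - exact: bounded_mfunZ.
  rewrite !ExZ// zeta_mean mulr0 add0r.
  have : v a ^+ 2 <= beta * v a.
    by rewrite expr2 ler_wpM2r// (le_trans va)// expr2 ler_piMl.
  have := B0 x.
  set bx := B x; set hxx := heat_xx _ _ _; set h' := heat _ _ _; nra.
have -> : (fun w => heat y tau (W (a :: s) w)) =
          (fun w => heat y tau (W s w + zeta a w)).
  by apply/funext => w; rewrite big_cons addrC.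
rewrite (@Ex_tonelli _ _ _ P (W s) (zeta a) (heat y tau))//; last 4 first.
- exact: indep_sum_cons.
- exact: measurable_heat.
- by move=> x; exact: Phibar_ge0.
- by move=> M; exists 1 => x _; exact: heat_bounded.
have bh : bounded_mfun (fun w => heat y (tau + v a) (W s w)).
  by apply: bounded_mfun_heat; case: (bW s).
apply: (@le_trans _ _ (E (fun w => heat y (tau + v a) (W s w) +
   (2 * beta * v a * (heat_cst t h * expR (- (t * y) + t ^+ 2 * tau / 2))) * expR (t * W s w)))).
  apply: Ex_le.
  - apply: bounded_mfun_Ex => //; first exact: measurable_heat.
      by move=> x; exact: Phibar_ge0.
    by move=> M; exists 1 => x _; exact: heat_bounded.
  - by apply: bounded_mfunD => //; exact: bounded_mfunZ.
  - by move=> w; rewrite -mulrA -BE; exact: step.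
rewrite ExD//; last exact: bounded_mfunZ.
rewrite ExZ//.
have H1 : E (fun w => heat y (tau + v a) (W s w)) <=
  heat y (tau + v a + V) 0 + 2 * beta * V *
    (heat_cst t h *
     expR (- (t * y) + t ^+ 2 * expR (t * beta) / 2 * (tau + v a + V))).
  by apply: IH => //; rewrite -/V; lra.
set ee := expR (- (t * y) + _ * (_ + (_ + V))).
(* The weight left by the exchange, averaged over the remaining sum, is at most the weight [ee] of
   the full sum, so all the errors add up under a common factor. *)
have H2 : expR (- (t * y) + t ^+ 2 * tau / 2) * E (fun w => expR (t * W s w)) <= ee.
  apply: (le_trans (ler_wpM2l (expR_ge0 _) (sum_mgf us t0))).
  rewrite -expRD ler_expR -/V -addrA lerD2l mulrDr.
  have e1 : 1 <= expR (t * beta) by rewrite -[leLHS]expR0 ler_expR mulr_ge0.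
  have t2 : 0 <= t ^+ 2 / 2 by rewrite divr_ge0 ?sqr_ge0.
  have tau0 : 0 <= tau by apply: le_trans htau; exact: sqr_ge0.
  rewrite lerD//.
    rewrite [leRHS](_ : _ = t ^+ 2 * tau / 2 * expR (t * beta)); last by ring.
    by rewrite ler_peMr// divr_ge0// mulr_ge0// sqr_ge0.
  rewrite ler_wpM2l ?lerDr// !mulr_ge0 ?sqr_ge0 ?expR_ge0// invr_ge0//.
have hc0 := heat_cst_ge0 t0 h0.
apply: (@le_trans _ _ (heat y (tau + v a + V) 0 + 2 * beta * V * (heat_cst t h * ee)
   + 2 * beta * v a * (heat_cst t h * ee))).
  apply: lerD.
    by move: H1; rewrite /ee addrA.
  rewrite -[leLHS]mulrA; apply: ler_wpM2l; first by rewrite !mulr_ge0.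
  by rewrite -mulrA; exact: ler_wpM2l.
by rewrite -addrA -mulrDl -mulrDr (addrC V) addrA.
Qed.

End bounded_independent_sums.

(** * Moderate deviations *)

Section moderate_deviations.
Context {R : realType}.
Implicit Types (t h x eps eta beta : R).

Lemma expR_le_lin x : 0 <= x -> x <= 1 -> expR x <= 1 + 3 * x.
Proof.
move=> x0 x1; have := expR_le_quad x; rewrite ger0_norm//; have := expR_gt0 x.
have : x ^+ 2 <= 1 by rewrite expr_le1.
set e := expR x => x2 e0 H.
have e4 : e <= 4 by nra.
nra.
Qed.

(** Extracts from the single smallness hypothesis the bounds on [t ^+ k * beta] needed in various
    exponents. *)
Lemma powM_le1 (k : nat) t beta : (k <= 8)%N -> 0 <= t -> 0 <= beta ->
  beta * (1 + t) ^+ 8 <= 1 -> t ^+ k * beta <= 1.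
Proof.
move=> k8 t0 b0; apply: le_trans; rewrite mulrC ler_wpM2l//.
apply: (@le_trans _ _ ((1 + t) ^+ k)); first by rewrite lerXn2r ?nnegrE//; lra.
by rewrite ler_weXn2l//; lra.
Qed.

(** Origin of the power 8: [heat_cst] has three factors 1 + t from the cubic polynomial and four
    from the smoothing width eta / (1 + t), and converting exp(- t^2 / 2) into [Phibar t] takes one
    more. *)
Lemma heat_error_bound (eta : R) : 0 < eta -> exists2 C : R, 0 < C & forall t beta y,
  0 <= t -> 0 <= beta -> beta * (1 + t) ^+ 8 <= 1 -> eta <= 1 ->
  t - y <= (1 + t)^-1 ->
  2 * beta * (heat_cst t (eta / (1 + t)) *
     expR (- (t * y) + t ^+ 2 * expR (t * beta) / 2 * ((eta / (1 + t)) ^+ 2 + 1)))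
  <= C * (beta * (1 + t) ^+ 8) * Phibar t.
Proof.
move=> eta0.
pose c0 : R := normal_peak 1 * expR (- (3/2)).
have c00 : 0 < c0 by rewrite mulr_gt0 ?normal_peak1_gt0 ?expR_gt0.
exists (2 * (expR 6 * 2 ^+ 3 / eta ^+ 4) * expR 6 / c0).
  by rewrite !mulr_gt0 ?invr_gt0 ?exprn_gt0 ?expR_gt0.
move=> t beta y t0 b0 bt eta1 ty; set h := eta / (1 + t).
have t1 : 0 < 1 + t by lra.
have tb : t * beta <= 1 := @powM_le1 1 _ _ isT t0 b0 bt.
have t3b : t ^+ 3 * beta <= 1 := @powM_le1 3 _ _ isT t0 b0 bt.
have tb0 : 0 <= t * beta by rewrite mulr_ge0.
have e1 := expR_le_lin tb0 tb.
(* With t (t - y) <= 1, (t h)^2 exp(t beta) <= 4 and t^2 exp(t beta) <= t^2 + 3, the left side is at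
   most - t^2 / 2 + 1 + 2 + 3 / 2. *)
have expo : - (t * y) + t ^+ 2 * expR (t * beta) / 2 * (h ^+ 2 + 1)
    <= 6 - t ^+ 2 / 2.
  have ht : t * h <= eta.
    by rewrite /h mulrCA ler_piMr ?(ltW eta0)// ler_pdivrMr//; lra.
  have h0 : 0 <= h by rewrite divr_ge0 ?ltW.
  have th0 : 0 <= t * h by rewrite mulr_ge0.
  have th2 : (t * h) ^+ 2 <= 1 by rewrite expr_le1//; lra.
  have ty1 : t * (t - y) <= 1.
    apply: (le_trans (ler_wpM2l t0 ty)); rewrite ler_pdivrMr//; lra.
  have E4 : expR (t * beta) <= 4 by lra.
  have A1 : (t * h) ^+ 2 * expR (t * beta) <= 4.
    by rewrite -[leRHS]mul1r ler_pM ?sqr_ge0 ?expR_ge0.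
  have A2 : t ^+ 2 * expR (t * beta) <= t ^+ 2 + 3.
    apply: (le_trans (ler_wpM2l (sqr_ge0 t) e1)).
    have -> : t ^+ 2 * (1 + 3 * (t * beta)) = t ^+ 2 + 3 * (t ^+ 3 * beta) by ring.
    lra.
  move: A1 A2 ty1; rewrite exprMn; set e := expR _; set hh := h ^+ 2.
  have -> : t ^+ 2 * e / 2 * (hh + 1) = (t ^+ 2 * hh * e) / 2 + t ^+ 2 * e / 2.
    by field.
  lra.
have := phi_le_Phibar t0; rewrite -/c0 => mills.
have mills' : expR (- (t ^+ 2 / 2)) <= (1 + t) * Phibar t / c0.
  by rewrite ler_pdivlMr// mulrC.
have hcE : heat_cst t h = expR 6 * 2 ^+ 3 / eta ^+ 4 * (1 + t) ^+ 7.
  rewrite /heat_cst /h; field; rewrite !gt_eqF//; lra.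
rewrite hcE.
have hh0 : 0 <= expR 6 * 2 ^+ 3 / eta ^+ 4 * (1 + t) ^+ 7 :> R.
  by rewrite !mulr_ge0 ?invr_ge0 ?exprn_ge0 ?expR_ge0 ?ltW//.
have expo' : expR (- (t * y) + t ^+ 2 * expR (t * beta) / 2 * (h ^+ 2 + 1)) <=
    expR 6 * ((1 + t) * Phibar t / c0).
  apply: (@le_trans _ _ (expR 6 * expR (- (t ^+ 2 / 2)))).
    by rewrite -expRD ler_expR.
  by rewrite ler_wpM2l ?expR_ge0.
apply: (@le_trans _ _ (2 * beta * (expR 6 * 2 ^+ 3 / eta ^+ 4 * (1 + t) ^+ 7 *
    (expR 6 * ((1 + t) * Phibar t / c0))))).
  by rewrite ler_wpM2l ?mulr_ge0// ler_wpM2l.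
apply: eqW; field.
by rewrite !gt_eqF.
Qed.

(** The indicator of [W >= t] is at most a multiple of a heat profile of width [h] centred at
    [y = t - h * L]; [lindeberg_sum] replaces the sum by a normal variable, and [Phibar_shift] moves
    the level back to t. The threshold [eta] precedes the probability space, so the bound is uniform
    over all pairs and experiments. *)
Lemma moderate_deviation eps t0 : 0 < eps -> 0 < t0 -> exists2 eta : R, 0 < eta &
  forall (d : measure_display) (T : measurableType d) (P : probability T R)
    (I : finType) (X : I -> {RV P >-> R}) (g : I -> R -> R) (beta t : R),
  mutually_independent X -> (forall a, measurable_fun setT (g a)) ->
  (forall a w, `|g a (X a w)| <= beta) ->
  (forall a, Ex P (fun w => g a (X a w)) = 0) ->
  \sum_a Ex P (fun w => g a (X a w) ^+ 2) <= 1 ->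
  0 <= beta -> t0 <= t -> beta * (1 + t) ^+ 8 <= eta ->
  (P [set w | (t <= \sum_a g a (X a w))%R] <= ((1 + eps) * Phibar t)%:E)%E.
Proof.
(* One factor 1 + del comes from [Phi L] and 1 + 2 del from the Lindeberg bound; their product is at
   most 1 + 5 del. *)
move=> eps0 t00; pose del : R := Num.min 1 eps / 5.
have del0 : 0 < del by rewrite divr_gt0// lt_min ltr01.
have del1 : 5 * del <= 1 by rewrite mulrC divfK// ge_min lexx.
have deleps : 5 * del <= eps by rewrite mulrC divfK// ge_min lexx orbT.
have [L L0 PL] : exists2 L : R, 0 <= L & (1 + del)^-1 <= Phi L.
  have d1 : (1 + del)^-1 < 1 by rewrite invf_lt1; lra.
  near (pinfty_nbhs R) => L; exists L.
    by near: L; apply: nbhs_pinfty_ge; exact: num_real.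
  by rewrite ltW//; near: L; exact: (cvgr_gt _ cvg_Phi_pinfty).
have [etas etas0 shift] := Phibar_shift del0.
have L1 : 0 < 1 + L by lra.
(* The minimum with 1 and [etas] serves the error bound and the shift; the minimum with [t0] keeps y
   nonnegative. That sign matters because the variance is only bounded above: for y < 0 a small
   variance would increase the tail. *)
pose eta1 : R := Num.min (Num.min 1 etas) t0 / (1 + L).
have eta10 : 0 < eta1 by rewrite divr_gt0// !lt_min ltr01 etas0.
have eta1L : eta1 * (1 + L) = Num.min (Num.min 1 etas) t0 by rewrite divfK// gt_eqF.
have eta1a : eta1 * (1 + L) <= 1 by rewrite eta1L !ge_min lexx.
have eta1b : eta1 * (1 + L) <= etas by rewrite eta1L !ge_min lexx orbT.
have eta1c : eta1 * (1 + L) <= t0 by rewrite eta1L !ge_min lexx orbT.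
have eta11 : eta1 <= 1 by nra.
have [C C0 err] := heat_error_bound eta10.
exists (Num.min 1 (del / C)); first by rewrite lt_min ltr01 divr_gt0.
move=> d T P I X g beta t Xind mg gb gm gv b0 t0t.
rewrite le_min => /andP[bt1 bt2].
have tge0 : 0 <= t by rewrite (le_trans _ t0t)// ltW.
have t1 : 0 < 1 + t by lra.
pose h := eta1 / (1 + t).
have h0 : 0 < h by rewrite divr_gt0.
have h1 : h <= 1 by rewrite ler_pdivrMr//; lra.
have he : h <= eta1 by rewrite ler_pdivrMr// ler_peMr//; lra.
have hE : h * (1 + t) = eta1 by rewrite divfK// gt_eqF.
pose y := t - h * L.
have y0 : 0 <= y by rewrite /y; nra.
pose s := index_enum I.
have us : uniq s by exact: index_enum_uniq.
set V := \sum_a _ in gv.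
have V0 : 0 <= V by apply: sumr_ge0 => a _; apply: Ex_ge0 => w; exact: sqr_ge0.
have tb : t * beta <= 1 := @powM_le1 1 _ _ isT tge0 b0 bt1.
have b1 : beta <= 1 by have := @powM_le1 0 _ _ isT tge0 b0 bt1; rewrite expr0 mul1r.
pose W w := \sum_a g a (X a w).
have mW : measurable_fun setT W.
  apply: (@measurable_sum _ T R setT I _ (fun a w => g a (X a w))) => a.
  exact: measurableT_comp.
have Phi0 : 0 < Phi L by apply: lt_le_trans PL; rewrite invr_gt0; lra.
(* When W >= t, the argument (y - W) / h is at most - L, where [Phibar] is at least [Phi L]. *)
have step1 : (P [set w | (t <= W w)%R] <=
    (Ex P (fun w => (Phi L)^-1 * heat y (h ^+ 2) (W w)))%:E)%E.
  apply: prob_le_Ex.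
  - exact: measurable_ge_set.
  - by apply: bounded_mfunZ; exact: bounded_mfun_heat.
  - by move=> w; apply: mulr_ge0; [rewrite invr_ge0 ltW|exact: Phibar_ge0].
  - move=> w /= tW; rewrite mulrC ler_pdivlMr// mul1r /heat.
    rewrite sqrtr_sqr gtr0_norm//.
    have -> : Phi L = Phibar (- L) by rewrite /Phibar; have := Phi_add_opp L; lra.
    by apply: Phibar_nincr; rewrite ler_pdivrMr// /y; lra.
apply: (le_trans step1); rewrite lee_fin.
rewrite ExZ; last exact: bounded_mfun_heat.
have h22 : h ^+ 2 <= 1 by rewrite expr_le1// ltW.
have lind := @lindeberg_sum _ _ _ P I X g Xind mg beta gb gm s y t h (h ^+ 2)
  us tge0 h0 h1 (lexx _) _ tb b1.
have {}lind : Ex P (fun w => heat y (h ^+ 2) (W w)) <=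
    heat y (h ^+ 2 + V) 0 + 2 * beta * V *
    (heat_cst t h * expR (- (t * y) + t ^+ 2 * expR (t * beta) / 2 * (h ^+ 2 + V))).
  by apply: lind; rewrite -/V; lra.
have hc0 := heat_cst_ge0 tge0 h0.
have A1 : 2 * beta * V *
    (heat_cst t h * expR (- (t * y) + t ^+ 2 * expR (t * beta) / 2 * (h ^+ 2 + V)))
    <= del * Phibar t.
  apply: (@le_trans _ _ (2 * beta * (heat_cst t h *
     expR (- (t * y) + t ^+ 2 * expR (t * beta) / 2 * (h ^+ 2 + 1))))).
    apply: ler_pM.
    - by rewrite !mulr_ge0.
    - by apply: mulr_ge0 => //; exact: expR_ge0.
    - by rewrite ler_piMr// mulr_ge0.
    apply: ler_wpM2l => //; rewrite ler_expR lerD2l ler_wpM2l ?lerD2l//.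
    by rewrite !mulr_ge0 ?sqr_ge0 ?expR_ge0 ?invr_ge0.
  apply: (le_trans (err _ _ _ tge0 b0 bt1 eta11 _)).
    rewrite /y opprB addrC subrK -(ler_pM2r t1) mulrAC hE mulVf ?gt_eqF//; nra.
  rewrite ler_wpM2r ?Phibar_ge0// mulrC -ler_pdivlMr//.
have A2 : heat y (h ^+ 2 + V) 0 <= (1 + del) * Phibar t.
  (* The total shift: h L from the smoothing and t h^2 from the extra variance h^2, as the standard
     deviation is at most 1 + h^2. *)
  pose dd := h * L + t * h ^+ 2.
  apply: (@le_trans _ _ (Phibar (t - dd))).
    apply: Phibar_nincr; rewrite subr0.
    have r0 : 0 < Num.sqrt (h ^+ 2 + V) by rewrite sqrtr_gt0 ltr_wpDr// exprn_gt0.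
    have r1 : Num.sqrt (h ^+ 2 + V) <= 1 + h ^+ 2.
      rewrite -(@ler_pXn2r _ 2) ?nnegrE ?(ltW r0)//; last by rewrite addr_ge0// sqr_ge0.
      rewrite sqr_sqrtr ?addr_ge0 ?sqr_ge0//; have := sqr_ge0 h; nra.
    rewrite ler_pdivlMr// /dd.
    have -> : t - (h * L + t * h ^+ 2) = y - t * h ^+ 2 by rewrite /y; ring.
    have yt : y <= t by rewrite /y; nra.
    have := sqr_ge0 h; move: h22 r0 r1; set r := Num.sqrt _; set hh := h ^+ 2 => h22 r0 r1 hh0.
    clear -yt y0 tge0 h22 r0 r1 hh0.
    have [neg|pos] := leP (y - t * hh) 0; first nra.
    have : (y - t * hh) * r <= y * (1 - hh) * (1 + hh).
      by apply: ler_pM; rewrite ?(ltW pos) ?(ltW r0)//; nra.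
    nra.
  apply: shift => //.
    by rewrite /dd addr_ge0// mulr_ge0 ?sqr_ge0 ?(ltW h0).
  rewrite /dd mulrDl mulrAC hE.
  have -> : t * h ^+ 2 * (1 + t) = t * h * eta1 by rewrite -hE; ring.
  have : t * h <= 1 by nra.
  nra.
have PB := Phibar_gt0 t.
have E0 : Ex P (fun w => heat y (h ^+ 2) (W w)) <= (1 + 2 * del) * Phibar t by lra.
rewrite mulrC ler_pdivrMr//; apply: (le_trans E0).
have : (1 + del)^-1 * (1 + del) <= Phi L * (1 + del) by rewrite ler_wpM2r//; lra.
rewrite mulVf; last by rewrite gt_eqF//; lra.
move=> PLd.
rewrite mulrAC ler_wpM2r ?(ltW PB)//.
nra.
Unshelve. all: by end_near. Qed.

(** The sum of two statistics of correlation at most [kap], with the optimal tilt z / (1 + kap). In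
    the constant 5, 2 pays for the shift [del] and 3 for exp(lam beta) - 1. *)
Lemma chernoff_pair (d : measure_display) (T : measurableType d)
    (P : probability T R) (I : finType) (X : I -> {RV P >-> R})
    (g : I -> R -> R) (beta kap z del : R) :
  mutually_independent X -> (forall a, measurable_fun setT (g a)) ->
  (forall a w, `|g a (X a w)| <= beta) ->
  (forall a, Ex P (fun w => g a (X a w)) = 0) ->
  \sum_a Ex P (fun w => g a (X a w) ^+ 2) <= 2 * (1 + kap) ->
  0 <= kap -> 0 <= z -> 0 <= beta -> beta * (1 + z) ^+ 8 <= 1 ->
  del * (1 + z) <= 1 -> 0 <= del ->
  (P [set w | (2 * (z - del) <= \sum_a g a (X a w))%R] <=
   (expR (5 - z ^+ 2 / (1 + kap)))%:E)%E.
Proof.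
move=> Xind mg gb gm gv kap0 z0 b0 bz dz del0.
have k1 : 0 < 1 + kap by lra.
have lam0 : 0 <= z / (1 + kap) by rewrite divr_ge0// ltW.
have := @chernoff_sum _ _ _ P I X g Xind mg beta gb gm (index_enum I)
  (z / (1 + kap)) (2 * (z - del)) _ (index_enum_uniq I) lam0 gv.
move/le_trans; apply; rewrite lee_fin ler_expR.
set lam := z / (1 + kap); have lamz : lam <= z by rewrite ler_pdivrMr//; nra.
have z1 : 1 <= 1 + z by lra.
have zb : z ^+ 3 * beta <= 1 := @powM_le1 3 _ _ isT z0 b0 bz.
have zb1 : z * beta <= 1 := @powM_le1 1 _ _ isT z0 b0 bz.
have lb : lam * beta <= z * beta by rewrite ler_wpM2r.
have e1 : expR (lam * beta) <= 1 + 3 * (lam * beta).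
  by apply: expR_le_lin; [rewrite mulr_ge0|lra].
have lamE : lam * (1 + kap) = z by rewrite divfK// gt_eqF.
have -> : z ^+ 2 / (1 + kap) = lam * z by rewrite /lam; ring.
have -> : lam ^+ 2 * expR (lam * beta) / 2 * (2 * (1 + kap)) =
    lam * z * expR (lam * beta) by rewrite -lamE; field.
have A : lam * z * expR (lam * beta) <= lam * z + 3.
  apply: (le_trans (ler_wpM2l _ e1)); first by rewrite mulr_ge0.
  have : lam * z * (lam * beta) <= z ^+ 3 * beta.
    rewrite (_ : lam * z * (lam * beta) = lam ^+ 2 * (z * beta)); last by ring.
    rewrite (_ : z ^+ 3 * beta = z ^+ 2 * (z * beta)); last by ring.
    by rewrite ler_wpM2r ?mulr_ge0// lerXn2r ?nnegrE.
  lra.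
have : lam * del <= 1 by nra.
lra.
Qed.

(** Tilt x; since x beta <= 1/150 gives exp(x beta) <= 102/100, the exponent is at most (- 1 +
    51/100) x^2. *)
Lemma chernoff_single (d : measure_display) (T : measurableType d)
    (P : probability T R) (I : finType) (X : I -> {RV P >-> R})
    (g : I -> R -> R) (beta x : R) :
  mutually_independent X -> (forall a, measurable_fun setT (g a)) ->
  (forall a w, `|g a (X a w)| <= beta) ->
  (forall a, Ex P (fun w => g a (X a w)) = 0) ->
  \sum_a Ex P (fun w => g a (X a w) ^+ 2) <= 1 ->
  0 <= x -> 0 <= beta -> x * beta <= 1 / 150 ->
  (P [set w | (x <= \sum_a g a (X a w))%R] <=
   (expR (- (49 / 100 * x ^+ 2)))%:E)%E.
Proof.
move=> Xind mg gb gm gv x0 b0 xb.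
have := @chernoff_sum _ _ _ P I X g Xind mg beta gb gm (index_enum I)
  x x _ (index_enum_uniq I) x0 gv.
move/le_trans; apply; rewrite lee_fin ler_expR mulr1.
have e1 : expR (x * beta) <= 1 + 3 * (x * beta).
  by apply: expR_le_lin; [rewrite mulr_ge0|lra].
have : x ^+ 2 * expR (x * beta) <= x ^+ 2 * (102 / 100).
  by rewrite ler_wpM2l ?sqr_ge0//; lra.
rewrite expr2; lra.
Qed.

End moderate_deviations.

(** * Chebyshev's inequality for a sparsely dependent family *)

Section second_moment.
Context (d : measure_display) (T : measurableType d) (R : realType).
Variable P : probability T R.

(** Independent pairs contribute no covariance, and for dependent ones the product of the means is
    simply dropped, so [D] bounds the variance. As the mean is only known to be at most (1 + eps) M,
    the threshold is placed a further eps M above. *)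
Lemma dependent_chebyshev (K : finType) (Q : {set K}) (A : K -> set T)
    (dep : rel K) (D M eps : R) :
  (forall k, measurable (A k)) ->
  (forall k l, k \in Q -> l \in Q -> ~~ dep k l ->
     P (A k `&` A l) = (P (A k) * P (A l))%E) ->
  0 < eps -> 0 < M ->
  \sum_(k in Q) fine (P (A k)) <= (1 + eps) * M ->
  \sum_(k in Q) \sum_(l in Q | dep k l) fine (P (A k `&` A l)) <= D ->
  (P [set w | ((1 + 2 * eps) * M <= \sum_(k in Q) \1_(A k) w)%R] <=
   (D / (eps * M) ^+ 2)%:E)%E.
Proof.
move=> mA indep eps0 M0 meanM covD.
have eM0 : 0 < eps * M by rewrite mulr_gt0.
pose V w : R := \sum_(k in Q) \1_(A k) w.
pose p k := fine (P (A k)).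
pose mu := \sum_(k in Q) p k.
have prE B : measurable B -> fine (P B) = Ex P \1_B.
  by move=> mB; rewrite -Ex_indic.
have VE w : V w = \sum_(k <- enum Q) \1_(A k) w by rewrite big_enum.
have bV : bounded_mfun V.
  rewrite (_ : V = fun w => \sum_(k <- enum Q) \1_(A k) w); last exact/funext.
  by apply: bounded_mfun_sum => k; exact: bounded_mfun_indic.
have EV : Ex P V = mu.
  rewrite (_ : V = fun w => \sum_(k <- enum Q) \1_(A k) w); last exact/funext.
  rewrite Ex_sum => [|k]; last exact: bounded_mfun_indic.
  by rewrite /mu big_enum/=; apply: eq_bigr => k _; rewrite /p prE.
have EV2 : Ex P (fun w => V w * V w) =
    \sum_(k in Q) \sum_(l in Q) fine (P (A k `&` A l)).
  rewrite (_ : (fun w => _) = fun w => \sum_(k <- enum Q) \sum_(l <- enum Q)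
      \1_(A k `&` A l) w); last first.
    apply/funext => w; rewrite {1}VE mulr_suml; apply: eq_bigr => k _.
    by rewrite VE mulr_sumr; apply: eq_bigr => l _; rewrite indicI.
  rewrite Ex_sum => [|k]; last first.
    by apply: bounded_mfun_sum => l; apply: bounded_mfun_indic; exact: measurableI.
  rewrite big_enum/=; apply: eq_bigr => k _.
  rewrite Ex_sum => [|l]; last by apply: bounded_mfun_indic; exact: measurableI.
  by rewrite big_enum/=; apply: eq_bigr => l _; rewrite prE//; exact: measurableI.
have var_le : Ex P (fun w => V w * V w) - mu ^+ 2 <= D.
  apply: le_trans covD; rewrite EV2.
  have -> : mu ^+ 2 = \sum_(k in Q) \sum_(l in Q) p k * p l.
    by rewrite expr2 {1}/mu mulr_suml; apply: eq_bigr => k _; rewrite mulr_sumr.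
  rewrite -sumrB; apply: ler_sum => k kQ.
  rewrite -sumrB (bigID (dep k))/= -[leRHS]addr0; apply: lerD.
    apply: ler_sum => l _; rewrite gerBl// mulr_ge0// fine_ge0//.
  rewrite big1// => l /andP[lQ ndep].
  by rewrite indep// fineM ?fin_num_measure// subrr.
have bf : bounded_mfun (fun w => (eps * M) ^- 2 * (V w * V w + (mu ^+ 2 + (- 2 * mu) * V w))).
  apply: bounded_mfunZ; apply: bounded_mfunD; first exact: bounded_mfunM.
  by apply: bounded_mfunD; [exact: bounded_mfun_cst|exact: bounded_mfunZ].
apply: (@le_trans _ _ (Ex P (fun w => (eps * M) ^- 2 * (V w * V w + (mu ^+ 2 + (- 2 * mu) * V w))))%:E).
  apply: prob_le_Ex => //.
  - by apply: measurable_ge_set; case: bV.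
  - move=> w; rewrite mulr_ge0 ?invr_ge0 ?sqr_ge0//.
    by have := sqr_ge0 (V w - mu); lra.
  - move=> w /= H; rewrite mulrC ler_pdivlMr ?exprn_gt0// mul1r.
    rewrite (_ : _ + _ = (V w - mu) ^+ 2); last by ring.
    rewrite lerXn2r ?nnegrE ?(ltW eM0)//; first by move: H; rewrite -/(V w) /mu /p; lra.
    by move: H; rewrite -/(V w) /mu /p; lra.
rewrite lee_fin ExZ; last first.
  apply: bounded_mfunD; first exact: bounded_mfunM.
  by apply: bounded_mfunD; [exact: bounded_mfun_cst|exact: bounded_mfunZ].
rewrite mulrC ler_pM2r ?invr_gt0 ?exprn_gt0//.
rewrite ExD; [|exact: bounded_mfunM|by apply: bounded_mfunD; [exact: bounded_mfun_cst|exact: bounded_mfunZ]].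
rewrite ExD; [|exact: bounded_mfun_cst|exact: bounded_mfunZ].
rewrite Ex_cst ExZ// EV.
by move: var_le; lra.
Qed.

End second_moment.

(** * The Benjamini-Hochberg procedure *)

Section order_statistics.
Context {R : realType}.

Lemma nth_sorted_le (s : seq R) (y : R) (i : nat) : sorted <=%R s ->
  (i < size s)%N -> (nth 0 s i <= y) = (i < count (fun x => (x <= y)%R) s)%N.
Proof.
elim: s i => [//|x s IH] i /= xs isz.
have ss : sorted <=%R s := path_sorted xs.
have /allP xall : all (<=%R x) s by apply: order_path_min xs; exact: le_trans.
have [xy|yx] := leP x y.
  by case: i isz => [//|i] isz; rewrite /= add1n ltnS IH.
have c0 : count (fun x => (x <= y)%R) s = 0%N.
  apply/eqP; rewrite -leqn0 leqNgt -has_count; apply/hasPn => u /xall xu.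
  by rewrite -ltNge (lt_le_trans yx).
rewrite /= c0 addn0; case: i isz => [|i] isz /=; first by rewrite leNgt yx.
by rewrite leNgt (lt_le_trans yx)//; apply/xall/mem_nth.
Qed.

Lemma nth_sort_le (s : seq R) (y : R) (k : nat) : (0 < k <= size s)%N ->
  (nth 0 (sort <=%R s) k.-1 <= y) = (k <= count (fun x => (x <= y)%R) s)%N.
Proof.
move=> /andP[k0 ks]; rewrite nth_sorted_le ?prednK ?size_sort//.
  have /seq.permP -> // : perm_eq (sort <=%R s) s by rewrite perm_sort.
exact/sort_sorted/le_total.
Qed.

End order_statistics.

Section benjamini_hochberg.
Context (R : realType) (E : experiment R).
Local Notation m := (ngroups E).
Context (F : 'I_m -> 'I_m -> cumulativeBounded (0 : R) (1 : R)) (alpha : R).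
Hypothesis alpha0 : 0 < alpha.
Local Notation q := (npairs E).
Local Notation pv x w := (pval F x.1 x.2 w).

Lemma card_pairs : #|pairs E| = q.
Proof.
rewrite /npairs subn1 divn2 -bin2 -bin2_sum big_mkord -sum1_card.
rewrite (eq_bigl (fun x : 'I_m * 'I_m => (x.1 < x.2)%N)); last by move=> x; rewrite inE.
rewrite -(pair_big_dep xpredT (fun i j : 'I_m => (i < j)%N) (fun _ _ => 1%N))/=.
rewrite (exchange_big_dep xpredT)//=; apply: eq_bigr => j _.
have jm : (j <= m)%N by exact: ltnW.
by rewrite -(big_ord_widen_cond _ xpredT (fun=> 1%N) jm)/= sum1_card card_ord.
Qed.

Definition nbelow (u : R) (w : space E) : nat :=
  #|[set x in pairs E | pv x w <= u]%SET|.

(** Replaces sorting by counting; from here on order statistics are handled through [nbelow]. *)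
Lemma order_pval_le w k u : (0 < k <= q)%N ->
  (order_pval F w k <= u) = (k <= nbelow u w)%N.
Proof.
move=> kq; rewrite /order_pval nth_sort_le ?size_image ?card_pairs//.
congr (_ <= _)%N.
rewrite /nbelow count_map -size_filter cardE /enum_mem -filter_predI.
by congr size; apply: eq_filter => x; rewrite !inE andbC.
Qed.

Lemma bh_index_spec w : (0 < bh_index F alpha w)%N ->
  (bh_index F alpha w <= q)%N /\
  order_pval F w (bh_index F alpha w) <= (bh_index F alpha w)%:R * alpha / q%:R.
Proof.
rewrite /bh_index big_nat_cond => b0.
have : [exists k : 'I_q.+1, (0 < k)%N &&
    (order_pval F w k <= k%:R * alpha / q%:R)].
  apply: contraTT b0; rewrite negb_exists => /forallP H.
  rewrite -leqNgt leqn0; apply/eqP; rewrite big1// => k /andP[/andP[k1 kq] kk].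
  by have := H (Ordinal kq); rewrite /= k1 kk.
move=> /existsP ex0.
pose P (k : 'I_q.+1) := (0 < k)%N && (order_pval F w k <= k%:R * alpha / q%:R).
have -> : \max_(1 <= k < q.+1 | (1 <= k < q.+1)%N &&
    (order_pval F w k <= k%:R * alpha / q%:R)) k = \max_(k < q.+1 | P k) k.
  rewrite (big_nat_widenl _ 0)// big_mkord.
  apply: eq_bigl => k; rewrite /P ltn_ord andbT.
  by case: (0 < k)%N; rewrite ?andbF ?andbT.
have [k0 Pk0] := ex0.
have P0 : (0 < #|P|)%N by apply/card_gt0P; exists k0.
have [k] := eq_bigmax_cond (fun k : 'I_q.+1 => k : nat) P0.
by move=> /andP[k1 kk] ->; split => //; rewrite -ltnS.
Qed.

Lemma bh_index_ge w k : (0 < k <= q)%N ->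
  (k <= nbelow (k%:R * alpha / q%:R) w)%N -> (k <= bh_index F alpha w)%N.
Proof.
move=> kq kn; rewrite /bh_index.
apply: (@leq_bigmax_seq _ _ _ id); rewrite ?mem_index_iota ?ltnS//.
by rewrite order_pval_le.
Qed.

Lemma order_pval_homo w k k' : (0 < k)%N -> (k <= k')%N -> (k' <= q)%N ->
  order_pval F w k <= order_pval F w k'.
Proof.
move=> k0 kk' k'q; rewrite order_pval_le; last by rewrite k0 (leq_trans kk').
rewrite (leq_trans kk')// -order_pval_le// k'q (leq_trans k0)//.
Qed.

(** Rejection without reference to the maximal index: a finite union of conditions on counts of
    p-values, which gives measurability. *)
Lemma rejectedE x w : x \in pairs E -> rejected F alpha x.1 x.2 w =
  [exists k : 'I_q.+1, [&& (0 < k)%N, pv x w <= k%:R * alpha / q%:R &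
     (k <= nbelow (k%:R * alpha / q%:R) w)%N]].
Proof.
move=> xp; apply/idP/existsP => [/andP[b0 px]|[k /and3P[k0 pk kn]]].
  have [bq bp] := bh_index_spec b0.
  have bq1 : (bh_index F alpha w < q.+1)%N by rewrite ltnS.
  exists (Ordinal bq1); rewrite /= b0 (le_trans px bp)/= -order_pval_le//.
  by rewrite b0.
have kq : (k <= q)%N by rewrite -ltnS.
(* The count k' at level k is at least k, hence itself admissible for the maximum. If the p-value of
   x exceeded the k'-th order statistic, x would be an extra element of a set of k' pairs already
   exhausted by those up to that order statistic. *)
set k' := nbelow (k%:R * alpha / q%:R) w in kn.
have k'q : (k' <= q)%N.
  rewrite /k' /nbelow -[leqRHS]card_pairs; apply: subset_leq_card; apply/fintype.subsetP => y.
  by rewrite inE => /andP[].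
have k'0 : (0 < k')%N by exact: leq_trans kn.
have k'b : (k' <= bh_index F alpha w)%N.
  apply: bh_index_ge; first by rewrite k'0.
  apply: subset_leq_card; apply/fintype.subsetP => y; rewrite !inE => /andP[-> /= /le_trans]; apply.
  by rewrite ler_pM2r ?invr_gt0 ?ltr0n ?(leq_trans k0)// ler_pM2r// ler_nat.
have b0 : (0 < bh_index F alpha w)%N by exact: leq_trans k'b.
rewrite /rejected b0/=; have [bq _] := bh_index_spec b0.
apply: le_trans (order_pval_homo w k'0 k'b bq).
rewrite leNgt; apply/negP => lt.
have : (k' <= nbelow (order_pval F w k') w)%N by rewrite -order_pval_le// k'0.
rewrite leqNgt => /negP; apply.
apply: proper_card; apply/properP; split.
  apply/fintype.subsetP => y; rewrite !inE => /andP[-> /= /le_trans]; apply.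
  by rewrite (le_trans (ltW lt)).
by exists x; [rewrite inE xp pk|rewrite inE negb_and -ltNge lt orbT].
Qed.

Lemma card_rejected_ge w :
  (bh_index F alpha w <= #|[set x in pairs E | rejected F alpha x.1 x.2 w]%SET|)%N.
Proof.
case: (posnP (bh_index F alpha w)) => [->//|b0].
have [bq _] := bh_index_spec b0.
have : (bh_index F alpha w <= nbelow (order_pval F w (bh_index F alpha w)) w)%N.
  by rewrite -order_pval_le// b0.
move/leq_trans; apply; apply: subset_leq_card; apply/fintype.subsetP => y.
by rewrite !inE => /andP[-> /=]; rewrite /rejected b0.
Qed.

Lemma rejected_pval x w : rejected F alpha x.1 x.2 w ->
  pv x w <= (bh_index F alpha w)%:R * alpha / q%:R.
Proof.
by move=> /andP[b0 /le_trans]; apply; case: (bh_index_spec b0).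
Qed.

End benjamini_hochberg.

Lemma card_indic (T : Type) (R : realType) (K : finType) (Q : {set K})
    (b : K -> T -> bool) (w : T) :
  #|[set x in Q | b x w]%SET|%:R = \sum_(x in Q) \1_[set w | b x w] w :> R.
Proof.
rewrite -sum1_card natr_sum.
rewrite (eq_bigl (fun x => (x \in Q) && b x w)); last by move=> x; rewrite inE.
rewrite big_mkcondr; apply: eq_bigr => x xQ.
rewrite indicE; case: ifPn => bx; first by rewrite mem_set.
by rewrite memNset//; exact/negP.
Qed.

(** * Measurability of roots, inverses and counts *)

Section measurability.
Context (d : measure_display) (T : measurableType d) (R : realType).

Lemma measurable_fun_inv_ge0 (f : T -> R) : (forall w, 0 <= f w) ->
  measurable_fun setT f -> measurable_fun setT (fun w => (f w)^-1).
Proof.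
move=> f0 mf; under eq_fun do rewrite -powR_inv1//.
exact: (@measurableT_comp _ _ _ _ _ _ (fun x : R => x `^ (-1)) _ f (measurable_powR (-1)) mf).
Qed.

Lemma measurable_fun_sqrt (f : T -> R) :
  measurable_fun setT f -> measurable_fun setT (fun w => Num.sqrt (f w)).
Proof.
move=> mf; apply: measurableT_comp => //; apply: nondecreasing_measurable => //.
by move=> x y xy; exact: ler_wsqrtr.
Qed.

Lemma measurable_card_set (K : finType) (Q : {set K}) (b : K -> T -> bool) :
  (forall x, x \in Q -> measurable [set w | b x w]) ->
  measurable_fun setT (fun w => #|[set x in Q | b x w]%SET|%:R : R).
Proof.
move=> mb.
have -> : (fun w => #|[set x in Q | b x w]%SET|%:R : R) =
   (fun w => \sum_(x <- index_enum K) (if x \in Q then \1_[set w | b x w] w else 0)).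
  by apply/funext => w; rewrite -big_mkcond/= card_indic.
apply: measurable_sum => x; case: (boolP (x \in Q)) => xQ; last exact: measurable_cst.
exact/measurable_indic/mb.
Qed.

End measurability.

(** * Ordered pairs and the counting of directional errors *)

Section ordered_pairs.
Context (R : realType) (E : experiment R).
Local Notation m := (ngroups E).
Local Notation q := (npairs E).

Definition ordered_pairs : {set 'I_m * 'I_m} :=
  [set x : 'I_m * 'I_m | (x.1 != x.2) && (mean x.1 <= mean x.2)]%SET.

(** A pair with distinct means has one admissible orientation, a null pair has two. This is where
    the factor 1 + q0 / q of the target originates. *)
Lemma card_ordered_pairs : #|ordered_pairs| = (q + #|null_pairs E|)%N.
Proof.
pose A := [set x in pairs E | mean x.1 <= mean x.2]%SET.
pose B := [set x in pairs E | mean x.2 <= mean x.1]%SET.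
pose swap (x : 'I_m * 'I_m) := (x.2, x.1).
have swapI : injective swap by move=> [a b] [a' b'] [-> ->].
have -> : ordered_pairs = (A :|: swap @: B)%SET.
  apply/setP => -[i j]; rewrite !inE/=.
  apply/andP/orP => [[ij mij]|].
    have := ij; rewrite -(inj_eq val_inj) neq_ltn => /orP[lt|lt].
      by left; rewrite lt.
    by right; apply/imsetP; exists (j, i) => //; rewrite !inE/= lt.
  move=> [/andP[lt mij]|/imsetP[[k l]]].
    by split=> //; rewrite -(inj_eq val_inj) neq_ltn lt.
  rewrite !inE/= => /andP[lt mkl] [-> ->]; split=> //.
  by rewrite -(inj_eq val_inj) neq_ltn lt orbT.
rewrite cardsU.
have -> : (A :&: swap @: B)%SET = finset.set0.
  apply/setP => -[i j]; rewrite !inE/=; apply/negP => /andP[/andP[ij _]].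
  by move=> /imsetP[[k l]]; rewrite !inE/= => /andP[kl _] [ei ej]; subst; lia.
rewrite cards0 subn0 card_imset// -cardsUI -(card_pairs E); congr (_ + _)%N.
  apply: eq_card => x; rewrite !inE; case: (x.1 < x.2)%N => //=.
  exact: le_total.
apply: eq_card => x; rewrite !inE; case: (x.1 < x.2)%N => //=.
by rewrite -eq_le.
Qed.

Lemma tstatC i j w : tstat (E := E) j i w = - tstat i j w.
Proof. by rewrite /tstat -[RHS]mulNr opprB [X in _ = _ / Num.sqrt X]addrC. Qed.

End ordered_pairs.

Definition symmetric_refs (R : realType) (m : nat)
    (F : 'I_m -> 'I_m -> cumulativeBounded (0 : R) (1 : R)) : Prop :=
  forall (i j : 'I_m) (t : R), (i < j)%N -> 0 <= t -> F i j t = 1 - F i j (- t).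

Section procedure.
Context (R : realType) (E : experiment R).
Local Notation m := (ngroups E).
Context (F : 'I_m -> 'I_m -> cumulativeBounded (0 : R) (1 : R)) (alpha : R).
Hypothesis alpha0 : 0 < alpha.
Hypothesis F_sym : symmetric_refs F.
Local Notation q := (npairs E).

Lemma measurable_sample_mean i : measurable_fun setT (@sample_mean _ E i).
Proof.
by apply: measurable_funM => //; apply: measurable_sum => k; exact: measurable_funP.
Qed.

Lemma measurable_sample_var i : measurable_fun setT (@sample_var _ E i).
Proof.
apply: measurable_funM => //; apply: measurable_sum => k.
apply: measurable_funX; apply: measurable_funB; first exact: measurable_funP.
exact: measurable_sample_mean.
Qed.

Lemma measurable_tstat i j : measurable_fun setT (@tstat _ E i j).
Proof.
apply: measurable_funM.
  by apply: measurable_funB; exact: measurable_sample_mean.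
apply: measurable_fun_inv_ge0; first by move=> w; exact: sqrtr_ge0.
apply: measurable_fun_sqrt; apply: measurable_funD;
  by apply: measurable_funM => //; exact: measurable_sample_var.
Qed.

Lemma F_homo i j : {homo (F i j : R -> R) : x y / x <= y}.
Proof. exact: cumulative_is_nondecreasing. Qed.

(** By symmetry of the reference law the two one-sided p-values are its tails at plus and minus the
    statistic, and the smaller one is the upper tail at the absolute value. *)
Lemma pvalE (i j : 'I_m) w : (i < j)%N ->
  pval F i j w = 2 * (1 - F i j `|tstat i j w|).
Proof.
move=> ij; rewrite /pval /pval_lower /pval_upper; set t := tstat i j w.
congr (2 * _).
have tn : F i j (- `|t|) = 1 - F i j `|t|.
  by rewrite (F_sym ij (normr_ge0 t)); ring.
have Fle : F i j (- `|t|) <= F i j `|t|.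
  by apply: F_homo; rewrite (@le_trans _ _ 0)// oppr_le0.
have [t0|/ltW t0] := leP 0 t.
  by move: tn Fle; rewrite ger0_norm// => -> ?; apply/min_idPr.
have -> : F i j t = 1 - F i j `|t| by rewrite -tn ler0_norm// opprK.
by rewrite opprB subrKC; apply/min_idPl; rewrite -tn.
Qed.

Lemma measurable_pval (i j : 'I_m) : (i < j)%N -> measurable_fun setT (pval F i j).
Proof.
move=> ij; rewrite (_ : pval F i j = fun w => 2 * (1 - F i j `|tstat i j w|)); last first.
  by apply/funext => w; exact: pvalE.
apply: measurable_funM => //; apply: measurable_funB => //.
apply: (@measurableT_comp _ _ _ _ _ _ (F i j : R -> R)).
  by apply: nondecreasing_measurable => //; exact: F_homo.
by apply: measurableT_comp => //; exact: measurable_tstat.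
Qed.

Lemma measurable_rejected x : x \in pairs E ->
  measurable [set w | rejected F alpha x.1 x.2 w].
Proof.
move=> xp.
have mp y u : y \in pairs E -> measurable [set w | pval F y.1 y.2 w <= u].
  rewrite inE => yp; rewrite -[X in measurable X]setTI.
  by apply: measurable_fun_le => //; exact: measurable_pval.
rewrite (_ : [set w | _] = \bigcup_(k in [set` [set: 'I_q.+1]%SET])
    ([set w | (0 < k)%N /\ pval F x.1 x.2 w <= k%:R * alpha / q%:R] `&`
     [set w | k%:R <= (nbelow F (k%:R * alpha / q%:R) w)%:R :> R])); last first.
  apply/seteqP; split => [w /=|w [k _ /= [[k0 pk] kn]]]; rewrite rejectedE//.
    move=> /existsP[k /and3P[k0 pk kn]]; exists k; first by rewrite /= inE.
    by split => //=; rewrite ler_nat.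
  by apply/existsP; exists k; rewrite k0 pk; move: kn; rewrite ler_nat => ->.
apply: fin_bigcup_measurable; first exact: finite_finset.
move=> k _; apply: measurableI.
  case: (posnP k) => [->|k0].
    by rewrite (_ : [set _ | _] = set0)//; apply/seteqP; split => // w [].
  rewrite (_ : [set _ | _] = [set w | pval F x.1 x.2 w <= k%:R * alpha / q%:R]).
    exact: mp.
  by apply/seteqP; split => w //= [].
apply: measurable_ge_set; apply: measurable_card_set => y yp; exact: mp.
Qed.

Lemma measurable_wrong_sign i j : measurable [set w | wrong_sign (E := E) i j w].
Proof.
have mt := measurable_tstat i j.
have gt0 := measurable_gt_set 0 mt; have lt0 := measurable_lt_set 0 mt.
rewrite /wrong_sign; have [n0|p0|e0] := ltgtP (mean i - mean j) 0.
- rewrite (_ : [set _ | _] = [set w | 0 < tstat i j w])//.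
  by apply/seteqP; split => w /=; rewrite andbT andbF orbF.
- rewrite (_ : [set _ | _] = [set w | tstat i j w < 0])//.
  by apply/seteqP; split => w /=; rewrite andbT andbF.
- rewrite (_ : [set _ | _] = set0)//.
  by apply/seteqP; split => w //=; rewrite !andbF.
Qed.

Lemma measurable_directional_error x : x \in pairs E ->
  measurable [set w | directional_error F alpha x.1 x.2 w].
Proof.
move=> xp; rewrite /directional_error; case: (eqVneq (mean x.1 - mean x.2) 0) => _ /=.
  exact: measurable_rejected.
rewrite (_ : [set _ | _] = [set w | rejected F alpha x.1 x.2 w] `&`
    [set w | wrong_sign x.1 x.2 w]); last first.
  apply/seteqP; split => w /=; rewrite orbF; first by move=> /andP.
  by move=> [-> ->].
by apply: measurableI; [exact: measurable_rejected|exact: measurable_wrong_sign].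
Qed.

Lemma measurable_dFDP : measurable_fun setT (dFDP F alpha).
Proof.
apply: measurable_funM; first exact/measurable_card_set/measurable_directional_error.
apply: measurable_fun_inv_ge0 => //.
exact/measurable_card_set/measurable_rejected.
Qed.

Lemma dFDP_ge0 w : 0 <= dFDP F alpha w.
Proof. by rewrite divr_ge0. Qed.

Lemma dFDP_le1 w : dFDP F alpha w <= 1.
Proof.
rewrite /dFDP; set r := #|[set x in pairs E | rejected _ _ _ _ _]%SET|.
case: (posnP r) => [->|r0]; first by rewrite invr0 mulr0.
rewrite ler_pdivrMr ?ltr0n// mul1r ler_nat; apply: subset_leq_card.
apply/fintype.subsetP => x; rewrite !inE => /andP[-> /=].
by rewrite /directional_error => /orP[/and3P[]|/andP[]].
Qed.

(** An erroneous pair is oriented so that its statistic is positive; a wrong sign or a null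
    difference then means that the first mean is at most the second. The orientation map is
    injective because errors are only recorded for i < j. *)
Lemma card_error_le w (z : R) : 0 < z ->
  (forall x, x \in pairs E -> rejected F alpha x.1 x.2 w ->
     z <= `|tstat x.1 x.2 w|) ->
  (#|[set x in pairs E | directional_error F alpha x.1 x.2 w]%SET| <=
   #|[set x in ordered_pairs E | (z <= tstat x.1 x.2 w)%R]%SET|)%N.
Proof.
move=> z0 zT.
set Er := [set x in pairs E | _]%SET; set H := [set x in ordered_pairs E | _]%SET.
pose f (x : 'I_m * 'I_m) := if x \in H then x else (x.2, x.1).
have lt_of x : x \in Er -> (x.1 < x.2)%N by rewrite !inE => /andP[].
have fI : {in Er &, injective f}.
  move=> [i j] [k l] /lt_of/= ij /lt_of/= kl; rewrite /f.
  by do 2 case: ifP => _; move=> [? ?]; subst => //; lia.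
rewrite -(card_in_imset fI); apply: subset_leq_card.
apply/fintype.subsetP => _ /imsetP[x xE ->]; rewrite /f; case: ifPn => // xH.
have := xE; rewrite inE => /andP[xp err].
have xlt : (x.1 < x.2)%N by exact: lt_of.
have xne : x.1 != x.2 by rewrite -(inj_eq val_inj) neq_ltn xlt.
have rej : rejected F alpha x.1 x.2 w.
  by move: err; rewrite /directional_error => /orP[/and3P[]|/andP[]].
have := zT x xp rej; move: xH; rewrite !inE/= (eq_sym x.2) xne/= (tstatC x.1 x.2).
move: err; rewrite /directional_error /wrong_sign rej/= andbT.
rewrite subr_lt0 subr_gt0 subr_eq0.
have [t0|t0] := leP 0 (tstat x.1 x.2 w).
  rewrite ger0_norm// => err xH zt; move: xH err.
  rewrite zt andbT -ltNge => m21.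
  by rewrite (lt_gtF m21) (gt_eqF m21)/= andbF.
rewrite ltr0_norm// => err _ ->; rewrite andbT.
move: err; rewrite (lt_gtF t0)/=.
by move=> /orP[/andP[_ /ltW]//|/eqP ->].
Qed.

End procedure.

(** * Truncation *)

Section truncation.
Context {R : realType}.

Definition trunc (b y : R) : R := if `|y| <= b then y else 0.

Lemma trunc_id b y : `|y| <= b -> trunc b y = y.
Proof. by rewrite /trunc => ->. Qed.

Lemma trunc_norm b y : 0 <= b -> `|trunc b y| <= b.
Proof. by move=> b0; rewrite /trunc; case: ifP => // _; rewrite normr0. Qed.

Lemma measurable_trunc b : measurable_fun setT (trunc b).
Proof.
rewrite (_ : trunc b = fun y => y * \1_(`[- b, b]) y); last first.
  apply/funext => y; rewrite /trunc indicE; case: ifPn => yb.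
    by rewrite mem_set ?mulr1//= in_itv/= -ler_norml.
  by rewrite memNset ?mulr0//= in_itv/= -ler_norml; exact/negP.
by apply: measurable_funM => //; exact: measurable_indic.
Qed.

Lemma trunc_sqr_le b y : trunc b y ^+ 2 <= y ^+ 2.
Proof. by rewrite /trunc; case: ifP => //; rewrite expr0n/= sqr_ge0. Qed.

End truncation.

Section truncated_moments.
Context (d : measure_display) (T : measurableType d) (R : realType).
Variable P : probability T R.
Variables (Y : T -> R) (p K b : R).
Hypothesis mY : measurable_fun setT Y.
Hypothesis intY : P.-integrable setT (EFin \o Y).
Hypothesis EY0 : (\int[P]_w (Y w)%:E = 0)%E.
Hypothesis EY1 : (\int[P]_w (Y w ^+ 2)%:E = 1)%E.
Hypothesis EYp : (\int[P]_w (`|Y w| `^ p)%:E <= K%:E)%E.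
Hypotheses (p2 : 2 <= p) (b1 : 0 < b).

Let mYp : measurable_fun setT (fun w => `|Y w| `^ p).
Proof.
apply: (@measurableT_comp _ _ _ _ _ _ (fun x : R => x `^ p)).
  exact: measurable_powR.
exact: measurableT_comp.
Qed.

Let tail_le (c y : R) : 0 <= c <= p -> b < `|y| -> `|y| `^ c <= `|y| `^ p * b `^ (c - p).
Proof.
move=> /andP[c0 cp] by_.
have y0 : 0 < `|y| by exact: lt_trans by_.
have -> : `|y| `^ c = `|y| `^ p * `|y| `^ (c - p).
  by rewrite -powRD ?subrKC//; apply/implyP => _; rewrite gt_eqF.
rewrite ler_wpM2l ?powR_ge0//.
have -> : c - p = - (p - c) by rewrite opprB.
rewrite !powRN lef_pV2 ?posrE ?powR_gt0//.
by apply: ge0_ler_powR; rewrite ?nnegrE ?subr_ge0// ltW.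
Qed.

(** Markov's inequality in the form |y|^c <= |y|^p b^(c - p) beyond b. The exponents c = 0, 1, 2
    give the tail probability, the bias of the mean and the loss of variance. *)
Let int_tail_le (c : R) (f : T -> R) : 0 <= c <= p -> measurable_fun setT f ->
  (forall w, 0 <= f w) -> (forall w, `|Y w| <= b -> f w = 0) ->
  (forall w, f w <= `|Y w| `^ c) ->
  (\int[P]_w (f w)%:E <= (K * b `^ (c - p))%:E)%E.
Proof.
move=> cp mf f0 fb fc.
apply: (@le_trans _ _ (\int[P]_w (b `^ (c - p) * (`|Y w| `^ p))%:E)%E).
  apply: ge0_le_integral => //.
  - by move=> w _; rewrite lee_fin.
  - exact/measurable_EFinP.
  - by apply/measurable_EFinP; exact: measurable_funM.
  - move=> w _; rewrite lee_fin; have [Yb|bY] := leP `|Y w| b.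
      by rewrite fb// mulr_ge0 ?powR_ge0.
    by rewrite (le_trans (fc w))// mulrC tail_le.
under eq_integral do rewrite EFinM.
rewrite ge0_integralZl_EFin ?powR_ge0//; last first.
- exact/measurable_EFinP.
by rewrite mulrC EFinM lee_wpmul2l// lee_fin powR_ge0.
Qed.

Lemma trunc_tail : (P [set w | b < `|Y w|]%R <= (K * b `^ (- p))%:E)%E.
Proof.
have mB : measurable [set w | b < `|Y w|].
  rewrite (_ : [set _ | _] = (fun w => `|Y w|) @^-1` `]b, +oo[); last first.
    by apply/seteqP; split => w /=; rewrite in_itv/= andbT.
  by rewrite -[X in measurable X]setTI; exact: measurableT_comp.
rewrite -[[set _ | _]]setIT -integral_indic// -[- p]add0r.
apply: int_tail_le.
- by rewrite lexx/= (le_trans _ p2).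
- exact: measurable_indic.
- by [].
- by move=> w Yb; rewrite indicE memNset//= ltNge Yb.
- by move=> w; rewrite powRr0 indicE; case: (_ \in _).
Qed.

Let btr : bounded_mfun (fun w => trunc b (Y w)).
Proof.
split; first by apply: measurableT_comp => //; exact: measurable_trunc.
by exists b => w; exact/trunc_norm/ltW.
Qed.

(** As Y is centred, the truncated mean is minus the mean of the part cut off. *)
Lemma trunc_mean : `|Ex P (fun w => trunc b (Y w))| <= K * b `^ (1 - p).
Proof.
rewrite -lee_fin EFin_normr_Rintegral//; last exact: bounded_integrable.
have -> : (\int[P]_w (trunc b (Y w))%:E = - \int[P]_w (Y w - trunc b (Y w))%:E)%E.
  under [X in (- X)%E]eq_integral do rewrite EFinB.
  rewrite integralB//; last exact: bounded_integrable.
  by rewrite EY0 sub0e oppeK.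
rewrite abseN; apply: (le_trans (le_abse_integral _ _ _)) => //.
  apply/measurable_EFinP; apply: measurable_funB => //; exact: btr.1.
apply: int_tail_le.
- by rewrite ler01 (le_trans _ p2)// ler1n.
- apply: measurableT_comp => //; apply: measurable_funB => //; exact: btr.1.
- by [].
- by move=> w Yb; rewrite trunc_id// subrr normr0.
- move=> w; rewrite powRr1// /trunc; case: ifP => _; last by rewrite subr0.
  by rewrite subrr normr0.
Qed.

Lemma trunc_sqr_mean :
  1 - K * b `^ (2 - p) <= Ex P (fun w => trunc b (Y w) ^+ 2) <= 1.
Proof.
have btr2 : bounded_mfun (fun w => trunc b (Y w) ^+ 2).
  by under eq_fun do rewrite expr2; exact: bounded_mfunM.
have mY2 : measurable_fun setT (fun w => (Y w ^+ 2)%:E).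
  by apply/measurable_EFinP; exact: measurable_funX.
have mtr2 : measurable_fun setT (fun w => (trunc b (Y w) ^+ 2)%:E).
  by apply/measurable_EFinP; exact: btr2.1.
apply/andP; split.
  rewrite lerBlDr -lee_fin EFinD EFin_Ex// -EY1.
  have -> : (\int[P]_w (Y w ^+ 2)%:E = \int[P]_w (trunc b (Y w) ^+ 2)%:E +
      \int[P]_w (Y w ^+ 2 - trunc b (Y w) ^+ 2)%:E)%E.
    rewrite -ge0_integralD//.
    - by apply: eq_integral => w _; rewrite -EFinD subrKC.
    - by move=> w _; rewrite lee_fin sqr_ge0.
    - by move=> w _; rewrite lee_fin subr_ge0 trunc_sqr_le.
    - by under eq_fun do rewrite EFinB; exact: emeasurable_funB.
  rewrite leeD2l//; apply: int_tail_le.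
  - by rewrite p2 andbT.
  - apply: measurable_funB; first exact: measurable_funX.
    exact: btr2.1.
  - by move=> w; rewrite subr_ge0 trunc_sqr_le.
  - by move=> w Yb; rewrite trunc_id// subrr.
  - move=> w; rewrite powR_mulrn// real_normK ?num_real//.
    by rewrite gerBl sqr_ge0.
rewrite -lee_fin EFin_Ex// -EY1; apply: ge0_le_integral => //.
- by move=> w _; rewrite lee_fin sqr_ge0.
- by move=> w _; rewrite lee_fin trunc_sqr_le.
Qed.

End truncated_moments.

(** * Standardized and truncated observations *)

Section standing_assumptions.
Context (R : realType) (E : experiment R).

Definition moment_bound (p K : R) : Prop :=
  forall (i : 'I_(ngroups E)) (k : 'I_(nobs i)), (standardized_moment k p <= K%:E)%E.

(** A centred truncated observation is at most 2 b and enters the normalized sums with a coefficient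
    at most 1 / sqrt n, so [beta] bounds every step. *)
Definition small_steps (b beta : R) : Prop :=
  forall i : 'I_(ngroups E), 2 * b <= beta * Num.sqrt (nobs i)%:R.

Definition variance_ratio_le (k : R) : Prop := forall i j : 'I_(ngroups E), i != j ->
  sd i ^+ 2 / (nobs i)%:R <= k * (sd j ^+ 2 / (nobs j)%:R).

Lemma small_steps_ge0 (b beta : R) (i : 'I_(ngroups E)) :
  0 <= b -> small_steps b beta -> 0 <= beta.
Proof.
have r0 : 0 < Num.sqrt (nobs i)%:R :> R.
  by rewrite sqrtr_gt0 ltr0n (leq_trans _ (nobs_ge2 i)).
move=> b0 bl; rewrite -(pmulr_lge0 _ r0); apply: le_trans (bl i).
by rewrite mulr_ge0.
Qed.

End standing_assumptions.

Section standardized_observations.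
Context (R : realType) (E : experiment R).
Local Notation m := (ngroups E).
Local Notation P := (prob E).
Local Notation I := {i : 'I_m & 'I_(nobs i)}.
Local Notation Omega := (space E).

Definition xobs (a : I) : {RV P >-> R} := obs (tagged a).

Definition std (a : I) (x : R) : R := (x - mean (tag a)) / sd (tag a).

Local Notation Y a := (fun w => std a (xobs a w)).

Lemma measurable_std a : measurable_fun setT (std a).
Proof. by apply: measurable_funM => //; exact: measurable_funB. Qed.

Lemma measurable_stdobs a : measurable_fun setT (Y a).
Proof. by apply: measurableT_comp; [exact: measurable_std|exact: measurable_funP]. Qed.

Lemma integral_obs a : (\int[P]_w (xobs a w)%:E = (mean (tag a))%:E)%E.
Proof. by have := obs_mean (tagged a); rewrite unlock. Qed.

Let integrable_mean (c : R) : P.-integrable setT (fun=> c%:E).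
Proof.
apply: (@bounded_integrable _ _ _ P (fun=> c)); exact: bounded_mfun_cst.
Qed.

Lemma integrable_centered a :
  P.-integrable setT (fun w => (xobs a w - mean (tag a))%:E).
Proof.
under eq_fun do rewrite EFinB.
by apply: integrableB => //; exact: obs_integrable.
Qed.

Lemma integrable_stdobs a : P.-integrable setT (EFin \o Y a).
Proof.
rewrite (_ : EFin \o _ =
  (fun w => (xobs a w - mean (tag a))%:E * ((sd (tag a))^-1)%:E)%E); last first.
  by apply/funext => w.
by apply: integrableZr => //; exact: integrable_centered.
Qed.

Lemma integral_stdobs a : (\int[P]_w (Y a w)%:E = 0)%E.
Proof.
under eq_integral do rewrite /std EFinM.
rewrite integralZr//; last exact: integrable_centered.
under eq_integral do rewrite EFinB.
rewrite integralB//; last exact: obs_integrable.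
have -> : (\int[P]__ (mean (tag a))%:E = (mean (tag a))%:E)%E.
  have bc := @bounded_mfun_cst _ Omega R (mean (tag a)).
  by rewrite -(EFin_Ex P bc) Ex_cst.
by rewrite integral_obs subee// mul0e.
Qed.

Lemma integral_stdobs_sqr a : (\int[P]_w (Y a w ^+ 2)%:E = 1)%E.
Proof.
have sd0 := sd_gt0 (tag a).
have := obs_variance (tagged a); rewrite /variance unlock obs_mean/= unlock/= => H.
under eq_integral do rewrite /std expr_div_n EFinM.
rewrite ge0_integralZr//; last first.
- by rewrite lee_fin invr_ge0 sqr_ge0.
- by move=> w _; rewrite lee_fin sqr_ge0.
- apply/measurable_EFinP; apply: measurable_funX; exact: measurable_funB.
rewrite (_ : (\int[P]_w _)%E = ((sd (tag a)) ^+ 2)%:E).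
  by rewrite -EFinM divff// gt_eqF// exprn_gt0.
by rewrite -H; apply: eq_integral => w _; rewrite expr2.
Qed.

Section truncated.
Variables (p K b : R).
Hypotheses (p2 : 2 <= p) (b0 : 0 < b).
Hypothesis moment : moment_bound E p K.

Let EYp a : (\int[P]_w (`|Y a w| `^ p)%:E <= K%:E)%E.
Proof. by have := moment (tagged a); rewrite /standardized_moment unlock. Qed.

Definition tr (a : I) (x : R) : R := trunc b (std a x).
Definition trmean (a : I) : R := Ex P (fun w => tr a (xobs a w)).
Definition trsqr (a : I) : R := Ex P (fun w => tr a (xobs a w) ^+ 2).

Lemma measurable_tr a : measurable_fun setT (tr a).
Proof. by apply: measurableT_comp; [exact: measurable_trunc|exact: measurable_std]. Qed.

Lemma bounded_tr a : bounded_mfun (fun w => tr a (xobs a w)).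
Proof.
split; first by apply: measurableT_comp; [exact: measurable_tr|exact: measurable_funP].
by exists b => w; exact/trunc_norm/ltW.
Qed.

Lemma bounded_tr_sqr a : bounded_mfun (fun w => tr a (xobs a w) ^+ 2).
Proof. by under eq_fun do rewrite expr2; apply: bounded_mfunM; exact: bounded_tr. Qed.

Lemma stdobs_tail a : (P [set w | b < `|Y a w|]%R <= (K * b `^ (- p))%:E)%E.
Proof. by apply: trunc_tail => //; exact: measurable_stdobs. Qed.

Lemma trmean_le a : `|trmean a| <= K * b `^ (1 - p).
Proof.
apply: trunc_mean => //; [exact: measurable_stdobs|exact: integrable_stdobs|].
exact: integral_stdobs.
Qed.

Lemma trsqr_bounds a : 1 - K * b `^ (2 - p) <= trsqr a <= 1.
Proof.
apply: trunc_sqr_mean => //; [exact: measurable_stdobs|].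
exact: integral_stdobs_sqr.
Qed.

Implicit Types c : 'I_m -> R.

Definition lin c (a : I) (x : R) : R := c (tag a) * (tr a x - trmean a).

(** Coefficients are constant on groups. This one form covers a pair statistic, a single group mean
    and the sum of two pair statistics, so the tail bounds are applied to all three alike. *)
Definition W c (w : Omega) : R := \sum_a lin c a (xobs a w).

Lemma measurable_lin c a : measurable_fun setT (lin c a).
Proof. by apply: measurable_funM => //; apply: measurable_funB => //; exact: measurable_tr. Qed.

Lemma lin_mean c a : Ex P (fun w => lin c a (xobs a w)) = 0.
Proof.
rewrite /lin ExZ; last by apply: bounded_mfunD; [exact: bounded_tr|exact: bounded_mfun_cst].
rewrite ExD; [|exact: bounded_tr|exact: bounded_mfun_cst].
by rewrite Ex_cst -/(trmean a) subrr mulr0.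
Qed.

Lemma trmean_le_b a : `|trmean a| <= b.
Proof.
rewrite ler_norml; apply/andP; split.
  rewrite -[leLHS](Ex_cst P); apply: Ex_le; [exact: bounded_mfun_cst|exact: bounded_tr|].
  by move=> w; have := trunc_norm (std a (xobs a w)) (ltW b0); rewrite ler_norml => /andP[].
rewrite -[leRHS](Ex_cst P); apply: Ex_le; [exact: bounded_tr|exact: bounded_mfun_cst|].
by move=> w; have := trunc_norm (std a (xobs a w)) (ltW b0); rewrite ler_norml => /andP[].
Qed.

Lemma lin_bound c beta a w : (forall i, `|c i| * (2 * b) <= beta) ->
  `|lin c a (xobs a w)| <= beta.
Proof.
move=> cb; apply: le_trans (cb (tag a)); rewrite normrM ler_wpM2l//.
rewrite (le_trans (ler_normB _ _))// mulr_natl mulr2n lerD ?trmean_le_b//.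
exact/trunc_norm/ltW.
Qed.

Lemma sum_obs (f : 'I_m -> R) : \sum_(a : I) f (tag a) = \sum_i (nobs i)%:R * f i.
Proof.
rewrite -(@sig_big_dep _ _ _ _ (fun i : 'I_m => 'I_(nobs i)) xpredT
  (fun _ => xpredT) (fun i _ => f i))/=.
by apply: eq_bigr => i _; rewrite sumr_const card_ord mulr_natl.
Qed.

Lemma lin_var_le c a : Ex P (fun w => lin c a (xobs a w) ^+ 2) <= c (tag a) ^+ 2.
Proof.
under [X in Ex _ X]eq_fun do rewrite /lin exprMn.
rewrite ExZ; last first.
  under eq_fun do rewrite expr2.
  by apply: bounded_mfunM; apply: bounded_mfunD;
    [exact: bounded_tr|exact: bounded_mfun_cst|exact: bounded_tr|exact: bounded_mfun_cst].
rewrite ler_piMr ?sqr_ge0//.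
have -> : (fun w => (tr a (xobs a w) - trmean a) ^+ 2) =
  (fun w => tr a (xobs a w) ^+ 2 + (trmean a ^+ 2 + (- 2 * trmean a) * tr a (xobs a w))).
  by apply/funext => w; ring.
rewrite ExD; [|exact: bounded_tr_sqr|]; last first.
  by apply: bounded_mfunD; [exact: bounded_mfun_cst|apply: bounded_mfunZ; exact: bounded_tr].
rewrite ExD; [|exact: bounded_mfun_cst|apply: bounded_mfunZ; exact: bounded_tr].
rewrite Ex_cst ExZ; last exact: bounded_tr.
rewrite -/(trmean a) -/(trsqr a).
have /andP[_] := trsqr_bounds a; have := sqr_ge0 (trmean a); lra.
Qed.

Lemma lin_var_sum c :
  \sum_a Ex P (fun w => lin c a (xobs a w) ^+ 2) <= \sum_i (nobs i)%:R * c i ^+ 2.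
Proof.
by rewrite -(sum_obs (fun i => c i ^+ 2)); apply: ler_sum => a _; exact: lin_var_le.
Qed.

Lemma measurable_W c : measurable_fun setT (W c).
Proof.
apply: measurable_sum => a; apply: measurableT_comp; first exact: measurable_lin.
exact: measurable_funP.
Qed.

Lemma W_add c c' w : W (fun i => c i + c' i) w = W c w + W c' w.
Proof. by rewrite -big_split/=; apply: eq_bigr => a _; rewrite /lin mulrDl. Qed.

Lemma W_opp c w : W (fun i => - c i) w = - W c w.
Proof. by rewrite -sumrN; apply: eq_bigr => a _; rewrite /lin mulNr. Qed.

(** Only groups with a nonzero coefficient enter the sum, so disjoint supports depend on disjoint
    blocks of observations. *)
Lemma W_indep c c' (x x' : R) : (forall i, c i = 0 \/ c' i = 0) ->
  P ([set w | x <= W c w] `&` [set w | x' <= W c' w]) =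
  (P [set w | x <= W c w]%R * P [set w | x' <= W c' w]%R)%E.
Proof.
move=> cc'.
pose J c := [set a : I | c (tag a) != 0]%SET.
have WE c0 : W c0 = fun w => \sum_(a <- enum (J c0)) lin c0 a (xobs a w).
  apply/funext => w; rewrite /W (bigID (mem (J c0)))/= [X in _ + X]big1 ?addr0.
    by rewrite big_enum.
  by move=> a; rewrite inE negbK => /eqP c00; rewrite /lin c00 mul0r.
have ind : independent_pair P (W c) (W c').
  apply: (@block_measurable_indep _ _ _ P I xobs (@obs_independent _ E) (J c) (J c')).
  - move=> a; rewrite !inE negbK; case: (cc' (tag a)) => -> //.
    by rewrite eqxx.
  - rewrite WE; apply: block_measurable_sum; first exact: measurable_lin.
    by move=> a; rewrite mem_enum.
  - rewrite WE; apply: block_measurable_sum; first exact: measurable_lin.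
    by move=> a; rewrite mem_enum.
have geE (f : Omega -> R) y : [set w | y <= f w] = f @^-1` `[y, +oo[%classic.
  by apply/seteqP; split => w /=; rewrite in_itv/= andbT.
by rewrite !geE; apply: ind; exact: measurable_itv.
Qed.

(* The scaling makes the total variance at most 1. *)
Definition sqs (e : R) (i : 'I_m) (a : I) (x : R) : R :=
  if tag a == i then e * (tr a x ^+ 2 - trsqr a) / (b * Num.sqrt (nobs i)%:R) else 0.

Definition U i (w : Omega) : R := \sum_a sqs 1 i a (xobs a w).

Lemma U_opp i w : \sum_a sqs (-1) i a (xobs a w) = - U i w.
Proof.
rewrite -sumrN; apply: eq_bigr => a _; rewrite /sqs; case: ifP => _; last by rewrite oppr0.
by rewrite mulN1r mul1r mulNr.
Qed.

Lemma measurable_sqs e i a : measurable_fun setT (sqs e i a).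
Proof.
rewrite /sqs; case: (tag a == i); last exact: measurable_cst.
apply: measurable_funM => //; apply: measurable_funM => //; apply: measurable_funB => //.
by apply: measurable_funX; exact: measurable_tr.
Qed.

Let nobs_gt0 (i : 'I_m) : 0 < (nobs i)%:R :> R.
Proof. by rewrite ltr0n (leq_trans _ (nobs_ge2 i)). Qed.

Lemma sqs_mean e i a : Ex P (fun w => sqs e i a (xobs a w)) = 0.
Proof.
rewrite /sqs; case: (tag a == i); last by rewrite Ex_cst.
have -> : (fun w => e * (tr a (xobs a w) ^+ 2 - trsqr a) / (b * Num.sqrt (nobs i)%:R)) =
  (fun w => (e / (b * Num.sqrt (nobs i)%:R)) * (tr a (xobs a w) ^+ 2 - trsqr a)).
  by apply/funext => w; ring.
rewrite ExZ; last by apply: bounded_mfunD; [exact: bounded_tr_sqr|exact: bounded_mfun_cst].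
rewrite ExD; [|exact: bounded_tr_sqr|exact: bounded_mfun_cst].
by rewrite Ex_cst -/(trsqr a) subrr mulr0.
Qed.

Let tr2_itv a w : 0 <= tr a (xobs a w) ^+ 2 <= b ^+ 2.
Proof.
rewrite sqr_ge0/= -(@real_normK _ (tr _ _)) ?num_real// lerXn2r ?nnegrE ?(ltW b0)//.
exact/trunc_norm/ltW.
Qed.

Let trsqr_itv a : 0 <= trsqr a <= b ^+ 2.
Proof.
apply/andP; split; first by apply: Ex_ge0 => w; exact: sqr_ge0.
rewrite -[leRHS](Ex_cst P); apply: Ex_le; [exact: bounded_tr_sqr|exact: bounded_mfun_cst|].
by move=> w; case/andP: (tr2_itv a w).
Qed.

Lemma sqs_bound e i a w : `|e| = 1 ->
  `|sqs e i a (xobs a w)| <= b / Num.sqrt (nobs i)%:R.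
Proof.
move=> e1; have r0 : 0 < Num.sqrt (nobs i)%:R :> R by rewrite sqrtr_gt0.
rewrite /sqs; case: (tag a == i); last by rewrite normr0 divr_ge0 ?ltW.
rewrite !normrM e1 mul1r (gtr0_norm (_ : 0 < (b * _)^-1)) ?invr_gt0 ?mulr_gt0//.
rewrite invfM mulrA ler_pM2r ?invr_gt0// ler_pdivrMr// -expr2 ler_norml.
have /andP[? ?] := tr2_itv a w; have /andP[? ?] := trsqr_itv a.
by apply/andP; split; lra.
Qed.

Lemma sqs_var_sum e i : `|e| = 1 ->
  \sum_a Ex P (fun w => sqs e i a (xobs a w) ^+ 2) <= 1.
Proof.
move=> e1.
have n0 := nobs_gt0 i.
have r0 : 0 < Num.sqrt (nobs i)%:R :> R by rewrite sqrtr_gt0.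
apply: (@le_trans _ _ (\sum_(a : I) (if tag a == i then (nobs i)%:R^-1 else 0))).
  apply: ler_sum => a _; rewrite /sqs; case: (tag a == i); last first.
    by rewrite expr0n/= Ex_cst.
  have -> : (fun w => (e * (tr a (xobs a w) ^+ 2 - trsqr a) / (b * Num.sqrt (nobs i)%:R)) ^+ 2) =
    (fun w => ((nobs i)%:R * b ^+ 2)^-1 * (tr a (xobs a w) ^+ 2 - trsqr a) ^+ 2).
    apply/funext => w; rewrite !exprMn exprVn exprMn sqr_sqrtr ?ltW//.
    rewrite -(real_normK (num_real e)) e1 expr1n mul1r mulrC.
    by rewrite (mulrC _ (b ^+ 2)).
  have bd : bounded_mfun (fun w => tr a (xobs a w) ^+ 2 - trsqr a).
    by apply: bounded_mfunD; [exact: bounded_tr_sqr|exact: bounded_mfun_cst].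
  rewrite ExZ; last by under eq_fun do rewrite expr2; exact: bounded_mfunM.
  rewrite invfM -mulrA ler_piMr ?invr_ge0 ?(ltW n0)// mulrC ler_pdivrMr ?exprn_gt0// mul1r.
  (* Uses y^2 <= b^2 y for 0 <= y <= b^2, so the second moment of the truncated variable, at most 1,
     replaces its fourth. *)
  apply: (@le_trans _ _ (Ex P (fun w => trsqr a ^+ 2 + (b ^+ 2 - 2 * trsqr a) * tr a (xobs a w) ^+ 2))).
    apply: Ex_le.
    - by under eq_fun do rewrite expr2; exact: bounded_mfunM.
    - by apply: bounded_mfunD; [exact: bounded_mfun_cst|apply: bounded_mfunZ; exact: bounded_tr_sqr].
    - move=> w; have /andP[h1 h2] := tr2_itv a w.
      set y := tr a _ ^+ 2 in h1 h2 *; nra.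
  rewrite ExD; [|exact: bounded_mfun_cst|apply: bounded_mfunZ; exact: bounded_tr_sqr].
  rewrite Ex_cst ExZ; last exact: bounded_tr_sqr.
  rewrite -/(trsqr a); have /andP[h1 h2] := trsqr_itv a; have /andP[_ h3] := trsqr_bounds a.
  nra.
rewrite (sum_obs (fun j => if j == i then (nobs i)%:R^-1 else 0)) (bigD1 i)//= eqxx.
rewrite big1 => [|j /negbTE ->]; last by rewrite mulr0.
by rewrite addr0 divff// gt_eqF.
Qed.

End truncated.
End standardized_observations.

(** * The studentized statistics on a good event *)

Lemma union_bound (d : measure_display) (T : measurableType d) (R : realType)
    (P : probability T R) (K : finType) (A : K -> set T) (r : K -> R) :
  (forall k, measurable (A k)) -> (forall k, P (A k) <= (r k)%:E)%E ->
  (P (\bigcup_(k in [set: K]) A k) <= (\sum_k r k)%:E)%E.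
Proof.
move=> mA Ar.
have bA k : bounded_mfun (\1_(A k) : T -> R) by exact: bounded_mfun_indic.
apply: (@le_trans _ _ (Ex P (fun w => \sum_(k <- index_enum K) \1_(A k) w))%:E).
  apply: prob_le_Ex.
  - by apply: fin_bigcup_measurable => //; exact: finite_finset.
  - exact: bounded_mfun_sum.
  - by move=> w; exact: sumr_ge0.
  - move=> w [k _ Akw]; rewrite (bigD1 k)//= indicE mem_set// lerDl.
    exact: sumr_ge0.
rewrite Ex_sum// lee_fin; apply: ler_sum => k _.
by rewrite -lee_fin Ex_indic.
Qed.

Section group_statistics.
Context (R : realType) (E : experiment R).
Local Notation m := (ngroups E).
Local Notation P := (prob E).
Local Notation I := {i : 'I_m & 'I_(nobs i)}.
Local Notation Omega := (space E).
Local Notation n i := ((nobs i)%:R : R).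

Lemma nobs_gt0 (i : 'I_m) : 0 < n i.
Proof. by rewrite ltr0n (leq_trans _ (nobs_ge2 i)). Qed.

Definition se (i j : 'I_m) : R := Num.sqrt ((sd i) ^+ 2 / n i + (sd j) ^+ 2 / n j).

Lemma se2 i j : se i j ^+ 2 = (sd i) ^+ 2 / n i + (sd j) ^+ 2 / n j.
Proof. by rewrite sqr_sqrtr// addr_ge0// divr_ge0 ?sqr_ge0. Qed.

Let s2_gt0 (i : 'I_m) : 0 < (sd i) ^+ 2 / n i.
Proof. by rewrite divr_gt0 ?nobs_gt0// exprn_gt0// sd_gt0. Qed.

Lemma se_gt0 i j : 0 < se i j.
Proof. by rewrite sqrtr_gt0 addr_gt0. Qed.

Lemma seC i j : se i j = se j i.
Proof. by rewrite /se addrC. Qed.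

Lemma sd_le_se i j : sd i <= Num.sqrt (n i) * se i j.
Proof.
have h : 0 <= Num.sqrt (n i) * se i j by rewrite mulr_ge0 ?sqrtr_ge0// ltW ?se_gt0.
rewrite -(@ler_pXn2r _ 2) ?nnegrE ?(ltW (sd_gt0 i))// exprMn se2 sqr_sqrtr//.
rewrite mulrDr mulrCA divff ?gt_eqF ?nobs_gt0// mulr1 lerDl.
by rewrite mulr_ge0// ltW// s2_gt0.
Qed.

Definition acoef i j := sd i / (n i * se i j).

Lemma acoef_gt0 i j : 0 < acoef i j.
Proof. by rewrite divr_gt0 ?sd_gt0// mulr_gt0 ?nobs_gt0 ?se_gt0. Qed.

Lemma acoef_sqr i j : n i * acoef i j ^+ 2 = (sd i) ^+ 2 / n i / se i j ^+ 2.
Proof.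
rewrite /acoef; field.
by rewrite !gt_eqF ?nobs_gt0 ?se_gt0.
Qed.

Lemma acoef_sqrt i j : acoef i j * Num.sqrt (n i) <= 1.
Proof.
have r0 : 0 < Num.sqrt (n i) by rewrite sqrtr_gt0 nobs_gt0.
rewrite /acoef mulrAC ler_pdivrMr ?mulr_gt0 ?nobs_gt0 ?se_gt0// mul1r.
rewrite -[X in _ <= X * _](@sqr_sqrtr _ (n i)) ?(ltW (nobs_gt0 i))// expr2 -mulrA mulrC.
by rewrite ler_pM2l// sd_le_se.
Qed.

(** Coefficients of the standardized observations in the difference of the two centred sample means
    divided by its true standard error; [pc_norm] is the unit variance of that difference. *)
Definition pc i j : 'I_m -> R :=
  fun g => (g == i)%:R * acoef i j - (g == j)%:R * acoef j i.

Lemma sum_pc (f : 'I_m -> R) i j :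
  \sum_g pc i j g * f g = acoef i j * f i - acoef j i * f j.
Proof.
under eq_bigr do rewrite /pc mulrBl.
rewrite sumrB (bigD1 i)//= eqxx mul1r big1 ?addr0; last first.
  by move=> g /negbTE ->; rewrite !mul0r.
rewrite (bigD1 j)//= eqxx mul1r big1 ?addr0// => g /negbTE ->.
by rewrite !mul0r.
Qed.

Lemma pc_norm i j : i != j -> \sum_g n g * pc i j g ^+ 2 = 1.
Proof.
move=> ij; under eq_bigr do rewrite expr2 mulrCA.
rewrite sum_pc /pc !eqxx (negbTE ij) eq_sym (negbTE ij).
rewrite !mul1r !mul0r subr0 sub0r !mulrN opprK ![acoef _ _ * (n _ * _)]mulrCA -!expr2.
by rewrite !acoef_sqr (seC j i) -mulrDl -se2 divff// gt_eqF// exprn_gt0// se_gt0.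
Qed.

(** The left side is 2 plus twice the correlation. A group shared in the same position gives a
    product of two ratios sd / (sqrt n se), each of square at most [kap]. *)
Lemma pc_cross i j k l kap : i != j -> k != l -> (i, j) != (k, l) ->
  0 <= kap -> (forall i j, i != j -> (sd i) ^+ 2 / n i <= kap * se i j ^+ 2) ->
  \sum_g n g * (pc i j g + pc k l g) ^+ 2 <= 2 * (1 + kap).
Proof.
move=> ij kl ijkl kap0 kapP.
have -> : \sum_g n g * (pc i j g + pc k l g) ^+ 2 =
  \sum_g n g * pc i j g ^+ 2 + \sum_g n g * pc k l g ^+ 2
  + 2 * \sum_g pc i j g * (n g * pc k l g).
  by rewrite mulr_sumr -!big_split/=; apply: eq_bigr => g _; ring.
rewrite !pc_norm// sum_pc.
have cross i' j' l' : i' != j' -> i' != l' -> n i' * (acoef i' j' * acoef i' l') <= kap.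
  move=> ij' il'; rewrite -(@ler_pXn2r _ 2) ?nnegrE//; last first.
    by rewrite mulr_ge0 ?(ltW (nobs_gt0 _))// mulr_ge0// ltW// acoef_gt0.
  rewrite (_ : (_ * _) ^+ 2 = (n i' * acoef i' j' ^+ 2) * (n i' * acoef i' l' ^+ 2)); last by ring.
  rewrite !acoef_sqr expr2; apply: ler_pM; rewrite ?divr_ge0 ?sqr_ge0 ?(ltW (s2_gt0 _))//.
    by rewrite ler_pdivrMr ?exprn_gt0 ?se_gt0// kapP.
  by rewrite ler_pdivrMr ?exprn_gt0 ?se_gt0// kapP.
have nn g a b : 0 <= n g * (acoef g a * acoef g b).
  by rewrite mulr_ge0 ?(ltW (nobs_gt0 _))// mulr_ge0// ltW// acoef_gt0.
have nn' g a h b : 0 <= acoef g a * (n g * acoef h b).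
  by rewrite mulr_ge0 ?(ltW (acoef_gt0 _ _))// mulr_ge0 ?(ltW (acoef_gt0 _ _))// ltW ?nobs_gt0.
suff : acoef i j * (n i * pc k l i) - acoef j i * (n j * pc k l j) <= kap by lra.
rewrite /pc.
have [ik|ik] := eqVneq i k; have [jl|jl] := eqVneq j l.
- by move: ijkl; rewrite ik jl eqxx.
- subst k; rewrite (negbTE kl) [j == i]eq_sym (negbTE ij)
    !(mul0r, mul1r, subr0, sub0r, mulr0, oppr0).
  by rewrite mulrCA; exact: cross.
- subst l; rewrite (negbTE ij) [j == k]eq_sym (negbTE kl)
    !(mul0r, mul1r, subr0, sub0r, mulr0, oppr0).
  by rewrite !mulrN opprK mulrCA; apply: cross; rewrite // eq_sym.
(* Any shared group now sits in opposite positions, so its contribution to the correlation is at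
   most 0. *)
- rewrite !mul0r !subr0 !sub0r; case: (i == l); case: (j == k);
  rewrite ?mul1r ?mul0r ?oppr0 ?mulr0 ?subr0 ?mulrN ?sub0r//.
  + by have := nn' i j l k; have := nn' j i k l; lra.
  + by have := nn' i j l k; lra.
  + by have := nn' j i k l; lra.
Qed.

Section good_event.
Variables (p K b beta x : R).
Hypotheses (p2 : 2 <= p) (b1 : 1 <= b).
Hypothesis moment : moment_bound E p K.
Hypotheses (beta1 : beta <= 1) (x0 : 0 <= x).
Hypothesis b_le : small_steps E b beta.
Hypothesis mean_le : forall i : 'I_m, Num.sqrt (n i) * (K * b `^ (1 - p)) <= beta.
Hypothesis var_le : K * b `^ (2 - p) <= beta.

Let b0 : 0 < b. Proof. exact: lt_le_trans b1. Qed.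

Let r_gt0 (i : 'I_m) : 0 < Num.sqrt (n i).
Proof. by rewrite sqrtr_gt0 nobs_gt0. Qed.

Let r2 (i : 'I_m) : Num.sqrt (n i) ^+ 2 = n i.
Proof. by rewrite sqr_sqrtr// ltW// nobs_gt0. Qed.

Local Notation tg k := (Tagged (fun i : 'I_m => 'I_(nobs i)) k : I).

Definition gW (i : 'I_m) : 'I_m -> R := fun g => (g == i)%:R / Num.sqrt (n i).

(** On this event no observation is altered by truncation, and the normalized mean and sum of
    squares of each group deviate by at most x. The passage between [tstat] and [W] is then
    pointwise. *)
Definition good (w : Omega) : Prop :=
  [/\ forall a : I, `|std a (xobs a w)| <= b,
      forall i, `|W b (gW i) w| <= x & forall i, `|U b i w| <= x].

Definition trsum (i : 'I_m) (w : Omega) : R :=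
  \sum_(k < nobs i) tr b (tg k) (xobs (tg k) w).

Definition trmeansum (i : 'I_m) : R := \sum_(k < nobs i) trmean b (tg k).

Lemma WE c w : W b c w = \sum_i c i * (trsum i w - trmeansum i).
Proof.
rewrite /W /lin.
rewrite -(@sig_big_dep _ _ _ _ (fun i : 'I_m => 'I_(nobs i)) xpredT
  (fun _ => xpredT) (fun i k => c i * (tr b (tg k) (xobs (tg k) w) - trmean b (tg k))))/=.
by apply: eq_bigr => i _; rewrite -mulr_sumr sumrB.
Qed.

Lemma W_gW i w : W b (gW i) w = (trsum i w - trmeansum i) / Num.sqrt (n i).
Proof.
rewrite WE (bigD1 i)//= big1 ?addr0; last by move=> g /negbTE gi; rewrite /gW gi !mul0r.
by rewrite /gW eqxx mul1r mulrC.
Qed.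

Lemma trmeansum_le i : `|trmeansum i| <= Num.sqrt (n i) * beta.
Proof.
apply: (@le_trans _ _ (n i * (K * b `^ (1 - p)))).
  rewrite (le_trans (ler_norm_sum _ _ _))//.
  rewrite (_ : n i * _ = \sum_(k < nobs i) (K * b `^ (1 - p))); last first.
    by rewrite sumr_const card_ord mulr_natl.
  by apply: ler_sum => k _; apply: trmean_le.
by rewrite -[X in X * _ <= _]r2 expr2 -mulrA ler_pM2l.
Qed.

Section at_good_point.
Variable w : Omega.
Hypothesis gw : good w.

Let stdE (i : 'I_m) (k : 'I_(nobs i)) :
  tr b (tg k) (xobs (tg k) w) = (obs k w - mean i) / sd i.
Proof. by case: gw => H _ _; apply: trunc_id; exact: (H (tg k)). Qed.

Lemma trsum_mean i : trsum i w = n i / sd i * (sample_mean i w - mean i).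
Proof.
rewrite /trsum; under eq_bigr do rewrite stdE.
rewrite -mulr_suml sumrB sumr_const card_ord /sample_mean -mulr_natl.
by field; rewrite !gt_eqF ?nobs_gt0 ?sd_gt0.
Qed.

Lemma sample_mean_dev i :
  `|sample_mean i w - mean i| <= (x + beta) * (sd i / Num.sqrt (n i)).
Proof.
have [_ Wx _] := gw; have sd0 := sd_gt0 i; have n0 := nobs_gt0 i.
have -> : sample_mean i w - mean i =
    sd i / n i * (Num.sqrt (n i) * W b (gW i) w + trmeansum i).
  rewrite W_gW mulrCA divff ?gt_eqF// mulr1 subrK trsum_mean.
  by field; rewrite !gt_eqF.
rewrite normrM ger0_norm ?divr_ge0 ?(ltW sd0) ?(ltW n0)//.
apply: (@le_trans _ _ (sd i / n i * (Num.sqrt (n i) * (x + beta)))).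
  rewrite ler_wpM2l ?divr_ge0 ?(ltW sd0) ?(ltW n0)//.
  rewrite (le_trans (ler_normD _ _))// mulrDr lerD ?trmeansum_le//.
  by rewrite normrM (gtr0_norm (r_gt0 i)) ler_pM2l.
rewrite -[X in _ / X]r2; apply: eqW.
by field; rewrite gt_eqF.
Qed.

Let beta0 (i : 'I_m) : 0 < beta.
Proof.
have := b_le i; rewrite leNgt => /negP H; rewrite ltNge; apply/negP => b_.
apply: H; apply: (@le_lt_trans _ _ 0); last by rewrite mulr_gt0.
by rewrite mulr_le0_ge0// sqrtr_ge0.
Qed.

(** Here V (n - 1) = A - Z^2 / n with A the sum of squares and Z the sum of the standardized
    observations. The centre of A is n up to n beta, its fluctuation is at most b sqrt(n) x <= n x
    beta, and Z^2 / n is at most (x + beta)^2. *)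
Lemma sample_var_bounds i : 1 - 4 * (1 + x) ^+ 2 * beta <= sample_var i w / sd i ^+ 2
  <= 1 + 4 * (1 + x) ^+ 2 * beta.
Proof.
have [_ Wx Ux] := gw; have sd0 := sd_gt0 i; have n0 := nobs_gt0 i.
have be0 := beta0 i.
have n2 : 2 <= n i by rewrite ler_nat nobs_ge2.
set V := sample_var i w / sd i ^+ 2.
pose A := \sum_(k < nobs i) tr b (tg k) (xobs (tg k) w) ^+ 2.
set Z := trsum i w.
have VE : V * (n i - 1) = A - Z ^+ 2 / n i.
  have -> : A - Z ^+ 2 / n i = \sum_(k < nobs i) (tr b (tg k) (xobs (tg k) w) - Z / n i) ^+ 2.
    under [RHS]eq_bigr do rewrite sqrrB.
    rewrite big_split/= sumr_const card_ord sumrB -/A.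
    under [in RHS]eq_bigr do rewrite -mulrnAr.
    rewrite -mulr_suml -/(trsum i w) -/Z.
    by rewrite -[_ *+ nobs i]mulr_natl mulr2n; field; rewrite gt_eqF.
  rewrite /V /sample_var (_ : _ * (n i - 1) = \sum_(k < nobs i) (obs k w - sample_mean i w) ^+ 2 / sd i ^+ 2).
    apply: eq_bigr => k _; rewrite stdE /Z trsum_mean.
    by field; rewrite !gt_eqF.
  rewrite -mulr_suml; field; rewrite !gt_eqF//; lra.
have V0 : 0 <= V.
  have i1 : 0 <= (n i - 1)^-1 by rewrite invr_ge0; lra.
  apply: divr_ge0; last exact: sqr_ge0; apply: mulr_ge0 => //.
  by apply: sumr_ge0 => k _; exact: sqr_ge0.
have AE : A = \sum_(k < nobs i) trsqr b (tg k) + b * Num.sqrt (n i) * U b i w.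
  have UE : U b i w = (A - \sum_(k < nobs i) trsqr b (tg k)) / (b * Num.sqrt (n i)).
    rewrite /U -(@sig_big_dep _ _ _ _ (fun i : 'I_m => 'I_(nobs i)) xpredT
      (fun _ => xpredT) (fun j k => sqs b 1 i (tg k) (xobs (tg k) w)))/=.
    rewrite (bigD1 i)//= [X in _ + X]big1 ?addr0; last first.
      by move=> j /negbTE ji; rewrite big1// => k _; rewrite /sqs/= ji.
    rewrite -sumrB mulr_suml; apply: eq_bigr => k _.
    by rewrite /sqs/= eqxx mul1r.
  by rewrite UE; field; rewrite !gt_eqF.
have S1 : n i * (1 - beta) <= \sum_(k < nobs i) trsqr b (tg k) <= n i.
  have cE (c : R) : n i * c = \sum_(k < nobs i) c by rewrite sumr_const card_ord mulr_natl.
  rewrite -[X in _ <= _ <= X]mulr1 !cE; apply/andP; split; apply: ler_sum => k _.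
    have /andP[h _] := trsqr_bounds p2 b0 moment (tg k).
    by apply: le_trans h; rewrite lerB.
  by have /andP[_ h] := trsqr_bounds p2 b0 moment (tg k).
have br : b <= beta * Num.sqrt (n i) by apply: le_trans (b_le i); have := b0; lra.
have bU : `|b * Num.sqrt (n i) * U b i w| <= n i * (x * beta).
  rewrite normrM ger0_norm ?mulr_ge0 ?(ltW b0) ?(ltW (r_gt0 i))//.
  rewrite -[X in _ <= X * _]r2 (_ : _ ^+ 2 * (x * beta) = beta * Num.sqrt (n i) * Num.sqrt (n i) * x); last by ring.
  by apply: ler_pM => //; rewrite ?mulr_ge0 ?(ltW b0) ?(ltW (r_gt0 i))// ler_pM2r.
have Z2 : Z ^+ 2 / n i <= (x + beta) ^+ 2.
  rewrite ler_pdivrMr// -r2 -exprMn -(real_normK (num_real Z)) lerXn2r ?nnegrE//.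
    by rewrite mulr_ge0 ?(ltW (r_gt0 i))// addr_ge0// ltW.
  have -> : Z = Num.sqrt (n i) * W b (gW i) w + trmeansum i.
    by rewrite W_gW mulrCA divff ?gt_eqF// mulr1 subrK.
  rewrite (le_trans (ler_normD _ _))// [leRHS]mulrC mulrDr lerD ?trmeansum_le//.
  by rewrite normrM (gtr0_norm (r_gt0 i)) ler_pM2l.
(* From 1 <= b <= beta sqrt(n). Constants are thus at most n beta^2, which absorbs (x + beta)^2 and
   the difference between n and n - 1. *)
have nb : 1 <= n i * beta ^+ 2.
  rewrite -r2 -exprMn mulrC -[leLHS](expr1n _ 2) lerXn2r ?nnegrE//.
    by rewrite mulr_ge0 ?(ltW (r_gt0 i))// ltW.
  exact: le_trans br.
clear - VE V0 AE S1 bU Z2 nb x0 be0 beta1 n2 n0.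
move: S1 bU; rewrite ler_norml => /andP[S1 S2] /andP[U1 U2].
have Z0 : 0 <= Z ^+ 2 / n i by rewrite divr_ge0 ?sqr_ge0 ?ltW.
have xb : (x + beta) ^+ 2 <= n i * ((1 + x) ^+ 2 * beta).
  have h1 : (x + beta) ^+ 2 <= (1 + x) ^+ 2.
    by rewrite lerXn2r ?nnegrE ?addr_ge0 ?(ltW be0)// addrC lerD2r.
  have h2 : 1 <= n i * beta.
    by apply: (le_trans nb); rewrite ler_pM2l// expr2 ler_piMl// ltW.
  rewrite mulrCA -[leLHS]mulr1; apply: ler_pM => //; exact: sqr_ge0.
have q1 : beta + x * beta <= (1 + x) ^+ 2 * beta.
  rewrite -{1}[beta]mul1r -mulrDl ler_pM2r//.
  by rewrite expr2 ler_peMr ?lerDl// addr_ge0.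
have qb : 0 <= (1 + x) ^+ 2 * beta by rewrite mulr_ge0 ?sqr_ge0 ?ltW.
apply/andP; split.
  rewrite -(ler_pM2l n0).
  have : V * (n i - 1) <= n i * V by rewrite mulrC ler_wpM2r//; lra.
  rewrite VE AE.
  have -> : n i * (1 - 4 * (1 + x) ^+ 2 * beta) =
    n i - 4 * (n i * ((1 + x) ^+ 2 * beta)) by ring.
  have := ler_wpM2l (ltW n0) q1; rewrite mulrDr.
  move: S1; rewrite mulrBr mulr1; lra.
have n1 : 0 < n i - 1 by lra.
rewrite -(ler_pM2r n1) VE AE.
have -> : (1 + 4 * (1 + x) ^+ 2 * beta) * (n i - 1) =
   n i - 1 + 4 * ((n i - 1) * ((1 + x) ^+ 2 * beta)) by ring.
have xb0 : 0 <= x * beta by rewrite mulr_ge0// ltW.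
have h2 : 1 <= n i * ((1 + x) ^+ 2 * beta).
  apply: (le_trans nb); rewrite ler_pM2l//; apply: le_trans q1.
  by rewrite -[leLHS]addr0 lerD// expr2 ler_piMl// ltW.
have h3 : n i * ((1 + x) ^+ 2 * beta) <= 2 * ((n i - 1) * ((1 + x) ^+ 2 * beta)).
  by rewrite [leRHS]mulrA; apply: ler_wpM2r => //; lra.
have h4 : n i * (x * beta) <= n i * ((1 + x) ^+ 2 * beta).
  by rewrite ler_pM2l//; apply: le_trans q1; rewrite lerDr ltW.
lra.
Qed.

Hypothesis eta_lt1 : 4 * (1 + x) ^+ 2 * beta < 1.
Local Notation eta := (4 * (1 + x) ^+ 2 * beta).

Definition sehat i j : R :=
  Num.sqrt (sample_var i w / n i + sample_var j w / n j).

Lemma sehat_bounds i j : (1 - eta) * se i j <= sehat i j <= (1 + eta) * se i j.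
Proof.
have e0 : 0 <= eta.
  by apply: mulr_ge0; [apply: mulr_ge0 => //; exact: sqr_ge0|exact: (ltW (beta0 i))].
have vb k : (1 - eta) * (sd k ^+ 2 / n k) <= sample_var k w / n k <=
    (1 + eta) * (sd k ^+ 2 / n k).
  have := sample_var_bounds k; have s0 : 0 < sd k ^+ 2 by rewrite exprn_gt0 ?sd_gt0.
  rewrite ler_pdivlMr// ler_pdivrMr// => /andP[h1 h2].
  have i0 : 0 < (n k)^-1 by rewrite invr_gt0 nobs_gt0.
  by apply/andP; split; rewrite mulrA ler_pM2r.
have /andP[i1 i2] := vb i; have /andP[j1 j2] := vb j.
have s0 := se_gt0 i j.
have V1 : (1 - eta) * se i j ^+ 2 <= sample_var i w / n i + sample_var j w / n j.
  by rewrite se2 mulrDr lerD.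
have V2 : sample_var i w / n i + sample_var j w / n j <= (1 + eta) * se i j ^+ 2.
  by rewrite se2 mulrDr lerD.
have q0 : 0 <= sample_var i w / n i + sample_var j w / n j.
  by apply: le_trans V1; apply: mulr_ge0; [rewrite subr_ge0 ltW|exact: sqr_ge0].
have e1 := eta_lt1; set e := eta in e0 e1 V1 V2 *.
apply/andP; split.
  rewrite -(@ler_pXn2r _ 2) ?nnegrE ?sqrtr_ge0//; last by rewrite mulr_ge0 ?(ltW s0)//; lra.
  rewrite sqr_sqrtr//; apply: le_trans V1; rewrite exprMn ler_pM2r ?exprn_gt0//; nra.
rewrite -(@ler_pXn2r _ 2) ?nnegrE ?sqrtr_ge0//; last by rewrite mulr_ge0 ?(ltW s0)//; lra.
rewrite sqr_sqrtr//; apply: (le_trans V2); rewrite exprMn ler_pM2r ?exprn_gt0//; nra.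
Qed.

Lemma W_pc i j :
  `|(sample_mean i w - mean i - (sample_mean j w - mean j)) / se i j - W b (pc i j) w|
  <= 2 * beta.
Proof.
rewrite WE sum_pc.
have s0 := se_gt0 i j.
have aE k l : acoef k l * trsum k w = (sample_mean k w - mean k) / se k l.
  rewrite trsum_mean /acoef; field.
  by rewrite !gt_eqF ?nobs_gt0 ?sd_gt0 ?se_gt0.
rewrite !mulrBr !aE (seC j i).
have -> : (sample_mean i w - mean i - (sample_mean j w - mean j)) / se i j -
  ((sample_mean i w - mean i) / se i j - acoef i j * trmeansum i -
   ((sample_mean j w - mean j) / se i j - acoef j i * trmeansum j)) =
  acoef i j * trmeansum i - acoef j i * trmeansum j by ring.
have tb k l : `|acoef k l * trmeansum k| <= beta.
  rewrite normrM (gtr0_norm (acoef_gt0 k l)).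
  apply: (le_trans (ler_wpM2l (ltW (acoef_gt0 k l)) (trmeansum_le k))).
  by rewrite mulrA ler_piMl ?acoef_sqrt// ltW// (beta0 k).
by rewrite (le_trans (ler_normB _ _))// mulr_natl mulr2n lerD.
Qed.

(** When the first mean is at most the second, centring can only raise the numerator; the relative
    error [eta] of the estimated standard error and the truncation bias 2 beta make up the shift. *)
Lemma tstat_ge_W i j (z : R) : 0 <= z -> z <= tstat i j w -> mean i <= mean j ->
  z - (z * eta + 2 * beta) <= W b (pc i j) w.
Proof.
move=> z0 zt mij; have s0 := se_gt0 i j.
have /andP[h1 _] := sehat_bounds i j.
have sh0 : 0 < sehat i j by apply: lt_le_trans h1; rewrite mulr_gt0// subr_gt0.
move: zt; rewrite /tstat -/(sehat i j) ler_pdivlMr// => zt.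
have := W_pc i j; rewrite ler_norml => /andP[_ h2].
have h3 : z * (1 - eta) <= (sample_mean i w - mean i - (sample_mean j w - mean j)) / se i j.
  rewrite ler_pdivlMr// -[leLHS]mulrA.
  by apply: (le_trans (ler_wpM2l z0 h1)); lra.
lra.
Qed.

Lemma tstat_signal i j (y : R) : y * se i j <= `|mean i - mean j| ->
  y - 3 / 2 * (x + beta) <= (1 + eta) * `|tstat i j w|.
Proof.
move=> yd; have s0 := se_gt0 i j.
have be0 := beta0 i.
have /andP[h1 h2] := sehat_bounds i j.
have sh0 : 0 < sehat i j by apply: lt_le_trans h1; rewrite mulr_gt0// subr_gt0.
rewrite /tstat -/(sehat i j) normrM normfV (gtr0_norm sh0) mulrA ler_pdivlMr//.
have xb : 0 <= x + beta by rewrite addr_ge0// ltW.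
(* Cauchy-Schwarz gives the factor sqrt 2, rounded up to 3/2. *)
have ssum : sd i / Num.sqrt (n i) + sd j / Num.sqrt (n j) <= 3 / 2 * se i j.
  have p0 (k : 'I_m) : 0 <= sd k / Num.sqrt (n k) by rewrite divr_ge0// ltW// sd_gt0.
  rewrite -(@ler_pXn2r _ 2) ?nnegrE ?addr_ge0//; last by rewrite mulr_ge0 ?(ltW s0).
  rewrite exprMn se2.
  have sk (k : 'I_m) : (sd k / Num.sqrt (n k)) ^+ 2 = sd k ^+ 2 / n k by rewrite expr_div_n r2.
  rewrite -!sk; set A := sd i / _; set B := sd j / _.
  have := sqr_ge0 (A - B); have := sqr_ge0 A; have := sqr_ge0 B; nra.
have di := sample_mean_dev i; have dj := sample_mean_dev j.
have D : `|mean i - mean j| - (x + beta) * (3 / 2 * se i j) <= `|sample_mean i w - sample_mean j w|.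
  have := ler_wpM2l xb ssum; rewrite mulrDr.
  move: di dj; rewrite !ler_norml => /andP[a1 a2] /andP[c1 c2].
  have := ler_norm (sample_mean i w - sample_mean j w).
  have := ler_norm (- (sample_mean i w - sample_mean j w)); rewrite normrN.
  by have [h|/ltW h] := leP 0 (mean i - mean j); [rewrite (ger0_norm h)|rewrite (ler0_norm h)]; lra.
have e0 : 0 <= eta.
  by apply: mulr_ge0; [apply: mulr_ge0 => //; exact: sqr_ge0|exact: ltW].
have e1 : 0 < 1 + eta by rewrite (lt_le_trans ltr01)// lerDl.
have [neg|pos] := leP (y - 3 / 2 * (x + beta)) 0.
  apply: (@le_trans _ _ 0); first by rewrite mulr_le0_ge0// ltW.
  by rewrite mulr_ge0// ltW.
apply: (le_trans (ler_wpM2l (ltW pos) h2)).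
rewrite mulrCA ler_pM2l//.
apply: le_trans D; apply: le_trans (lerB yd (lexx _)); lra.
Qed.

End at_good_point.

Let beta_ge0 (i : 'I_m) : 0 <= beta.
Proof. exact: small_steps_ge0 i (ltW b0) b_le. Qed.

Lemma good_probability : x * beta <= 1 / 150 ->
  exists2 G : set Omega, measurable G & G `<=` [set w | good w] /\
  (P (~` G) <= ((\sum_(i : 'I_m) n i) * (K * b `^ (- p)) +
                4 * m%:R * expR (- (49 / 100 * x ^+ 2)))%:E)%E.
Proof.
move=> xb.
pose sg (s : bool) : R := if s then 1 else -1.
have sg1 s : `|sg s| = 1 by case: s; rewrite /sg ?normr1// normrN normr1.
(* One event per observation and, per group, four events: mean or sum of squares, with either sign.
   The latter produce the term 4 m exp(- 49/100 x^2). *)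
pose B (k : I + ('I_m * bool) * bool) : set Omega :=
  match k with
  | inl a => [set w | b < `|std a (xobs a w)|]
  | inr (i, true, s) => [set w | x <= W b (fun g => sg s * gW i g) w]
  | inr (i, false, s) => [set w | x <= \sum_a sqs b (sg s) i a (xobs a w)]
  end.
pose r (k : I + ('I_m * bool) * bool) : R :=
  match k with inl _ => K * b `^ (- p) | inr _ => expR (- (49 / 100 * x ^+ 2)) end.
have mB k : measurable (B k).
  case: k => [a|[[i [|]] s]] /=.
  - apply: measurable_gt_set; apply: measurableT_comp => //.
    exact: measurable_stdobs.
  - by apply: measurable_ge_set; exact: measurable_W.
  - apply: measurable_ge_set; apply: measurable_sum => a.
    by apply: measurableT_comp; [exact: measurable_sqs|exact: measurable_funP].
have rB k : (P (B k) <= (r k)%:E)%E.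
  case: k => [a|[[i [|]] s]] /=.
  - exact: stdobs_tail.
  - apply: (@chernoff_single _ _ _ P I (@xobs _ E) (lin b (fun g => sg s * gW i g)) beta) => //.
    + exact: obs_independent.
    + by move=> a; exact: measurable_lin.
    + move=> a w; apply: lin_bound => // g.
      rewrite normrM sg1 mul1r /gW normrM; case: (g == i); last first.
        by rewrite normr0 !mul0r (beta_ge0 i).
      rewrite normr1 mul1r normfV (gtr0_norm (r_gt0 i)) mulrC ler_pdivrMr//.
    + by move=> a; exact: lin_mean.
    + apply: (le_trans (lin_var_sum p2 b0 moment _)).
      rewrite (bigD1 i)//= big1 ?addr0; last first.
        by move=> g /negbTE gi; rewrite /gW gi mul0r mulr0 expr0n/= mulr0.
      rewrite exprMn -(real_normK (num_real (sg s))) sg1 expr1n mul1r /gW eqxx.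
      by rewrite expr_div_n r2 expr1n mulrA mulr1 divff// gt_eqF// nobs_gt0.
    + exact: (beta_ge0 i).
  - apply: (@chernoff_single _ _ _ P I (@xobs _ E) (sqs b (sg s) i) beta) => //.
    + exact: obs_independent.
    + by move=> a; exact: measurable_sqs.
    + move=> a w; apply: (le_trans (sqs_bound b0 i a w (sg1 s))).
      by rewrite ler_pdivrMr//; apply: le_trans (b_le i); have := b0; lra.
    + by move=> a; exact: sqs_mean.
    + exact: (sqs_var_sum p2 b0 moment).
    + exact: (beta_ge0 i).
exists (~` \bigcup_(k in [set: I + ('I_m * bool) * bool]) B k).
  by apply: measurableC; apply: fin_bigcup_measurable => //; exact: finite_finset.
split.
  move=> w nB; split => [a|i|i].
  - by rewrite leNgt; apply/negP => h; apply: nB; exists (inl a).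
  - rewrite ler_norml; apply/andP; split; rewrite leNgt; apply/negP => /ltW h; apply: nB.
      exists (inr (i, true, false)) => //=; rewrite /sg.
      rewrite (_ : (fun g => _) = (fun g => - gW i g)); first by rewrite W_opp; lra.
      by apply/funext => g; rewrite mulN1r.
    exists (inr (i, true, true)) => //=; rewrite /sg.
    by rewrite (_ : (fun g => _) = gW i)//; apply/funext => g; rewrite mul1r.
  - rewrite ler_norml; apply/andP; split; rewrite leNgt; apply/negP => /ltW h; apply: nB.
      by exists (inr (i, false, false)) => //=; rewrite /sg U_opp; lra.
    by exists (inr (i, false, true)).
rewrite setCK; apply: (le_trans (union_bound mB rB)).
rewrite lee_fin big_sumType/= sumr_const sumr_const !card_prod card_ord card_bool.
apply: eqW.
have -> : \sum_(i : 'I_m) n i = #|{: I}|%:R.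
  by have := sum_obs (fun _ : 'I_m => 1 : R); rewrite sumr_const => ->; apply: eq_bigr => i _; rewrite mulr1.
congr (_ + _); first by rewrite mulr_natl.
have -> : (m * 2 * 2 = 4 * m)%N by lia.
by rewrite -[LHS]mulr_natl natrM.
Qed.

End good_event.
End group_statistics.

(** * Exceedances of a level *)

Section exceedances.
Context {R : realType}.
Implicit Types (E : experiment R) (eps t eta p K b beta kap z del : R).

Definition exceedances E b (y : R) (w : space E) : nat :=
  #|[set x in ordered_pairs E | y <= W b (pc x.1 x.2) w]%SET|.

Lemma pc_bound E b beta (i j : 'I_(ngroups E)) : i != j -> 0 < b ->
  small_steps E b beta ->
  forall g, `|pc i j g| * (2 * b) <= beta.
Proof.
move=> ij b0 b_le g.
have be0 := small_steps_ge0 i (ltW b0) b_le.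
have ab (k l : 'I_(ngroups E)) : `|acoef k l| * (2 * b) <= beta :> R.
  rewrite (gtr0_norm (acoef_gt0 k l)).
  apply: (le_trans (ler_wpM2l (ltW (acoef_gt0 k l)) (b_le k))).
  by rewrite mulrCA ler_piMr// acoef_sqrt.
rewrite /pc; have [->|gi] := eqVneq g i.
  by rewrite (negbTE ij) mul1r mul0r subr0.
have [e|gj] := eqVneq g j; first by rewrite mul0r mul1r sub0r normrN.
by rewrite !mul0r subr0 normr0 mul0r.
Qed.

(** [moderate_deviation] at z - del, which stays above t / 2, followed by [Phibar_shift] back to z.
    Each costs a factor 1 + e with (1 + e)^2 <= 1 + eps. *)
Lemma pair_tail eps t : 0 < eps -> 0 < t -> exists2 eta, 0 < eta &
  forall E p K b beta z del (i j : 'I_(ngroups E)), 2 <= p -> 0 < b ->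
  moment_bound E p K ->
  small_steps E b beta ->
  i != j -> t <= z -> beta * (1 + z) ^+ 8 <= eta ->
  0 <= del -> del * (1 + z) <= eta ->
  (prob E [set w | (z - del <= W b (pc i j) w)%R] <= ((1 + eps) * Phibar z)%:E)%E.
Proof.
move=> eps0 t00.
pose e := Num.min eps 1 / 3.
have e0 : 0 < e by rewrite divr_gt0// lt_min eps0 ltr01.
have ee : (1 + e) * (1 + e) <= 1 + eps.
  have h1 : e <= 1 / 3 by rewrite ler_pM2r ?invr_gt0// ge_min lexx orbT.
  have h2 : e <= eps / 3 by rewrite ler_pM2r ?invr_gt0// ge_min lexx.
  nra.
have [eta1 eta10 H1] := Phibar_shift e0.
have t02 : 0 < t / 2 by lra.
have [eta2 eta20 H2] := moderate_deviation e0 t02.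
exists (Num.min (Num.min eta1 eta2) (t / 2)); first by rewrite !lt_min eta10 eta20.
move=> E p K b beta z del i j p2 b0 mom b_le ij t0z; rewrite !le_min.
move=> /andP[/andP[_ bz] _] del0 /andP[/andP[dz1 _] dz3].
have z0 : 0 < z by lra.
have dle : del <= t / 2.
  by apply: le_trans dz3; rewrite ler_peMr//; lra.
have be0 := small_steps_ge0 i (ltW b0) b_le.
apply: (@le_trans _ _ ((1 + e) * Phibar (z - del))%:E).
  apply: (H2 _ _ _ _ (@xobs _ E) (lin b (pc i j)) beta).
  - exact: obs_independent.
  - by move=> a; exact: measurable_lin.
  - by move=> a w; apply: lin_bound => //; exact: pc_bound.
  - by move=> a; exact: lin_mean.
  - by apply: (le_trans (lin_var_sum p2 b0 mom _)); rewrite pc_norm.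
  - exact: be0.
  - lra.
  - apply: le_trans bz; rewrite ler_wpM2l// lerXn2r ?nnegrE; lra.
rewrite lee_fin.
apply: (@le_trans _ _ ((1 + e) * ((1 + e) * Phibar z))).
  by rewrite ler_wpM2l ?H1 ?(ltW z0)//; lra.
by rewrite mulrA ler_wpM2r// Phibar_ge0.
Qed.

(** If both statistics exceed the level, their sum exceeds twice the level; the sum is again a [W],
    of steps at most 2 beta and variance at most 2 (1 + kap). *)
Lemma joint_tail E p K b beta kap z del (x y : 'I_(ngroups E) * 'I_(ngroups E)) :
  2 <= p -> 0 < b ->
  moment_bound E p K ->
  small_steps E b beta ->
  0 <= kap ->
  (forall i j : 'I_(ngroups E), i != j -> (sd i) ^+ 2 / (nobs i)%:R <= kap * se i j ^+ 2) ->
  x.1 != x.2 -> y.1 != y.2 -> x != y ->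
  0 <= z -> beta * (1 + z) ^+ 8 <= 1 / 2 -> 0 <= del -> del * (1 + z) <= 1 ->
  (prob E ([set w | (z - del <= W b (pc x.1 x.2) w)%R] `&` [set w | (z - del <= W b (pc y.1 y.2) w)%R])
   <= (expR (5 - z ^+ 2 / (1 + kap)))%:E)%E.
Proof.
move=> p2 b0 mom b_le kap0 kapP x12 y12 xy z0 bz del0 dz.
pose c g := pc x.1 x.2 g + pc y.1 y.2 g.
have be0 := small_steps_ge0 x.1 (ltW b0) b_le.
apply: (@le_trans _ _ (prob E [set w | 2 * (z - del) <= W b c w])).
  apply: le_measure; rewrite ?inE.
  - by apply: measurableI; apply: measurable_ge_set; exact: measurable_W.
  - by apply: measurable_ge_set; exact: measurable_W.
  - by move=> w [/= h1 h2]; rewrite W_add; lra.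
apply: (@chernoff_pair _ _ _ _ _ (@xobs _ E) (lin b c) (2 * beta) kap) => //.
- exact: obs_independent.
- by move=> a; exact: measurable_lin.
- move=> a w; apply: lin_bound => // g.
  have := pc_bound x12 b0 b_le g; have := pc_bound y12 b0 b_le g.
  have b2 : 0 <= 2 * b by rewrite mulr_ge0// ltW.
  have := ler_wpM2r b2 (ler_normD (pc x.1 x.2 g) (pc y.1 y.2 g)).
  rewrite mulrDl /c; lra.
- by move=> a; exact: lin_mean.
- apply: (le_trans (lin_var_sum p2 b0 mom _)); apply: pc_cross; rewrite -?surjective_pairing//.
- by rewrite mulr_ge0.
- by rewrite -mulrA; lra.
Qed.

Lemma card_meeting_pairs (m : nat) (x : 'I_m * 'I_m) (Q : {set 'I_m * 'I_m}) :
  (#|[set y in Q | [|| y.1 == x.1, y.1 == x.2, y.2 == x.1 | y.2 == x.2]]%SET| <= 4 * m)%N.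
Proof.
pose f (v : 'I_m * bool * bool) : 'I_m * 'I_m :=
  let i := if v.2 then x.1 else x.2 in if v.1.2 then (i, v.1.1) else (v.1.1, i).
have -> : (4 * m = #|[set: 'I_m * bool * bool]%SET|)%N.
  by rewrite cardsT !card_prod card_ord card_bool; lia.
apply: leq_trans (leq_imset_card f _); apply: subset_leq_card.
apply/fintype.subsetP => -[i j]; rewrite inE/= => /andP[_] /or4P[] /eqP e; apply/imsetP.
- by exists (j, true, true); rewrite ?inE// /f/= e.
- by exists (j, true, false); rewrite ?inE// /f/= e.
- by exists (i, false, true); rewrite ?inE// /f/= e.
- by exists (i, false, false); rewrite ?inE// /f/= e.
Qed.

(** [dependent_chebyshev] with M the number of ordered pairs times [Phibar z]. Each pair contributes
    its own tail and at most 4 m joint tails with the pairs it meets. *)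
Lemma exceedances_tail eps t : 0 < eps -> 0 < t -> exists2 eta, 0 < eta &
  forall E p K b beta kap z del, 2 <= p -> 0 < b ->
  moment_bound E p K ->
  small_steps E b beta ->
  0 <= kap ->
  (forall i j : 'I_(ngroups E), i != j -> (sd i) ^+ 2 / (nobs i)%:R <= kap * se i j ^+ 2) ->
  (0 < #|ordered_pairs E|)%N ->
  t <= z -> beta * (1 + z) ^+ 8 <= eta -> 0 <= del -> del * (1 + z) <= eta ->
  (prob E [set w | ((1 + 2 * eps) * (#|ordered_pairs E|%:R * Phibar z) <=
                    (exceedances b (z - del) w)%:R)%R] <=
   (((1 + eps) * Phibar z + 4 * (ngroups E)%:R * expR (5 - z ^+ 2 / (1 + kap)))
     / (eps ^+ 2 * #|ordered_pairs E|%:R * Phibar z ^+ 2))%:E)%E.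
Proof.
move=> eps0 t00; have [eta eta0 H] := pair_tail eps0 t00.
exists (Num.min eta (1 / 2)); first by rewrite lt_min eta0; lra.
move=> E p K b beta kap z del p2 b0 mom b_le kap0 kapP Q0 t0z.
rewrite !le_min => /andP[bz1 bz2] del0 /andP[dz1 dz2].
pose A (x : 'I_(ngroups E) * 'I_(ngroups E)) := [set w | z - del <= W b (pc x.1 x.2) w].
pose dep (x y : 'I_(ngroups E) * 'I_(ngroups E)) :=
  [|| y.1 == x.1, y.1 == x.2, y.2 == x.1 | y.2 == x.2].
have mA x : measurable (A x) by apply: measurable_ge_set; exact: measurable_W.
set Q := ordered_pairs E in Q0 *.
have Qne x : x \in Q -> x.1 != x.2 by rewrite inE => /andP[].
have Ph0 := Phibar_gt0 z; have z0 : 0 < z by lra.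
have tail x : x \in Q -> (prob E (A x) <= ((1 + eps) * Phibar z)%:E)%E.
  by move=> xQ; apply: (H _ _ _ _ _ _ _ _ _ p2 b0 mom b_le) => //; exact: Qne.
set J := expR (5 - z ^+ 2 / (1 + kap)).
pose D := #|Q|%:R * ((1 + eps) * Phibar z + 4 * (ngroups E)%:R * J).
have Q0' : 0 < #|Q|%:R :> R by rewrite ltr0n.
have -> : ((1 + eps) * Phibar z + 4 * (ngroups E)%:R * J)
     / (eps ^+ 2 * #|Q|%:R * Phibar z ^+ 2) = D / (eps * (#|Q|%:R * Phibar z)) ^+ 2.
  by rewrite /D; field; rewrite !gt_eqF.
have -> : [set w | (1 + 2 * eps) * (#|Q|%:R * Phibar z) <= (exceedances b (z - del) w)%:R] =
  [set w | (1 + 2 * eps) * (#|Q|%:R * Phibar z) <= \sum_(x in Q) \1_(A x) w].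
  by apply: eq_set => w; rewrite /exceedances (card_indic R Q (fun x w => z - del <= W b (pc x.1 x.2) w)).
apply: (@dependent_chebyshev _ _ _ (prob E) _ Q A dep) => //.
- move=> x y xQ yQ nd; apply: W_indep => g.
  move: nd; rewrite /dep !negb_or => /and4P[d1 d2 d3 d4].
  rewrite /pc; have [->|g1] := eqVneq g x.1.
    by right; rewrite eq_sym (negbTE d1) eq_sym (negbTE d3) !mul0r subrr.
  have [->|g2] := eqVneq g x.2.
    by right; rewrite eq_sym (negbTE d2) eq_sym (negbTE d4) !mul0r subrr.
  by left; rewrite !mul0r subrr.
- by rewrite mulr_gt0.
- apply: (@le_trans _ _ (\sum_(x in Q) (1 + eps) * Phibar z)).
    by apply: ler_sum => x xQ; rewrite -lee_fin fineK ?tail// fin_num_measure.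
  by rewrite sumr_const -[_ *+ #|Q|]mulr_natl mulrCA.
- rewrite /D mulr_natl -sumr_const; apply: ler_sum => x xQ.
  rewrite (bigID (pred1 x))/= addrC; rewrite [leRHS]addrC; apply: lerD.
    apply: (@le_trans _ _ (\sum_(y in [set y in Q | dep x y]%SET) J)).
      rewrite [leRHS]big_mkcond [leLHS]big_mkcond/=; apply: ler_sum => y _.
      rewrite (_ : (y \in [set y in Q | dep x y]%SET) = (y \in Q) && dep x y); last first.
        by rewrite [LHS]inE.
      case: (boolP (y \in Q)) => yQ //=; case: (dep x y) => //=.
      case: eqVneq => [_|yx] /=; first exact: expR_ge0.
      rewrite -lee_fin fineK; last by rewrite fin_num_measure//; exact: measurableI.
      apply: (joint_tail p2 b0 mom b_le kap0 kapP) => //; rewrite ?Qne ?(ltW z0)//.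
        by rewrite eq_sym.
      lra.
    rewrite sumr_const -[leLHS]mulr_natl ler_wpM2r ?expR_ge0// -natrM ler_nat.
    exact: card_meeting_pairs.
  rewrite (eq_bigl (pred1 x)); last first.
    move=> y /=; case: eqVneq => [->|]; rewrite ?andbF// xQ /dep eqxx//.
  by rewrite big_pred1_eq setIid -lee_fin fineK ?tail// fin_num_measure.
Qed.

End exceedances.

(** * From exceedances to the false discovery proportion *)

Lemma geometric_bracket (R : realType) (lam u0 u : R) : 1 < lam -> 0 < u0 -> u0 <= u ->
  exists s : nat, u0 * lam ^+ s <= u < u0 * lam ^+ s.+1.
Proof.
move=> lam1 u00 u0u.
have [s0 Ps0] : exists s, u < u0 * lam ^+ s.+1.
  have l0 : 0 < lam - 1 by lra.
  exists (Num.truncn (u / u0 / (lam - 1))).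
  set k := Num.truncn _.
  have hk : u / u0 / (lam - 1) < k.+1%:R by exact: truncnS_gt.
  have bern j : 1 + j%:R * (lam - 1) <= lam ^+ j.
    elim: j => [|j IH]; first by rewrite mul0r addr0.
    rewrite exprS -natr1.
    apply: (@le_trans _ _ (lam * (1 + j%:R * (lam - 1)))); last by rewrite ler_pM2l//; lra.
    have := mulr_ge0 (ler0n R j) (sqr_ge0 (lam - 1)); nra.
  rewrite -ltr_pdivrMl// mulrC; apply: lt_le_trans (bern k.+1).
  by move: hk; rewrite ltr_pdivrMr//; lra.
pose Q s := u < u0 * lam ^+ s.+1.
have exQ : exists s, Q s by exists s0.
case: (ex_minnP exQ) => s Qs smin; exists s; apply/andP; split => //.
case: s Qs smin => [|s] Qs smin; first by rewrite expr0 mulr1.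
rewrite leNgt; apply/negP => h; have := smin s h; by rewrite ltnn.
Qed.

Lemma npairs_double (R : realType) (E : experiment R) :
  (npairs E * 2 = ngroups E * (ngroups E - 1))%N.
Proof.
rewrite /npairs divnK// dvdn2 oddM; case: (ngroups E) => // k.
by rewrite subn1/= andNb.
Qed.

Section pairs_with_signal.
Context (R : realType) (E : experiment R) (cU y : R).
Local Notation m := (ngroups E).
Local Notation n i := ((nobs i)%:R : R).
Hypotheses (cU1 : 1 <= cU) (y0 : 0 <= y).
Hypothesis ratio : variance_ratio_le E (cU ^+ 2).

Lemma se_ratio (i j k : 'I_m) : k != j -> se i k <= cU * se i j.
Proof.
move=> kj; have c0 : 0 <= cU by exact: le_trans ler01 cU1.
rewrite -(@ler_pXn2r _ 2) ?nnegrE ?mulr_ge0// ?(ltW (se_gt0 _ _))//.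
rewrite exprMn !se2 mulrDr; apply: lerD; last exact: ratio.
rewrite ler_peMl ?divr_ge0 ?sqr_ge0//.
by rewrite exprn_ege1.
Qed.

(* By the triangle inequality every third group is separated from one endpoint of a
   well separated pair, which yields m - 1 separated pairs. *)
Lemma card_signal_pairs (i j : 'I_m) : i != j ->
  2 * cU * y * se i j <= `|mean i - mean j| ->
  (m - 1 <= #|[set x in pairs E | (y * se x.1 x.2 <= `|mean x.1 - mean x.2|)%R]%SET|)%N.
Proof.
move=> ij sij.
pose sp (a b : 'I_m) := if (a < b)%N then (a, b) else (b, a).
(* Every k other than j gets a pair with endpoint k, the index i getting the pair of i and j itself.
   [g] inverts this by reading off the endpoint outside that pair, with default i. *)
pose f k := if k == i then sp i j else
  if y * se i k <= `|mean i - mean k| then sp i k else sp j k.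
pose g (x : 'I_m * 'I_m) := if x.1 \in [:: i; j] then
  (if x.2 \in [:: i; j] then i else x.2) else x.1.
have fK : {in [set~ j]%SET, cancel f g}.
  move=> k; rewrite !inE => kj; rewrite /f /g /sp.
  have [->|ki] := eqVneq k i; first by case: (i < j)%N; rewrite /= !inE !eqxx/= ?orbT.
  by case: (y * se i k <= _); [case: (i < k)%N|case: (j < k)%N]; rewrite /= !inE ?eqxx/= ?orbT ?(negbTE ki) ?(negbTE kj)//.
have -> : (m - 1 = #|[set~ j]%SET|)%N by rewrite cardsC1 card_ord subn1.
rewrite -(card_in_imset (can_in_inj fK)); apply: subset_leq_card.
have s0 := se_gt0 i j.
have spP a b : a != b -> y * se a b <= `|mean a - mean b| ->
    sp a b \in [set x in pairs E | (y * se x.1 x.2 <= `|mean x.1 - mean x.2|)%R]%SET.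
  move=> ab h; rewrite /sp; have := ab; rewrite -(inj_eq val_inj) neq_ltn.
  case: ifP => [lt _|lt /= gt]; rewrite !inE/= ?lt ?gt//=.
  by rewrite seC distrC.
apply/fintype.subsetP => _ /imsetP[k kj ->]; have {}kj : k != j by move: kj; rewrite !inE.
rewrite /f; have [e|ki] := eqVneq k i.
  apply: spP => //; apply: le_trans sij.
  rewrite ler_pM2r// ler_peMl// (le_trans cU1)// ler_peMl ?(le_trans ler01 cU1)//.
  by rewrite ler1n.
case: ifPn => [h|]; first by apply: spP => //; rewrite eq_sym.
rewrite -ltNge => h; apply: spP; first by rewrite eq_sym.
have h1 := ler_wpM2l y0 (se_ratio i kj).
have h2 : y * se j k <= y * (cU * se i j).
  by rewrite ler_wpM2l// (seC i j) se_ratio.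
have h3 : `|mean i - mean j| <= `|mean i - mean k| + `|mean j - mean k|.
  rewrite (distrC (mean j)); exact: ler_distD.
move: sij h h1 h2 h3; rewrite (_ : 2 * cU * y * se i j = 2 * (y * (cU * se i j))); last by ring.
lra.
Qed.

End pairs_with_signal.

Section at_good_point.
Context (R : realType) (E : experiment R).
Local Notation m := (ngroups E).
Local Notation q := (npairs E).
Context (F : 'I_m -> 'I_m -> cumulativeBounded (0 : R) (1 : R)) (alpha : R).
Hypothesis alpha01 : 0 < alpha < 1.
Hypothesis F_sym : symmetric_refs F.
Variables (p K b beta x : R).
Hypotheses (p2 : 2 <= p) (b1 : 1 <= b).
Hypothesis moment : moment_bound E p K.
Hypotheses (beta1 : beta <= 1) (x0 : 0 <= x).
Hypothesis b_le : small_steps E b beta.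
Hypothesis mean_le : forall i : 'I_m, Num.sqrt (nobs i)%:R * (K * b `^ (1 - p)) <= beta.
Hypothesis var_le : K * b `^ (2 - p) <= beta.
Hypothesis eta_lt1 : 4 * (1 + x) ^+ 2 * beta < 1.
Hypothesis m2 : (2 <= m)%N.
Variable w : space E.
Hypothesis gw : good b x w.
Local Notation eta := (4 * (1 + x) ^+ 2 * beta).

Let alpha0 : 0 < alpha. Proof. by case/andP: alpha01. Qed.

Let m0 : 0 < m%:R :> R. Proof. by rewrite ltr0n (leq_trans _ m2). Qed.

Let qE : q%:R = m%:R * (m%:R - 1) / 2 :> R.
Proof.
have := npairs_double E; move=> /(congr1 (fun k => k%:R : R)).
by rewrite !natrM natrB ?(ltnW m2)// => <-; field.
Qed.

Let leq_npairs : (m - 1 <= q)%N.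
Proof.
rewrite -(@leq_pmul2r 2)// npairs_double mulnC leq_mul2r m2 orbT//.
Qed.

Let q0 : 0 < q%:R :> R.
Proof. by rewrite qE; have : 2 <= m%:R :> R by [rewrite ler_nat]; nra. Qed.

(** At k = m - 1 the Benjamini-Hochberg level is exactly 2 alpha / m, twice the assumed bound on the
    reference tail at [tau], so the m - 1 separated pairs alone lift the index to m - 1. *)
Lemma bh_index_signal (cU y tau : R) (i j : 'I_m) : 1 <= cU -> 0 <= y -> 0 <= tau ->
  variance_ratio_le E (cU ^+ 2) ->
  i != j -> 2 * cU * y * se i j <= `|mean i - mean j| ->
  (1 + eta) * tau <= y - 3 / 2 * (x + beta) ->
  (forall i j : 'I_m, (i < j)%N -> 1 - F i j tau <= alpha / m%:R) ->
  (m - 1 <= bh_index F alpha w)%N.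
Proof.
move=> cU1 y0 tau0 ratio ij sij taule Ftau.
apply: bh_index_ge; first by rewrite subn_gt0 m2 leq_npairs.
apply: (leq_trans (card_signal_pairs cU1 y0 ratio ij sij)).
apply: subset_leq_card; apply/fintype.subsetP => z; rewrite !inE => /andP[zp zs].
rewrite zp/= pvalE//.
have lev : (m - 1)%:R * alpha / q%:R = 2 * (alpha / m%:R).
  rewrite qE natrB ?(ltnW m2)//.
  by field; rewrite gt_eqF//= subr_eq0 gt_eqF// ltr1n.
rewrite lev ler_pM2l//; apply: le_trans (Ftau _ _ zp).
rewrite lerD2l lerN2; apply: F_homo.
have e1 : 0 < 1 + eta.
  have : 0 <= eta.
    apply: mulr_ge0; first by apply: mulr_ge0 => //; exact: sqr_ge0.
    exact: small_steps_ge0 i (le_trans ler01 b1) b_le.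
  by move=> h; rewrite (lt_le_trans ltr01)// lerDl.
rewrite -(ler_pM2l e1); apply: (le_trans taule).
exact: (tstat_signal p2 b1 moment beta1 x0 b_le mean_le var_le gw eta_lt1 zs).
Qed.

(** The level u = k alpha / q lies between u0 lam^s and u0 lam^(s+1) with u0 = 2 alpha / m. Errors
    are at most the exceedances at [zl s], about (q + q0) lam^(s+2) alpha / m of them, while
    rejections number at least k >= 2 lam^s q / m. The quotient is lam^2 times the target. *)
Lemma dFDP_le (lam eps Y : R) (zl : nat -> R) : 1 < lam -> 0 < eps ->
  (m - 1 <= bh_index F alpha w)%N ->
  (forall (i j : 'I_m) t, (i < j)%N -> 0 <= t <= Y -> Phibar t <= lam * (1 - F i j t)) ->
  (forall s, lam ^+ s <= m%:R / 2 ->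
     0 < zl s <= Y /\ Phibar (zl s) = lam ^+ s.+2 * alpha / m%:R) ->
  (forall s, lam ^+ s <= m%:R / 2 ->
     (exceedances b (zl s - (zl s * eta + 2 * beta)) w)%:R <
     (1 + 2 * eps) * (#|ordered_pairs E|%:R * Phibar (zl s))) ->
  dFDP F alpha w <= (1 + 2 * eps) * lam ^+ 2 * dFDR_target E alpha.
Proof.
move=> lam1 eps0 kge FP zP excP.
have lam0 : 0 < lam by lra.
set k := bh_index F alpha w in kge.
have k0 : (0 < k)%N by apply: leq_trans kge; rewrite subn_gt0.
have [kq _] := bh_index_spec k0.
pose u0 := 2 * alpha / m%:R; pose u := k%:R * alpha / q%:R.
have u00 : 0 < u0 by rewrite divr_gt0// mulr_gt0.
have u0u : u0 <= u.
  rewrite /u0 /u ler_pdivrMr// mulrAC ler_pdivlMr// qE.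
  have : m%:R - 1 <= k%:R :> R by rewrite lerBlDr natr1 ler_nat -add1n -leq_subLR.
  move=> h; have h' := ler_wpM2r (mulr_ge0 (ltW alpha0) (ltW m0)) h.
  lra.
have [s /andP[us1 us2]] := geometric_bracket lam1 u00 u0u.
have ua : u <= alpha.
  by rewrite /u ler_pdivrMr// mulrC ler_pM2l// ler_nat.
have sm : lam ^+ s <= m%:R / 2.
  have : 2 * alpha / m%:R * lam ^+ s <= alpha by exact: le_trans ua.
  rewrite mulrAC ler_pdivrMr// => h.
  by rewrite ler_pdivlMr// -(ler_pM2l alpha0); lra.
have [/andP[z0 zY] Pz] := zP _ sm.
have exc := excP _ sm.
have err : (#|[set v in pairs E | directional_error F alpha v.1 v.2 w]%SET| <=
    exceedances b (zl s - (zl s * eta + 2 * beta)) w)%N.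
  apply: (@leq_trans #|[set v in ordered_pairs E | (zl s <= tstat v.1 v.2 w)%R]%SET|).
    apply: card_error_le => // v vp rej.
    (* Below [zl s] the normal tail exceeds lam^(s+2) alpha / m, hence the reference tail exceeds
       lam^(s+1) alpha / m and the p-value exceeds u0 lam^(s+1) > u. *)
    rewrite leNgt; apply/negP => lt.
    have vlt : (v.1 < v.2)%N by move: vp; rewrite inE.
    have := rejected_pval rej; rewrite pvalE// -/u => pu.
    have := FP _ _ `|tstat v.1 v.2 w| vlt; rewrite normr_ge0 (le_trans (ltW lt) zY) => /(_ isT).
    have := Phibar_decr lt; rewrite Pz => h1 h2.
    have h3 := lt_le_trans h1 h2.
    have h4 : 2 * (1 - F v.1 v.2 `|tstat v.1 v.2 w|) < u0 * lam ^+ s.+1.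
      exact: le_lt_trans us2.
    move: h3; rewrite exprS -!mulrA ltr_pM2l// => h3.
    move: h4; rewrite /u0 => h4; lra.
  apply: subset_leq_card; apply/fintype.subsetP => v; rewrite !inE => /andP[/andP[v12 mv] zt].
  rewrite v12 mv/=.
  exact: (tstat_ge_W p2 b1 moment beta1 x0 b_le mean_le var_le gw eta_lt1 (ltW z0) zt mv).
have rejge := card_rejected_ge F alpha w; rewrite -/k in rejge.
rewrite /dFDP ler_pdivrMr; last by rewrite ltr0n (leq_trans k0).
apply: (@le_trans _ _ ((1 + 2 * eps) * (#|ordered_pairs E|%:R * Phibar (zl s)))).
  by apply: le_trans (ltW exc); rewrite ler_nat.
have T0 : 0 <= dFDR_target E alpha.
  by rewrite mulr_ge0 ?divr_ge0 ?(ltW alpha0)// addr_ge0// divr_ge0.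
have e1 : 0 <= 1 + 2 * eps by lra.
apply: (@le_trans _ _ ((1 + 2 * eps) * lam ^+ 2 * dFDR_target E alpha * k%:R)); last first.
  by rewrite ler_wpM2l ?ler_nat// mulr_ge0// mulr_ge0// sqr_ge0.
rewrite -[leRHS]mulrA -[leRHS]mulrA ler_wpM2l//.
rewrite Pz card_ordered_pairs natrD.
have hk : 2 * lam ^+ s * q%:R / m%:R <= k%:R.
  move: us1; rewrite /u ler_pdivlMr// => h.
  rewrite -(ler_pM2l alpha0) [leRHS]mulrC; apply: le_trans h.
  by apply: eqW; rewrite /u0; ring.
apply: (@le_trans _ _ (lam ^+ 2 * (dFDR_target E alpha * (2 * lam ^+ s * q%:R / m%:R)))); last first.
  by rewrite ler_wpM2l ?sqr_ge0// ler_wpM2l.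
apply: eqW; rewrite /dFDR_target !exprS expr0.
by field; rewrite !gt_eqF.
Qed.

End at_good_point.

(** * Asymptotics *)

Section growth.
Context {R : realType}.
Implicit Types (e eps u v : R).

Lemma powR_small e eps : 0 < e -> 0 < eps ->
  exists M : nat, forall u, M%:R <= u -> u `^ (- e) <= eps.
Proof.
move=> e0 eps0; exists (Num.truncn (eps `^ (- e^-1))).+1 => u Mu.
have h : eps `^ (- e^-1) <= u by apply: le_trans Mu; exact/ltW/truncnS_gt.
have v0 : 0 < eps `^ (- e^-1) by exact: powR_gt0.
have u0 : 0 < u by exact: lt_le_trans h.
rewrite powRN -[leRHS]invrK lef_pV2 ?posrE ?invr_gt0 ?powR_gt0//.
have -> : eps^-1 = (eps `^ (- e^-1)) `^ e.
  by rewrite -powRrM mulNr mulVf ?gt_eqF// powR_inv1 ?ltW.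
by apply: ge0_ler_powR => //; rewrite ?nnegrE ltW.
Qed.

(** At u = m this bounds 1 + z for all levels z up to 2 sqrt (ln m), so error terms are collected as
    powers of it. *)
Definition logf u : R := 1 + 2 * Num.sqrt (ln u).

Lemma logf_ge1 u : 1 <= logf u.
Proof. by rewrite lerDl mulr_ge0// sqrtr_ge0. Qed.

Lemma logf_le e : 0 < e -> exists2 c : R, 0 < c & forall u, 1 <= u -> logf u <= c * u `^ e.
Proof.
move=> e0; exists (2 + e^-1); first by rewrite addr_gt0// invr_gt0.
move=> u u1.
have u0 : 0 < u by exact: lt_le_trans u1.
have L0 : 0 <= ln u by exact: ln_ge0.
have h1 : ln u <= e^-1 * u `^ e.
  rewrite -(ler_pM2l e0) mulrA divff ?gt_eqF// mul1r -ln_powR.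
  by apply/ltW/ln_sublinear; exact: powR_gt0.
have h2 : 1 <= u `^ e by rewrite -(powRr0 u) ler_powR// ltW.
have h3 : logf u <= 2 + ln u.
  rewrite /logf; set q := Num.sqrt _.
  have : q ^+ 2 = ln u by exact: sqr_sqrtr.
  have := sqr_ge0 (q - 1); nra.
rewrite mulrDl; lra.
Qed.

Lemma logf_powR_small2 (k : nat) (r C a eps : R) : 0 < r -> 0 < C -> 0 < a -> 0 < eps ->
  exists M : nat, forall u v, 1 <= u -> u <= C * v `^ r -> M%:R <= v -> 1 <= v ->
    logf u ^+ k * v `^ (- a) <= eps.
Proof.
move=> r0 C0 a0 eps0.
(* Chosen so that r f k <= a / 2: half of the decay v^(- a) beats the logarithms and the other half
   remains small. *)
pose f := a / 2 / k.+1%:R / r.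
have f0 : 0 < f by rewrite !divr_gt0.
have [c c0 H] := logf_le f0.
pose c' := (c * C `^ f) ^+ k.
have c'0 : 0 < c' by rewrite exprn_gt0// mulr_gt0// powR_gt0.
have a2 : 0 < a / 2 by rewrite divr_gt0.
have [M HM] := powR_small a2 (divr_gt0 eps0 c'0).
exists M => u v u1 uv Mv v1; have u0 : 0 < u by exact: lt_le_trans u1.
have v0 : 0 < v by exact: lt_le_trans v1.
have l0 : 0 <= logf u by exact: le_trans (logf_ge1 u).
apply: (@le_trans _ _ (c' * v `^ (- (a / 2)))); last first.
  by rewrite mulrC -ler_pdivlMr// HM.
apply: (@le_trans _ _ ((c * C `^ f * v `^ (r * f)) ^+ k * v `^ (- a))).
  rewrite ler_wpM2r ?powR_ge0// lerXn2r ?nnegrE ?mulr_ge0 ?powR_ge0 ?(ltW c0)//.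
  apply: (le_trans (H u u1)); rewrite -mulrA ler_pM2l// powRrM -powRM ?powR_ge0 ?(ltW C0)//.
  by apply: ge0_ler_powR; rewrite ?nnegrE ?(ltW f0) ?(ltW u0)// mulr_ge0 ?powR_ge0 ?ltW.
rewrite exprMn -/c' -mulrA ler_pM2l// -powR_mulrn ?powR_ge0// -powRrM -powRD; last first.
  by rewrite (gt_eqF v0)/= implybT.
rewrite ler_powR//.
have : r * f * k%:R <= a / 2.
  have -> : r * f * k%:R = a / 2 * (k%:R / k.+1%:R).
    by rewrite /f; field; rewrite !gt_eqF.
  by rewrite ler_piMr ?(ltW a2)// ler_pdivrMr// mul1r ler_nat.
lra.
Qed.

Lemma logf_powR_small (k : nat) e eps : 0 < e -> 0 < eps ->
  exists M : nat, forall u, M%:R <= u -> 1 <= u -> logf u ^+ k * u `^ (- e) <= eps.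
Proof.
move=> e0 eps0; have [M H] := logf_powR_small2 k ltr01 ltr01 e0 eps0.
exists M => u Mu u1; apply: H => //.
by rewrite mul1r powRr1 ?(le_trans ler01 u1).
Qed.

Lemma Phibar_ivt (Y v : R) : 0 <= Y -> Phibar Y <= v -> v <= 1 / 2 ->
  exists2 z, 0 <= z <= Y & Phibar z = v.
Proof.
move=> Y0 Yv v12.
have := @IVT _ (@Phibar R) 0 Y v Y0.
have -> : Num.min (Phibar 0) (Phibar Y) = Phibar Y :> R.
  by apply/min_idPr; exact: Phibar_nincr.
have -> : Num.max (Phibar 0) (Phibar Y) = Phibar 0 :> R.
  by apply/max_idPl; exact: Phibar_nincr.
case; first by apply: continuous_subspaceT; exact: continuous_Phibar.
  by rewrite Phibar0 Yv.
by move=> z; rewrite in_itv/= => zY <-; exists z.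
Qed.

Lemma Phibar_pos_level (v : R) : 0 < v -> v < 1 / 2 -> exists2 z, 0 < z & Phibar z = v.
Proof.
move=> v0 v12.
pose Y := 2 + 2 * `|ln v|.
have Y2 : 2 <= Y by rewrite lerDl mulr_ge0.
have Yv : Phibar Y <= v.
  apply: (@le_trans _ _ (expR (1 / 2) * expR (- (Y ^+ 2 / 2)))).
    by apply: Phibar_le_expR; lra.
  rewrite -expRD -[leRHS](lnK v0) ler_expR.
  have : - `|ln v| <= ln v by rewrite lerNl -normrN ler_norm.
  have := normr_ge0 (ln v); rewrite /Y; nra.
have Y0 : 0 <= Y by lra.
have [z /andP[z0 _] zv] := Phibar_ivt Y0 Yv (ltW v12).
exists z => //; rewrite lt_neqAle z0 andbT; apply/eqP => z00.
by move: zv v12; rewrite -z00 Phibar0 => <-; rewrite ltxx.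
Qed.

(* Overlapping pairs contribute exp(- z^2 / (1 + kap)) / Phibar(z)^2, which is at most
   u^(2 kap / (1 + kap)) up to constants and logarithms. *)
Lemma level_failure (alpha kap d : R) : 0 < alpha -> 0 <= kap -> kap < 1 -> 0 < d -> d <= 1 ->
  exists2 c : R, 0 < c & forall (u Q z : R), 1 <= u -> u ^+ 2 / 4 <= Q ->
    0 <= z -> z <= 2 * Num.sqrt (ln u) -> alpha / u <= Phibar z ->
    ((1 + d) * Phibar z + 4 * u * expR (5 - z ^+ 2 / (1 + kap))) / (d ^+ 2 * Q * Phibar z ^+ 2)
    <= c * logf u ^+ 2 * u `^ (- ((1 - kap) / (1 + kap))).
Proof.
move=> al0 kap0 kap1 d0 d1.
(* The power of u coming from the overlapping pairs; g - 1 = - (1 - kap) / (1 + kap) is negative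
   exactly because kap < 1. *)
pose g := 2 * kap / (1 + kap).
have [c0 c0E c00] : exists2 c0 : R, c0 = @normal_peak R 1 * expR (- (3 / 2)) & 0 < c0.
  by eexists; first reflexivity; rewrite mulr_gt0 ?expR_gt0// normal_peak_gt0.
pose c1 := 8 / (d ^+ 2 * alpha).
pose c2 := 16 * expR 5 / (d ^+ 2 * c0 ^+ 2) * (expR (1 / 2) / alpha) `^ g.
have d20 : 0 < d ^+ 2 by exact: exprn_gt0.
have c10 : 0 < c1 by rewrite divr_gt0// mulr_gt0.
have c20 : 0 < c2.
  apply: mulr_gt0; last by rewrite powR_gt0// divr_gt0 ?expR_gt0.
  by apply: divr_gt0; apply: mulr_gt0; rewrite ?expR_gt0 ?exprn_gt0.
exists (c1 + c2); first by rewrite addr_gt0.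
move=> u Q z u1 uQ z0 zu au.
have u0 : 0 < u by exact: lt_le_trans u1.
have P0 := Phibar_gt0 z; set P := Phibar z in au P0 *.
have Q0 : 0 < Q by apply: lt_le_trans uQ; rewrite divr_gt0// exprn_gt0.
set th := (1 - kap) / (1 + kap).
have k10 : 0 < 1 + kap by lra.
have gth : g - 1 = - th by rewrite /g /th; field; rewrite gt_eqF.
have th1 : th <= 1 by rewrite /th ler_pdivrMr//; lra.
have g0 : 0 <= g by rewrite divr_ge0 ?mulr_ge0//; lra.
have lf := logf_ge1 u.
have l2 : 1 <= logf u ^+ 2 by rewrite exprn_ege1.
have ut : 0 < u `^ (- th) by exact: powR_gt0.
have iQ : Q^-1 <= 4 / u ^+ 2.
  rewrite -[leRHS]invrK lef_pV2 ?posrE ?invr_gt0 ?divr_gt0 ?exprn_gt0//.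
  by rewrite invf_div.
have -> : ((1 + d) * P + 4 * u * expR (5 - z ^+ 2 / (1 + kap))) / (d ^+ 2 * Q * P ^+ 2) =
  (1 + d) / d ^+ 2 * Q^-1 / P + 4 * u / d ^+ 2 * Q^-1 * (expR (5 - z ^+ 2 / (1 + kap)) / P ^+ 2).
  by field; rewrite !gt_eqF.
have iP : P^-1 <= u / alpha by rewrite -[leRHS]invrK lef_pV2 ?posrE ?invr_gt0 ?divr_gt0// invf_div.
rewrite -[leRHS]mulrA [leRHS]mulrDl; apply: lerD.
  apply: (@le_trans _ _ (2 / d ^+ 2 * (4 / u ^+ 2) * (u / alpha))).
    apply: ler_pM; rewrite ?invr_ge0 ?(ltW P0)//.
      by rewrite mulr_ge0 ?divr_ge0 ?invr_ge0 ?(ltW Q0) ?(ltW d20)//; lra.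
    apply: ler_pM; rewrite ?divr_ge0 ?invr_ge0 ?(ltW Q0) ?(ltW d20)//; first lra.
    by rewrite ler_pM2r ?invr_gt0//; lra.
  rewrite (_ : _ / d ^+ 2 * _ * _ = c1 * u^-1); last first.
    by rewrite /c1; field; rewrite !gt_eqF.
  rewrite ler_pM2l// -[leLHS]mul1r; apply: ler_pM => //; first by rewrite invr_ge0 ltW.
  by rewrite -powR_inv1 ?(ltW u0)// ler_powR// lerN2.
have zl : 1 + z <= logf u by rewrite lerD2l.
have iP2 : (P ^+ 2)^-1 <= (logf u) ^+ 2 / c0 ^+ 2 * expR (z ^+ 2).
  have h := phi_le_Phibar z0; rewrite -c0E -/P in h.
  have h' : c0 * expR (- (z ^+ 2 / 2)) <= logf u * P.
    by apply: (le_trans h); rewrite ler_wpM2r ?(ltW P0).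
  have hs : (c0 * expR (- (z ^+ 2 / 2))) ^+ 2 <= (logf u * P) ^+ 2.
    rewrite lerXn2r ?nnegrE//; first exact: mulr_ge0 (ltW c00) (expR_ge0 _).
    exact: mulr_ge0 (le_trans ler01 lf) (ltW P0).
  move: hs; rewrite !exprMn.
  have -> : expR (- (z ^+ 2 / 2)) ^+ 2 = (expR (z ^+ 2))^-1.
    by rewrite -expRN expr2 -expRD; congr expR; field.
  rewrite ler_pdivrMr ?expR_gt0// => hs.
  rewrite -[leLHS]mul1r ler_pdivrMr ?exprn_gt0//.
  rewrite (_ : _ * P ^+ 2 = logf u ^+ 2 * P ^+ 2 * expR (z ^+ 2) / c0 ^+ 2); last by ring.
  by rewrite ler_pdivlMr ?exprn_gt0// mul1r.
(* The exponent is (z^2 / 2) g, and [alpha / u <= Phibar z] forces exp(z^2 / 2) to be O(u). *)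
have ez : expR (z ^+ 2 - z ^+ 2 / (1 + kap)) <= (expR (1 / 2) / alpha) `^ g * u `^ g.
  have h : expR (z ^+ 2 / 2) <= expR (1 / 2) / alpha * u.
    have := Phibar_le_expR z0; rewrite -/P => hP.
    have {hP} : alpha / u <= expR (1 / 2) * expR (- (z ^+ 2 / 2)) by exact: le_trans hP.
    rewrite expRN ler_pdivlMr ?expR_gt0// mulrAC ler_pdivrMr// => hP.
    by rewrite [leRHS]mulrAC ler_pdivlMr// mulrC.
  rewrite -powRM ?divr_ge0 ?expR_ge0 ?(ltW al0) ?(ltW u0)//.
  have -> : z ^+ 2 - z ^+ 2 / (1 + kap) = z ^+ 2 / 2 * g by rewrite /g; field; rewrite gt_eqF.
  rewrite expRM; apply: ge0_ler_powR => //; rewrite ?nnegrE ?expR_ge0//.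
  by rewrite mulr_ge0 ?divr_ge0 ?expR_ge0 ?(ltW al0) ?(ltW u0).
apply: (@le_trans _ _ (4 * u / d ^+ 2 * (4 / u ^+ 2) *
    (expR 5 * (logf u ^+ 2 / c0 ^+ 2) * ((expR (1 / 2) / alpha) `^ g * u `^ g)))).
  have a0 : 0 <= 4 * u / d ^+ 2 by apply: divr_ge0; [apply: mulr_ge0 => //|]; exact: ltW.
  apply: ler_pM.
  - by rewrite mulr_ge0// invr_ge0 ltW.
  - by rewrite divr_ge0 ?expR_ge0// sqr_ge0.
  - by rewrite ler_wpM2l.
  apply: (@le_trans _ _ (expR (5 - z ^+ 2 / (1 + kap)) * (logf u ^+ 2 / c0 ^+ 2 * expR (z ^+ 2)))).
    by rewrite ler_wpM2l ?expR_ge0.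
  have -> : expR (5 - z ^+ 2 / (1 + kap)) * (logf u ^+ 2 / c0 ^+ 2 * expR (z ^+ 2)) =
    expR 5 * (logf u ^+ 2 / c0 ^+ 2) * expR (z ^+ 2 - z ^+ 2 / (1 + kap)).
    by rewrite !expRD; ring.
  by rewrite ler_wpM2l// mulr_ge0 ?expR_ge0// divr_ge0 ?sqr_ge0.
apply: eqW.
have -> : u `^ g = u * u `^ (- th).
  by rewrite -gth -{2}(powRr1 (ltW u0)) -powRD ?subrKC// (gt_eqF u0)/= implybT.
by rewrite /c2; field; rewrite !gt_eqF.
Qed.

End growth.

(* The truncation level N^(1/2 - a) with a = r / (2 (2 + 4 r + nu)) is low enough for the
   truncated means to be sums of o(1) summands, and high enough for no observation at all
   to be truncated, with probability tending to 1. *)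
Lemma truncation_level (R : realType) (cU r C nu K kk : R) :
  1 <= cU -> 0 < r -> 0 < C -> 0 < nu -> 0 < K -> 0 < kk ->
  exists M : nat, forall (E : experiment R) (v : R),
  (forall i : 'I_(ngroups E), v <= cU * (nobs i)%:R) ->
  (forall i : 'I_(ngroups E), (nobs i)%:R <= v) ->
  1 <= (ngroups E)%:R :> R -> (ngroups E)%:R <= C * v `^ r -> M%:R <= v -> 1 <= v ->
  exists b beta : R, [/\ 1 <= b, 0 <= beta, beta * logf (ngroups E)%:R ^+ 8 <= kk &
  [/\ small_steps E b beta,
    forall i : 'I_(ngroups E), Num.sqrt (nobs i)%:R * (K * b `^ (1 - (2 + 4 * r + nu))) <= beta,
    K * b `^ (2 - (2 + 4 * r + nu)) <= beta &
    (\sum_(i : 'I_(ngroups E)) (nobs i)%:R) * (K * b `^ (- (2 + 4 * r + nu))) <= kk]].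
Proof.
move=> cU1 r0 C0 nu0 K0 kk0.
pose p := 2 + 4 * r + nu; rewrite -/p.
have p0 : 0 < p by rewrite /p; lra.
pose a := r / (2 * p).
have a0 : 0 < a by rewrite divr_gt0// mulr_gt0.
have ap : a * p = r / 2 by rewrite /a; field; rewrite gt_eqF.
have a12 : a <= 1 / 2.
  by rewrite /a ler_pdivrMr ?mulr_gt0//; rewrite /p; lra.
(* The part 2 cU is for [small_steps], the part K for the bounds on truncated means and
   variances. *)
pose C1 := 2 * cU + K.
have C10 : 0 < C1 by rewrite /C1; lra.
have [M1 H1] := logf_powR_small2 8 r0 C0 a0 (divr_gt0 kk0 C10).
have r2 : 0 < r / 2 by lra.
have [M2 H2] := powR_small r2 (divr_gt0 kk0 (mulr_gt0 C0 K0)).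
exists (maxn M1 M2) => E v vn nv m1 mC Mv v1.
have [M1v M2v] : M1%:R <= v /\ M2%:R <= v.
  by split; apply: le_trans Mv; rewrite ler_nat ?leq_maxl ?leq_maxr.
have v0 : 0 < v by exact: lt_le_trans v1.
have vn0 : (v == 0) = false by rewrite gt_eqF.
pose b := v `^ (1 / 2 - a); pose beta := C1 * v `^ (- a).
exists b, beta.
have sv : Num.sqrt v = v `^ (1 / 2) by rewrite mul1r powR12_sqrt// ltW.
have C1a : K * v `^ (- a) <= beta.
  by rewrite ler_wpM2r ?powR_ge0// /C1; lra.
split.
- by rewrite -(powRr0 v) ler_powR//; lra.
- by rewrite mulr_ge0 ?powR_ge0// ltW.
- by rewrite /beta -mulrA mulrC -ler_pdivlMr// [leLHS]mulrC H1.
split.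
- move=> i.
  have -> : b = Num.sqrt v * v `^ (- a) by rewrite sv -powRD ?vn0 ?implybT.
  have h : Num.sqrt v <= cU * Num.sqrt (nobs i)%:R.
    rewrite -[X in X * _](ger0_norm (le_trans ler01 cU1)) -sqrtr_sqr -sqrtrM ?sqr_ge0//.
    apply: ler_wsqrtr; apply: (le_trans (vn i)); rewrite ler_wpM2r//.
    by rewrite expr2 ler_peMl// (le_trans ler01).
  rewrite /beta mulrA [leRHS]mulrAC ler_wpM2r ?powR_ge0//.
  apply: (@le_trans _ _ (2 * cU * Num.sqrt (nobs i)%:R)); first by rewrite -mulrA ler_pM2l.
  by rewrite ler_wpM2r ?sqrtr_ge0// /C1; lra.
- move=> i; apply: le_trans C1a.
  rewrite mulrCA ler_pM2l// /b -powRrM.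
  apply: (@le_trans _ _ (Num.sqrt v * v `^ ((1 / 2 - a) * (1 - p)))).
    by rewrite ler_wpM2r ?powR_ge0// ler_wsqrtr.
  rewrite sv -powRD ?vn0 ?implybT// ler_powR//.
  have -> : 1 / 2 + (1 / 2 - a) * (1 - p) = 1 - p / 2 - a + a * p by field.
  rewrite ap /p; lra.
- apply: le_trans C1a; rewrite ler_pM2l// /b -powRrM ler_powR//.
  have -> : (1 / 2 - a) * (2 - p) = 1 - p / 2 - 2 * a + a * p by field.
  rewrite ap /p; lra.
- apply: (@le_trans _ _ (C * v `^ r * v * (K * b `^ (- p)))).
    rewrite ler_wpM2r ?mulr_ge0 ?powR_ge0 ?(ltW K0)//.
    apply: (@le_trans _ _ ((ngroups E)%:R * v)); last by rewrite ler_wpM2r// ltW.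
    rewrite mulr_natl -[X in _ *+ X](card_ord (ngroups E)) -sumr_const.
    by apply: ler_sum => i _.
  have -> : C * v `^ r * v * (K * b `^ (- p)) = C * K * v `^ (r + 1 + (1 / 2 - a) * (- p)).
    rewrite !powRD ?vn0 ?implybT// powRr1 ?(ltW v0)// /b -powRrM; ring.
  rewrite -ler_pdivlMl ?mulr_gt0// [leRHS]mulrC; apply: le_trans (H2 v M2v).
  rewrite ler_powR//.
  have -> : r + 1 + (1 / 2 - a) * (- p) = r + 1 - p / 2 + a * p by field.
  rewrite ap /p; lra.
Qed.

(** * Tail bound for the false discovery proportion *)

Section tail.
Context (R : realType) (E : experiment R).
Local Notation m := (ngroups E).
Context (F : 'I_m -> 'I_m -> cumulativeBounded (0 : R) (1 : R)) (alpha : R).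
Hypothesis alpha01 : 0 < alpha < 1.
Hypothesis F_sym : symmetric_refs F.

Lemma measurable_exceedances b y (c : R) :
  measurable [set w : space E | c <= (exceedances b y w)%:R].
Proof.
apply: measurable_ge_set; apply: measurable_card_set => x _.
by apply: measurable_ge_set; exact: measurable_W.
Qed.

Lemma measurable_dFDP_gt (c : R) : measurable [set w | c < dFDP F alpha w].
Proof.
apply: measurable_gt_set; apply: measurable_dFDP => //.
by case/andP: alpha01.
Qed.

(** Outside the complement of [G], a large proportion forces some grid level to fail. Indices beyond
    the range of the grid contribute the empty set, so the union is over [S.+1] events. *)
Lemma levels_tail (lam d b theta c0 : R) (S : nat) (zl del : nat -> R) (V : R) (G : set (space E)) :
  measurable G ->
  (forall w, G w -> (forall s, lam ^+ s <= m%:R / 2 ->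
     (exceedances b (zl s - del s) w)%:R <
     (1 + 2 * d) * (#|ordered_pairs E|%:R * Phibar (zl s))) -> dFDP F alpha w <= c0) ->
  (forall s, lam ^+ s <= m%:R / 2 -> (s <= S)%N) ->
  (forall s, lam ^+ s <= m%:R / 2 ->
    (prob E [set w | ((1 + 2 * d) * (#|ordered_pairs E|%:R * Phibar (zl s)) <=
                    (exceedances b (zl s - del s) w)%:R)%R] <= V%:E)%E) ->
  (prob E (~` G) <= theta%:E)%E -> 0 <= V ->
  (prob E [set w | (c0 < dFDP F alpha w)%R] <= (theta + S.+1%:R * V)%:E)%E.
Proof.
move=> mG GP SP VP Gth V0.
pose B (s : 'I_S.+1) : set (space E) := if lam ^+ s <= m%:R / 2 then
  [set w | (1 + 2 * d) * (#|ordered_pairs E|%:R * Phibar (zl s)) <=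
           (exceedances b (zl s - del s) w)%:R] else set0.
have mB s : measurable (B s).
  by rewrite /B; case: ifP => _; [exact: measurable_exceedances|exact: measurable0].
have BV s : (prob E (B s) <= V%:E)%E.
  by rewrite /B; case: ifP => [/VP//|_]; rewrite measure0 lee_fin.
have mU : measurable (\bigcup_(s in [set: 'I_S.+1]) B s).
  by apply: fin_bigcup_measurable => //; exact: finite_finset.
apply: (@le_trans _ _ (prob E (~` G `|` \bigcup_(s in [set: 'I_S.+1]) B s))).
  apply: le_measure; rewrite ?inE.
  - exact: measurable_dFDP_gt.
  - by apply: measurableU => //; exact: measurableC.
  move=> w /= cw; have [Gw|nG] := pselect (G w); last by left.
  right; apply: contrapT => nB.
  have : dFDP F alpha w <= c0; last by rewrite leNgt cw.
  apply: (GP w Gw) => s sm; rewrite ltNge; apply/negP => h; apply: nB.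
  have sS : (s < S.+1)%N by rewrite ltnS SP.
  by exists (Ordinal sS) => //; rewrite /B/= sm.
apply: (le_trans (measureU2 _ (measurableC mG) mU)); rewrite EFinD.
apply: leeD => //; apply: (le_trans (union_bound mB BV)).
by rewrite sumr_const card_ord mulr_natl.
Qed.

End tail.

Lemma ref_bounds (R : realType) (E : experiment R)
    (F : 'I_(ngroups E) -> 'I_(ngroups E) -> cumulativeBounded (0 : R) (1 : R))
    (h lam : R) : (ref_deviation F <= h%:E)%E -> 0 < lam -> h <= 1 -> h <= 1 - lam^-1 ->
  forall (i j : 'I_(ngroups E)) (t : R), (i < j)%N ->
  0 <= t <= 2 * Num.sqrt (ln (ngroups E)%:R) ->
  Phibar t <= lam * (1 - F i j t) /\ 1 - F i j t <= 2 * Phibar t.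
Proof.
move=> Fh lam0 h1 hl i j t ij tY.
have P0 := Phibar_gt0 t.
have : (`|(1 - F i j t) / Phibar t - 1|%:E <= h%:E)%E.
  by apply: le_trans Fh; apply: ereal_sup_ubound; exists i, j, t.
rewrite lee_fin ler_norml => /andP[l1 l2].
have l1' : lam^-1 <= (1 - F i j t) / Phibar t by lra.
have l2' : (1 - F i j t) / Phibar t <= 2 by lra.
split; last by move: l2'; rewrite ler_pdivrMr.
by move: l1'; rewrite ler_pdivlMr// mulrC ler_pdivrMr// mulrC.
Qed.

Section ratios.
Context (R : realType) (E : experiment R) (cU : R).
Local Notation n i := ((nobs i)%:R : R).

Lemma variance_ratio :
  (forall i j : 'I_(ngroups E), i != j -> sd i ^+ 2 / sd j ^+ 2 <= cU) ->
  (forall i j : 'I_(ngroups E), i != j -> n i / n j <= cU) ->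
  variance_ratio_le E (cU ^+ 2).
Proof.
move=> sr nr i j ij.
have ji : j != i by rewrite eq_sym.
have sj : 0 < sd j ^+ 2 by rewrite exprn_gt0// sd_gt0.
have si : 0 < sd i ^+ 2 by rewrite exprn_gt0// sd_gt0.
have ni := nobs_gt0 i; have nj := nobs_gt0 j.
have := ler_pM (divr_ge0 (ltW si) (ltW sj)) (divr_ge0 (ltW nj) (ltW ni)) (sr _ _ ij) (nr _ _ ji).
rewrite -expr2 => h.
rewrite -ler_pdivrMr ?divr_gt0//; apply: le_trans h.
by apply: eqW; field; rewrite !gt_eqF ?sd_gt0.
Qed.

Lemma kap_ratio :
  variance_ratio_le E (cU ^+ 2) ->
  forall i j : 'I_(ngroups E), i != j ->
  sd i ^+ 2 / n i <= cU ^+ 2 / (1 + cU ^+ 2) * se i j ^+ 2.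
Proof.
move=> ratio i j ij; have := ratio i j ij; rewrite se2.
have c0 : 0 < 1 + cU ^+ 2 by have := sqr_ge0 cU; lra.
move=> h; rewrite [leRHS]mulrAC ler_pdivlMr//; lra.
Qed.

Lemma max_nobs_ratio : 1 <= cU ->
  (forall i j : 'I_(ngroups E), i != j -> n i / n j <= cU) ->
  forall i : 'I_(ngroups E), (max_nobs E)%:R <= cU * n i.
Proof.
move=> cU1 nr i.
have m0 : (0 < #|'I_(ngroups E)|)%N by rewrite card_ord (leq_ltn_trans _ (ltn_ord i)).
have [j ->] : exists j : 'I_(ngroups E), max_nobs E = nobs j.
  by have [j jE] := bigop.eq_bigmax (@nobs _ E) m0; exists j.
have [->|ji] := eqVneq j i; first by rewrite ler_peMl.
by have := nr _ _ ji; rewrite ler_pdivrMr ?nobs_gt0.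
Qed.

Lemma nobs_le_max (i : 'I_(ngroups E)) : (nobs i)%:R <= (max_nobs E)%:R :> R.
Proof. by rewrite ler_nat; exact: leq_bigmax. Qed.

End ratios.

Section grid.
Context (R : realType).
Implicit Types (lam alpha u z : R).

Lemma grid_size lam u (s : nat) : 1 < lam -> 1 <= u -> lam ^+ s <= u / 2 ->
  (s <= Num.truncn (ln u / ln lam))%N.
Proof.
move=> lam1 u1 h; have l0 : 0 < ln lam by exact: ln_gt0.
have lam0 : 0 < lam by lra.
rewrite truncn_ge_nat ?divr_ge0 ?ln_ge0 ?(ltW lam1)//.
rewrite ler_pdivlMr// mulr_natl -lnXn// ler_ln ?posrE ?exprn_gt0//; lra.
Qed.

(** All tail values lie between alpha / u and lam^2 alpha / 2 <= (1 + alpha) / 4. As the latter is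
    below 1/2, the quantiles are bounded away from 0 uniformly in u, as [exceedances_tail]
    requires. *)
Lemma grid_levels lam alpha u z : 1 < lam -> 0 < alpha -> 1 <= u ->
  lam ^+ 2 * alpha <= (1 + alpha) / 2 -> alpha < 1 -> Phibar z = (1 + alpha) / 4 ->
  Phibar (2 * Num.sqrt (ln u)) <= alpha / u ->
  exists zl : nat -> R, forall s, lam ^+ s <= u / 2 ->
    z <= zl s <= 2 * Num.sqrt (ln u) /\ Phibar (zl s) = lam ^+ s.+2 * alpha / u.
Proof.
move=> lam1 al0 u1 lal al1 zE PY.
have u0 : 0 < u by lra.
have H (s : nat) : exists y, lam ^+ s <= u / 2 ->
    z <= y <= 2 * Num.sqrt (ln u) /\ Phibar y = lam ^+ s.+2 * alpha / u.
  have [sm|sm] := boolP (lam ^+ s <= u / 2); last by exists 0.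
  have v1 : alpha / u <= lam ^+ s.+2 * alpha / u.
    by rewrite ler_pM2r ?invr_gt0// ler_peMl ?(ltW al0)// exprn_ege1// ltW.
  have v2 : lam ^+ s.+2 * alpha / u <= (1 + alpha) / 4.
    rewrite ler_pdivrMr// exprS exprS.
    have := ler_wpM2r (_ : 0 <= lam ^+ 2 * alpha) sm.
    rewrite mulr_ge0 ?sqr_ge0 ?(ltW al0)// => /(_ isT) h1.
    have h2 : u / 2 * (lam ^+ 2 * alpha) <= u / 2 * ((1 + alpha) / 2).
      by rewrite ler_wpM2l//; lra.
    have -> : lam * (lam * lam ^+ s) * alpha = lam ^+ s * (lam ^+ 2 * alpha) by ring.
    apply: (le_trans h1); apply: (le_trans h2); lra.
  have Y0 : 0 <= 2 * Num.sqrt (ln u) by rewrite mulr_ge0// sqrtr_ge0.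
  have v3 : lam ^+ s.+2 * alpha / u <= 1 / 2 by lra.
  have [y /andP[y0 yY] yE] := Phibar_ivt Y0 (le_trans PY v1) v3.
  exists y => _; split => //; rewrite yY andbT leNgt; apply/negP => /Phibar_decr.
  by rewrite yE zE ltNge v2.
have [zl zlP] := choice H.
by exists zl.
Qed.

End grid.

(** On the good event the signal bounds the rejection level from below and [dFDP_le] applies;
    [theta] accounts for the complement of that event, [V] for each grid level. *)
Lemma dFDP_tail (R : realType) (E : experiment R)
    (F : 'I_(ngroups E) -> 'I_(ngroups E) -> cumulativeBounded (0 : R) (1 : R)) (alpha : R)
    (cU p K b beta lam d theta V z : R) (S : nat) (zl : nat -> R) :
  0 < alpha < 1 -> symmetric_refs F ->
  1 <= cU -> 2 <= p -> 1 <= b ->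
  moment_bound E p K ->
  small_steps E b beta ->
  (forall i : 'I_(ngroups E), Num.sqrt (nobs i)%:R * (K * b `^ (1 - p)) <= beta) ->
  K * b `^ (2 - p) <= beta -> 0 <= beta -> beta * logf (ngroups E)%:R ^+ 8 <= 1 / 1000 ->
  (2 <= ngroups E)%N -> 1 <= ln (ngroups E)%:R :> R ->
  variance_ratio_le E (cU ^+ 2) ->
  (1 <= #|separated_pairs E (8 * cU ^+ 2 * Num.sqrt (ln (ngroups E)%:R))%R|)%N ->
  (forall (i j : 'I_(ngroups E)) (t : R), (i < j)%N -> 0 <= t <= 2 * Num.sqrt (ln (ngroups E)%:R) ->
     Phibar t <= lam * (1 - F i j t) /\ 1 - F i j t <= 2 * Phibar t) ->
  2 * Phibar (17 / 10 * Num.sqrt (ln (ngroups E)%:R)) <= alpha / (ngroups E)%:R ->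
  1 < lam -> 0 < d -> 0 < z ->
  (forall s, lam ^+ s <= (ngroups E)%:R / 2 ->
     z <= zl s <= 2 * Num.sqrt (ln (ngroups E)%:R) /\ Phibar (zl s) = lam ^+ s.+2 * alpha / (ngroups E)%:R) ->
  (forall s, lam ^+ s <= (ngroups E)%:R / 2 -> (s <= S)%N) -> 0 <= V ->
  (forall s, lam ^+ s <= (ngroups E)%:R / 2 ->
    (prob E [set w | ((1 + 2 * d) * (#|ordered_pairs E|%:R * Phibar (zl s)) <=
       (exceedances b (zl s -
          (zl s * (4 * (1 + 3 / 2 * Num.sqrt (ln (ngroups E)%:R)) ^+ 2 * beta) + 2 * beta)) w)%:R)%R] <= V%:E)%E) ->
  (\sum_(i : 'I_(ngroups E)) (nobs i)%:R) * (K * b `^ (- p)) +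
    4 * (ngroups E)%:R * expR (- (49 / 100 * (3 / 2 * Num.sqrt (ln (ngroups E)%:R)) ^+ 2)) <= theta ->
  (prob E [set w | ((1 + 2 * d) * lam ^+ 2 * dFDR_target E alpha < dFDP F alpha w)%R] <=
   (theta + S.+1%:R * V)%:E)%E.
Proof.
move=> al01 Fs cU1 p2 b1 mom b_le mean_le var_le be0 bl m2 L1 ratio sep Fb tauP
  lam1 d0 z0 zlP SP V0 VP thP.
(* The factor 3/2 is large enough that 49/100 x^2 > ln m, for the union over 4 m events, and small
   enough that 4 - 3/2 * 3/2 exceeds 17/10. *)
pose x : R := 3 / 2 * Num.sqrt (ln (ngroups E)%:R).
have sq1 : 1 <= Num.sqrt (ln (ngroups E)%:R) :> R by rewrite -[leLHS](@sqrtr1 R) ler_wsqrtr.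
have x0 : 0 <= x by clear -sq1 x; rewrite /x; lra.
have lf1 : 1 <= logf (ngroups E)%:R :> R by exact: logf_ge1.
have xl : 1 + x <= logf (ngroups E)%:R by clear -sq1 x; rewrite /logf /x; lra.
have blk (k : nat) : (k <= 8)%N -> beta * logf (ngroups E)%:R ^+ k <= 1 / 1000.
  by move=> k8; apply: le_trans bl; rewrite ler_wpM2l// ler_weXn2l.
have bek : beta <= 1 / 1000 by have := blk 0%N isT; rewrite expr0 mulr1.
have be1 : beta <= 1 by clear -bek; lra.
have etk : 4 * (1 + x) ^+ 2 * beta <= 4 / 1000.
  apply: (@le_trans _ _ (4 * (beta * logf (ngroups E)%:R ^+ 2))).
    rewrite -mulrA ler_pM2l// mulrC ler_wpM2l// lerXn2r ?nnegrE ?addr_ge0//.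
  by have := blk 2%N isT; clear; lra.
have et1 : 4 * (1 + x) ^+ 2 * beta < 1 by apply: (le_lt_trans etk); clear; lra.
have xbe : x * beta <= 1 / 150.
  have : beta * x <= beta * logf (ngroups E)%:R.
    by rewrite ler_wpM2l//; apply: le_trans xl; rewrite lerDr.
  have := blk 1%N isT; rewrite expr1; clear; lra.
have [G mG [GG Gprob]] := good_probability p2 b1 mom be1 x0 b_le var_le xbe.
have bh w : G w -> (ngroups E - 1 <= bh_index F alpha w)%N.
  move=> /GG gw.
  have [[i j]] := card_gt0P sep.
  rewrite !inE/= => /andP[ij sij].
  have ijn : i != j by rewrite -(inj_eq val_inj) neq_ltn ij.
  (* With y = 4 cU sqrt (ln m), the product 2 cU y is the assumed separation. *)
  have y0 : 0 <= 4 * cU * Num.sqrt (ln (ngroups E)%:R).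
    by apply: mulr_ge0; [apply: mulr_ge0 => //; exact: le_trans cU1|exact: sqrtr_ge0].
  have tau0 : 0 <= 17 / 10 * Num.sqrt (ln (ngroups E)%:R) :> R by clear -sq1; lra.
  refine (bh_index_signal Fs p2 b1 mom be1 x0 b_le mean_le var_le et1 m2 gw cU1 y0 tau0
    ratio ijn _ _ _).
  - move: sij; rewrite /standardized_diff -/(se i j) ler_pdivlMr ?se_gt0//.
    by congr (_ <= _); ring.
  (* In units of sqrt (ln m) >= 1: 4 - 9/4 = 7/4 on the right, at most 17/10 times 1 + 4/1000 on the
     left, and the gap covers 3/2 beta. *)
  - apply: (@le_trans _ _ (4 * Num.sqrt (ln (ngroups E)%:R) - 3 / 2 * (x + beta))); last first.
      rewrite lerD2r -mulrA ler_pM2l// ler_peMl// (le_trans ler01)//.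
    have h := ler_wpM2r tau0 etk.
    clear -h sq1 bek x; rewrite mulrDl /x in h *; lra.
  - move=> i' j' ij'; have [|_ h] := Fb i' j' (17 / 10 * Num.sqrt (ln (ngroups E)%:R)) ij'.
      by apply/andP; split => //; clear -sq1; lra.
    exact: le_trans tauP.
refine (@levels_tail _ _ _ _ al01 Fs lam d b theta _ S zl
  (fun s => zl s * (4 * (1 + x) ^+ 2 * beta) + 2 * beta) V G mG _ SP VP _ V0).
- move=> w Gw exc.
  refine (dFDP_le al01 Fs p2 b1 mom be1 x0 b_le mean_le var_le et1 m2 (GG w Gw) lam1 d0 (bh w Gw)
    (Y := 2 * Num.sqrt (ln (ngroups E)%:R)) (zl := zl) _ _ exc).
  + by move=> i j t ij tY; case: (Fb i j t ij tY).
  + move=> s sm; have [/andP[h1 h2] h3] := zlP s sm; split => //.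
    by rewrite h2 (lt_le_trans z0).
- apply: (le_trans Gprob); rewrite lee_fin; exact: thP.
Qed.

(** The shift between [tstat] and [W], multiplied by 1 + z as [Phibar_shift] demands. Four powers of
    1 + 2 sq arise; they are raised to 8 to match the control on [beta]. *)
Lemma delta_bound (R : realType) (sq beta z : R) : 0 <= sq -> 0 <= beta -> 0 <= z <= 2 * sq ->
  (z * (4 * (1 + 3 / 2 * sq) ^+ 2 * beta) + 2 * beta) * (1 + z) <=
  6 * (beta * (1 + 2 * sq) ^+ 8).
Proof.
move=> sq0 be0 /andP[z0 zs]; set l := 1 + 2 * sq.
have l1 : 1 <= l by rewrite /l; lra.
have l0 : 0 <= l by lra.
have h1 : (1 + 3 / 2 * sq) ^+ 2 <= l ^+ 2 by rewrite lerXn2r ?nnegrE /l; lra.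
have h2 : z * (4 * (1 + 3 / 2 * sq) ^+ 2 * beta) <= l * (4 * l ^+ 2 * beta).
  apply: ler_pM => //.
  - by apply: mulr_ge0 => //; apply: mulr_ge0 => //; exact: sqr_ge0.
  - by rewrite /l; lra.
  - by rewrite ler_wpM2r// ler_pM2l.
have h3 : l * (4 * l ^+ 2 * beta) = 4 * (beta * l ^+ 3) by ring.
have h4 : beta <= beta * l ^+ 3 by rewrite ler_peMr// exprn_ege1.
have h5 : z * (4 * (1 + 3 / 2 * sq) ^+ 2 * beta) + 2 * beta <= 6 * (beta * l ^+ 3) by lra.
have e0 : 0 <= z * (4 * (1 + 3 / 2 * sq) ^+ 2 * beta) + 2 * beta.
  apply: addr_ge0; last by rewrite mulr_ge0.
  by apply: mulr_ge0 => //; apply: mulr_ge0 => //; apply: mulr_ge0 => //; exact: sqr_ge0.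
have zl : 1 + z <= l by rewrite /l; lra.
apply: (le_trans (ler_pM e0 _ h5 zl)); first lra.
have -> : 6 * (beta * l ^+ 3) * l = 6 * (beta * l ^+ 4) by ring.
by rewrite ler_pM2l// ler_wpM2l// ler_weXn2l.
Qed.

Lemma card_ordered_pairs_ge (R : realType) (E : experiment R) : (2 <= ngroups E)%N ->
  (ngroups E)%:R ^+ 2 / 4 <= #|ordered_pairs E|%:R :> R.
Proof.
move=> m2; rewrite card_ordered_pairs natrD.
have := npairs_double E; move=> /(congr1 (fun k => k%:R : R)).
rewrite !natrM natrB ?(ltnW m2)// => h.
have : 2 <= (ngroups E)%:R :> R by rewrite ler_nat.
have := ler0n R #|null_pairs E|; nra.
Qed.

Lemma Phibar_sqrt_ln (R : realType) (k u : R) : 0 <= k -> 1 <= u ->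
  Phibar (k * Num.sqrt (ln u)) <= expR (1 / 2) * (u^-1 * u `^ (- (k ^+ 2 / 2 - 1))).
Proof.
move=> k0 u1; have u0 : 0 < u by lra.
have L0 : 0 <= ln u by exact: ln_ge0.
apply: (le_trans (Phibar_le_expR _)); first by rewrite mulr_ge0// sqrtr_ge0.
have -> : u^-1 = u `^ (-1) by rewrite powR_inv1// ltW.
rewrite ler_pM2l ?expR_gt0// -powRD ?(gt_eqF u0) ?implybT//.
rewrite /powR (gt_eqF u0) ler_expR exprMn sqr_sqrtr//; lra.
Qed.

(** [M] is chosen before the experiment, so the asymptotics reduce to finitely many smallness
    conditions on powers of m and n. *)
Lemma dFDP_uniform (R : realType) (alpha cU r C nu K c A eta : R) :
  0 < alpha < 1 -> 1 <= cU -> 0 < r -> 0 < C -> 0 < nu -> 0 < K -> 0 < c -> 0 < eta ->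
  exists M : nat, forall (E : experiment R)
    (F : 'I_(ngroups E) -> 'I_(ngroups E) -> cumulativeBounded (0 : R) (1 : R)),
  (forall i j : 'I_(ngroups E), i != j -> sd i ^+ 2 / sd j ^+ 2 <= cU) ->
  (forall i j : 'I_(ngroups E), i != j -> (nobs i)%:R / (nobs j)%:R <= cU) ->
  (ngroups E)%:R <= C * (max_nobs E)%:R `^ r ->
  moment_bound E (2 + 4 * r + nu) K ->
  symmetric_refs F ->
  (ref_deviation F <= (A * (max_nobs E)%:R `^ (- c))%:E)%E ->
  (1 <= #|separated_pairs E (8 * cU ^+ 2 * Num.sqrt (ln (ngroups E)%:R))%R|)%N ->
  (M <= ngroups E)%N -> (M <= max_nobs E)%N ->
  (prob E [set w | ((1 + eta) * dFDR_target E alpha < dFDP F alpha w)%R] <= eta%:E)%E.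
Proof.
move=> al01 cU1 r0 C0 nu0 K0 c0 eta0.
have /andP[al0 al1] := al01.
(* With lam = 1 + d, (1 + 2 d) lam^2 <= 1 + 11 d. The bound (1 - alpha) / 6 yields lam^2 alpha <= (1
   + alpha) / 2, keeping all normal tails of the grid below 1/2. *)
have [d [d0 d11 d6]] : exists d : R, [/\ 0 < d, d <= eta / 11 & d <= (1 - alpha) / 6].
  exists (Num.min (eta / 11) ((1 - alpha) / 6)); split.
  - by rewrite lt_min !divr_gt0//; lra.
  - by rewrite ge_min lexx.
  - by rewrite ge_min lexx orbT.
have d1 : d <= 1 by lra.
have [lam lamE] : exists lam, lam = 1 + d by eexists.
have lam1 : 1 < lam by lra.
have lam0 : 0 < lam by lra.
have l0 : 0 < ln lam by exact: ln_gt0.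
have dd : d ^+ 2 <= d by rewrite expr2 ler_piMl// ltW.
have dlam : (1 + 2 * d) * lam ^+ 2 <= 1 + eta.
  have ddd : d ^+ 3 <= d by rewrite exprS ler_piMr ?(ltW d0)//; lra.
  have -> : (1 + 2 * d) * lam ^+ 2 = 1 + 4 * d + 5 * d ^+ 2 + 2 * d ^+ 3 by rewrite lamE; ring.
  lra.
have lal : lam ^+ 2 * alpha <= (1 + alpha) / 2.
  have : lam ^+ 2 <= 1 + 3 * d by rewrite lamE; lra.
  move=> /(ler_wpM2r (ltW al0)) h; apply: (le_trans h).
  have : d * alpha <= d by rewrite ler_piMr ?ltW.
  lra.
have [z z0 zE] : exists2 z : R, 0 < z & Phibar z = (1 + alpha) / 4.
  by apply: Phibar_pos_level; lra.
have [kap kapE [kap0 kap1]] : exists2 kap, kap = cU ^+ 2 / (1 + cU ^+ 2) & 0 <= kap /\ kap < 1.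
  have cU20 : 0 <= cU ^+ 2 by exact: sqr_ge0.
  eexists; first reflexivity; rewrite ltr_pdivrMr; last lra.
  by split; [rewrite divr_ge0//; lra|lra].
have [th thE th0] : exists2 th, th = (1 - kap) / (1 + kap) & 0 < th.
  by eexists; first reflexivity; rewrite divr_gt0; lra.
have lami : 0 < 1 - lam^-1 by rewrite subr_gt0 invf_lt1.
have A10 : 0 < `|A| + 1 by rewrite ltr_wpDl.
have e16 : 0 < eta / 16 by lra.
(* Surplus exponents: 49/100 (3/2)^2 = 1 + 41/400 for the good event and (17/10)^2 / 2 = 1 + 89/200
   for the tail at the signal threshold. *)
have p41 : 0 < 41 / 400 :> R by lra.
have p89 : 0 < 89 / 200 :> R by lra.
have [eta1 eta10 HX] := exceedances_tail d0 z0.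
have [c1 c10 HL] := level_failure al0 kap0 kap1 d0 d1; rewrite -thE in HL.
have [kk [kk0 kk1 kk2 kk3]] : exists kk : R,
    [/\ 0 < kk, kk <= eta1 / 10, kk <= 1 / 1000 & kk <= eta / 4].
  exists (Num.min (eta1 / 10) (Num.min (1 / 1000) (eta / 4))); split.
  - by rewrite !lt_min; apply/and3P; split; clear -eta10 eta0; lra.
  - by rewrite ge_min lexx.
  - by rewrite !ge_min lexx orbT.
  - by rewrite !ge_min lexx !orbT.
have [M1 HT] := truncation_level cU1 r0 C0 nu0 K0 kk0.
have [c2 c2E c20] : exists2 c2, c2 = c1 * ((ln lam)^-1 + 1) & 0 < c2.
  by eexists; first reflexivity; rewrite mulr_gt0// addr_gt0// invr_gt0.
have [M2 H2] := logf_powR_small 4 th0 (divr_gt0 (divr_gt0 eta0 (ltr0n R 2)) c20).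
have [M3 H3] := powR_small p41 e16.
have [M4 H4] := powR_small p89 (divr_gt0 al0 (mulr_gt0 (ltr0n R 2) (expR_gt0 (1 / 2)))).
have [M5 H5] := powR_small c0 (divr_gt0 lami A10).
have [M6 H6] := powR_small (@ltr01 R) (divr_gt0 al0 (expR_gt0 (1 / 2))).
have [M7 H7] : exists k : nat, expR (1 : R) <= k%:R.
  by exists (Num.truncn (expR (1 : R))).+1; exact/ltW/truncnS_gt.
have [M [[MM1 MM2 MM3 MM4] [MM5 MM6 MM7 MM8]]] : exists M : nat,
    [/\ (M1 <= M)%N, (M2 <= M)%N, (M3 <= M)%N & (M4 <= M)%N] /\
    [/\ (M5 <= M)%N, (M6 <= M)%N, (M7 <= M)%N & (2 <= M)%N].
  clear; exists (M1 + M2 + M3 + M4 + M5 + M6 + M7 + 2)%N; split; split; lia.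
exists M => E F sdr nr mC mom Fs Fd sep Mm Mn.
have m2 : (2 <= ngroups E)%N by exact: leq_trans Mm.
have Qge := card_ordered_pairs_ge m2.
have Mu (k : nat) : (k <= M)%N -> k%:R <= (ngroups E)%:R :> R.
  by move=> h; rewrite ler_nat (leq_trans h).
have Mv (k : nat) : (k <= M)%N -> k%:R <= (max_nobs E)%:R :> R.
  by move=> h; rewrite ler_nat (leq_trans h).
have ratio := variance_ratio sdr nr.
have kapP := kap_ratio ratio; rewrite -kapE in kapP.
have nv := @nobs_le_max _ E.
have vn := max_nobs_ratio cU1 nr.
have v1 : 1 <= (max_nobs E)%:R :> R by apply: (Mv 1%N); exact: ltnW.
have u1 : 1 <= (ngroups E)%:R :> R by apply: (Mu 1%N); exact: ltnW.
have [b [beta [b1 be0 bl [b_le mean_le var_le sum_le]]]] :=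
  HT E _ vn nv u1 mC (Mv _ MM1) v1.
set u : R := (ngroups E)%:R in mC Mu u1 bl Qge *.
set p := 2 + 4 * r + nu in mom mean_le var_le sum_le *.
have u0 : 0 < u by exact: lt_le_trans u1.
have L1 : 1 <= ln u.
  rewrite -[leLHS](@expRK R) ler_ln ?posrE ?expR_gt0//.
  exact: le_trans H7 (Mu _ MM7).
have sq1 : 1 <= Num.sqrt (ln u) by rewrite -[leLHS](@sqrtr1 R) ler_wsqrtr.
have sq0 : 0 <= Num.sqrt (ln u) by exact: sqrtr_ge0.
have p2 : 2 <= p by clear -r0 nu0 p; rewrite /p; lra.
have b0 : 0 < b by exact: lt_le_trans b1.
have Ah : A * (max_nobs E)%:R `^ (- c) <= 1 - lam^-1.
  have h := H5 _ (Mv _ MM5).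
  apply: (@le_trans _ _ ((`|A| + 1) * (max_nobs E)%:R `^ (- c))).
    by rewrite ler_wpM2r ?powR_ge0// (le_trans (ler_norm A))// lerDl.
  by rewrite mulrC -ler_pdivlMr.
have Ah1 : A * (max_nobs E)%:R `^ (- c) <= 1.
  by apply: (le_trans Ah); rewrite gerBl invr_ge0 ltW.
have Fb := ref_bounds Fd lam0 Ah1 Ah.
have tauP : 2 * Phibar (17 / 10 * Num.sqrt (ln u)) <= alpha / u.
  have h := H4 _ (Mu _ MM4).
  have : Phibar (17 / 10 * Num.sqrt (ln u)) <= expR (1 / 2) * (u^-1 * u `^ (- (89 / 200))).
    rewrite (_ : 89 / 200 = (17 / 10) ^+ 2 / 2 - 1); last by clear; lra.
    by apply: Phibar_sqrt_ln => //; clear; lra.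
  move=> h1; rewrite -ler_pdivlMl//; apply: (le_trans h1).
  rewrite ler_pdivlMr ?mulr_gt0 ?expR_gt0// in h.
  rewrite mulrCA mulrC [leRHS]mulrA ler_pM2r ?invr_gt0//.
  by clear -h; lra.
have PY : Phibar (2 * Num.sqrt (ln u)) <= alpha / u.
  have h := H6 _ (Mu _ MM6).
  have : Phibar (2 * Num.sqrt (ln u)) <= expR (1 / 2) * (u^-1 * u `^ (-1)).
    have := Phibar_sqrt_ln (ler0n R 2) u1.
    by rewrite (_ : 2 ^+ 2 / 2 - 1 = 1); last by clear; lra.
  move=> h1; apply: (le_trans h1).
  rewrite ler_pdivlMr ?expR_gt0// in h.
  by rewrite mulrCA mulrC ler_pM2r ?invr_gt0// mulrC.
have [zl zlP] := grid_levels lam1 al0 u1 lal al1 zE PY.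
have Q0 : 0 < #|ordered_pairs E|%:R :> R.
  by apply: lt_le_trans Qge; rewrite divr_gt0// exprn_gt0.
set V := c1 * logf u ^+ 2 * u `^ (- th).
have V0 : 0 <= V.
  by apply: mulr_ge0; [apply: mulr_ge0; [exact: ltW|exact: sqr_ge0]|exact: powR_ge0].
have bl1 : beta * logf u ^+ 8 <= 1 / 1000 by exact: le_trans kk2.
(* The number of levels is O(ln u), hence O(logf u ^+ 2), which together with the square in [V]
   makes the fourth power. *)
have SV : (Num.truncn (ln u / ln lam)).+1%:R * V <= eta / 2.
  have h := H2 _ (Mu _ MM2) u1.
  rewrite ler_pdivlMr// in h; apply: le_trans h.
  have -> : logf u ^+ 4 * u `^ (- th) * c2 =
    ((ln lam)^-1 + 1) * logf u ^+ 2 * V by rewrite c2E /V; clear; ring.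
  rewrite ler_wpM2r//.
  have q0 : 0 <= ln u / ln lam by rewrite divr_ge0 ?(ltW l0)// (le_trans ler01).
  rewrite -natr1.
  have lf2 : 1 <= logf u ^+ 2 by rewrite exprn_ege1// logf_ge1.
  have Lf : ln u <= logf u ^+ 2.
    have h := sqr_sqrtr (le_trans ler01 L1).
    by rewrite /logf; clear -h sq1; move: h sq1; set q := Num.sqrt _ => h sq1; nra.
  rewrite mulrDl mul1r; apply: lerD => //.
  apply: (@le_trans _ _ (ln u / ln lam)); first by rewrite truncn_le.
  by rewrite mulrC ler_pM2l ?invr_gt0.
have thP : (\sum_(i : 'I_(ngroups E)) (nobs i)%:R) * (K * b `^ (- p)) +
    4 * u * expR (- (49 / 100 * (3 / 2 * Num.sqrt (ln u)) ^+ 2)) <= eta / 2.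
  have -> : 4 * u * expR (- (49 / 100 * (3 / 2 * Num.sqrt (ln u)) ^+ 2)) = 4 * u `^ (- (41 / 400)).
    rewrite /powR (gt_eqF u0) -{1}(lnK u0) -mulrA -expRD; congr (_ * expR _).
    by rewrite exprMn sqr_sqrtr ?(le_trans ler01 L1)//; clear; field.
  by have := le_trans sum_le kk3; have := H3 _ (Mu _ MM3); clear; lra.
have VP s : lam ^+ s <= u / 2 ->
    (prob E [set w | ((1 + 2 * d) * (#|ordered_pairs E|%:R * Phibar (zl s)) <=
       (exceedances b (zl s -
          (zl s * (4 * (1 + 3 / 2 * Num.sqrt (ln u)) ^+ 2 * beta) + 2 * beta)) w)%:R)%R] <= V%:E)%E.
  move=> sm; have [/andP[zz zY] zP] := zlP s sm.
  have zl0 : 0 <= zl s by apply: le_trans zz; exact: ltW.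
  have lz : 1 + zl s <= logf u by rewrite lerD2l.
  apply: (le_trans (HX E p K b beta kap _ _ p2 b0 mom b_le kap0 kapP _ zz _ _ _)).
  - by rewrite -(ltr0n R).
  - apply: (@le_trans _ _ (beta * logf u ^+ 8)).
      by rewrite ler_wpM2l// lerXn2r ?nnegrE ?addr_ge0//; exact: le_trans lz.
    by apply: (le_trans bl); clear -kk1 eta10; lra.
  - apply: addr_ge0; last by rewrite mulr_ge0.
    by apply: mulr_ge0 => //; apply: mulr_ge0 => //; apply: mulr_ge0 => //; exact: sqr_ge0.
  - apply: le_trans (delta_bound sq0 be0 _) _; first by rewrite zl0.
    by have := bl; rewrite /logf; clear -kk1 eta10; lra.
  rewrite lee_fin; apply: HL => //.
  by rewrite zP ler_pM2r ?invr_gt0// ler_peMl ?(ltW al0)// exprn_ege1// ltW.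
have H := dFDP_tail al01 Fs cU1 p2 b1 mom b_le mean_le var_le be0 bl1 m2 L1 ratio sep Fb tauP
  lam1 d0 z0 zlP (fun s => @grid_size _ _ _ s lam1 u1) V0 VP thP.
apply: (@le_trans _ _ (prob E [set w |
    ((1 + 2 * d) * lam ^+ 2 * dFDR_target E alpha < dFDP F alpha w)%R])).
  apply: le_measure; rewrite ?inE; [exact: measurable_dFDP_gt|exact: measurable_dFDP_gt|].
  move=> w /=; apply: le_lt_trans; rewrite ler_wpM2r//.
  by rewrite mulr_ge0 ?divr_ge0 ?(ltW al0)// addr_ge0// divr_ge0.
apply: (le_trans H); rewrite lee_fin; move: SV; clear; lra.
Qed.

(** * From probabilities to the false discovery rate *)

Section target.
Context (R : realType) (E : experiment R) (alpha : R).
Hypothesis alpha01 : 0 < alpha < 1.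

Lemma dFDR_target_ge : alpha / 2 <= dFDR_target E alpha.
Proof.
have /andP[al0 _] := alpha01.
by rewrite ler_peMr ?divr_ge0 ?(ltW al0)// lerDl divr_ge0.
Qed.

Lemma dFDR_target_le1 : dFDR_target E alpha <= 1.
Proof.
have /andP[al0 al1] := alpha01.
have h : #|null_pairs E|%:R / (npairs E)%:R <= 1 :> R.
  have [->|q0] := posnP (npairs E); first by rewrite invr0 mulr0.
  rewrite ler_pdivrMr ?ltr0n// mul1r ler_nat -card_pairs.
  by apply: subset_leq_card; apply/fintype.subsetP => x; rewrite inE => /andP[].
apply: (@le_trans _ _ (alpha / 2 * 2)); last by rewrite divfK// ltW.
by rewrite ler_wpM2l ?divr_ge0 ?(ltW al0)// [leRHS](_ : 2 = 1 + 1)// lerD2l.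
Qed.

Context (F : 'I_(ngroups E) -> 'I_(ngroups E) -> cumulativeBounded (0 : R) (1 : R)).
Hypothesis F_sym : symmetric_refs F.

(** The proportion is at most c off the exceptional event and at most 1 on it. *)
Lemma dFDR_le (c e : R) : 0 <= c ->
  (prob E [set w | (c < dFDP F alpha w)%R] <= e%:E)%E ->
  (dFDR F alpha <= (c + e)%:E)%E.
Proof.
move=> c0 ce; have /andP[al0 _] := alpha01.
have mA := measurable_dFDP_gt alpha01 F_sym c.
have bF : bounded_mfun (dFDP F alpha).
  split; first exact: measurable_dFDP.
  by exists 1 => w; rewrite ger0_norm ?dFDP_ge0// dFDP_le1.
have bA : bounded_mfun (\1_[set w | c < dFDP F alpha w] : space E -> R).
  exact: bounded_mfun_indic.
rewrite /dFDR unlock -EFin_Ex//.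
apply: (@le_trans _ _ (Ex (prob E) (fun w => c + \1_[set w | c < dFDP F alpha w] w))%:E).
  rewrite lee_fin; apply: Ex_le => //.
    by apply: bounded_mfunD => //; exact: bounded_mfun_cst.
  move=> w; rewrite indicE; have [h|h] := leP (dFDP F alpha w) c.
    by rewrite (le_trans h)// lerDl.
  by rewrite mem_set//= (le_trans (dFDP_le1 _ _ _))// lerDr.
rewrite ExD//; last exact: bounded_mfun_cst.
rewrite Ex_cst; have -> : (c + e)%:E = (c%:E + e%:E)%E by [].
by rewrite EFinD Ex_indic// leeD2l.
Qed.

End target.

Theorem theorem2p1 (R : realType) (E : nat -> experiment R)
  (F : forall l : nat, 'I_(ngroups (E l)) -> 'I_(ngroups (E l)) ->
         cumulativeBounded (0 : R) (1 : R))
  (alpha cL cU r C nu K c : R)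
  (m_infty : (fun l : nat => ngroups (E l)) @ \oo --> \oo)
  (n_infty : (fun l : nat => max_nobs (E l)) @ \oo --> \oo)
  (alpha01 : 0 < alpha < 1)
  (cL_bounds : 0 < cL <= 1) (cU_ge1 : 1 <= cU)
  (sd_ratio : forall (l : nat) (i j : 'I_(ngroups (E l))), i != j ->
     cL <= (sd i) ^+ 2 / (sd j) ^+ 2 <= cU)
  (nobs_ratio : forall (l : nat) (i j : 'I_(ngroups (E l))), i != j ->
     cL <= (nobs i)%:R / (nobs j)%:R <= cU)
  (r_gt0 : 0 < r) (C_gt0 : 0 < C) (nu_gt0 : 0 < nu) (K_gt0 : 0 < K)
  (m_le : forall l : nat,
     (ngroups (E l))%:R <= C * (max_nobs (E l))%:R `^ r)
  (moments : forall (l : nat) (i : 'I_(ngroups (E l))) (k : 'I_(nobs i)),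
     (standardized_moment k (2 + 4 * r + nu)%R <= K%:E)%E)
  (F_sym : forall (l : nat) (i j : 'I_(ngroups (E l))) (t : R),
     (i < j)%N -> 0 <= t -> F l i j t = 1 - F l i j (- t))
  (c_gt0 : 0 < c)
  (F_normal : exists A : R, \forall l \near \oo,
     (ref_deviation (F l) <= (A * (max_nobs (E l))%:R `^ (- c))%R%:E)%E)
  (signal : forall l : nat,
     (1 <= #|separated_pairs (E l)
               (8 * cU ^+ 2 * Num.sqrt (ln (ngroups (E l))%:R))%R|)%N) :
  (limn_esup (fun l : nat =>
      dFDR (F l) alpha * ((dFDR_target (E l) alpha)^-1)%R%:E) <= 1)%E /\
  (forall eps : R, 0 < eps ->
     (fun l : nat => prob (E l)
        [set w | dFDP (F l) alpha w < dFDR_target (E l) alpha + eps])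
     @ \oo --> (1 : \bar R)%E).
Proof.
have [A A_near] := F_normal.
have /andP[al0 al1] := alpha01.
have T0 l : 0 < dFDR_target (E l) alpha.
  by apply: lt_le_trans (dFDR_target_ge (E l) alpha01); rewrite divr_gt0.
have tail eta : 0 < eta -> \forall l \near \oo, (prob (E l)
    [set w | ((1 + eta) * dFDR_target (E l) alpha < dFDP (F l) alpha w)%R] <= eta%:E)%E.
  move=> eta0.
  have [M HM] := dFDP_uniform A alpha01 cU_ge1 r_gt0 C_gt0 nu_gt0 K_gt0 c_gt0 eta0.
  near=> l; apply: HM => //.
  - by move=> i j ij; case/andP: (sd_ratio l i j ij).
  - by move=> i j ij; case/andP: (nobs_ratio l i j ij).
  - by move=> i j t; exact: F_sym.
  - by near: l.
  - by near: l; exact: (m_infty _ (nbhs_infty_ge M)).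
  - by near: l; exact: (n_infty _ (nbhs_infty_ge M)).
split.
- apply/lee_addgt0Pr => e e0.
  (* Dividing the additive error [eta] by the target, which is at least alpha / 2, costs 2 / alpha;
     in total eta (1 + 2 / alpha) = e. *)
  pose eta := e / (1 + 2 / alpha).
  have k0 : 0 < 1 + 2 / alpha by rewrite addr_gt0// divr_gt0.
  have eta0 : 0 < eta by rewrite divr_gt0.
  (* The upper limit is an infimum of suprema over eventual sets of indices, and [G] is such a set
     by [tail]. *)
  pose G := [set l | (prob (E l) [set w | ((1 + eta) * dFDR_target (E l) alpha <
                        dFDP (F l) alpha w)%R] <= eta%:E)%E].
  apply: (@le_trans _ _ (ereal_sup
     [set dFDR (F l) alpha * ((dFDR_target (E l) alpha)^-1)%R%:E | l in G])%E).
    by apply: ereal_inf_lbound; exists G => //; exact: tail.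
  apply: ge_ereal_sup => _ [l /= Hl <-].
  have c0 : 0 <= (1 + eta) * dFDR_target (E l) alpha by rewrite mulr_ge0 ?ltW// addr_gt0.
  have H := dFDR_le alpha01 (@F_sym l) c0 Hl.
  apply: (@le_trans _ _ (((1 + eta) * dFDR_target (E l) alpha + eta)%:E *
      ((dFDR_target (E l) alpha)^-1)%:E)%E).
    by rewrite lee_wpmul2r// lee_fin invr_ge0 ltW.
  rewrite -EFinM -EFinD lee_fin mulrDl mulfK ?gt_eqF// -addrA lerD2l.
  have h : eta / dFDR_target (E l) alpha <= eta * (2 / alpha).
    rewrite ler_pM2l// -[leRHS]invrK lef_pV2 ?posrE ?invr_gt0 ?divr_gt0// invf_div.
    exact: dFDR_target_ge.
  apply: (le_trans (lerD (lexx eta) h)).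
  by rewrite -{1}[eta]mulr1 -mulrDr divfK// gt_eqF.
- move=> eps eps0.
  have mlt l : measurable [set w | dFDP (F l) alpha w < dFDR_target (E l) alpha + eps].
    by apply: measurable_lt_set; apply: measurable_dFDP => //; exact: F_sym.
  apply/fine_cvgP; split; first by near=> l; exact: fin_num_measure.
  apply/cvgrPdist_le => e e0.
  (* The target is at most 1, so (1 + eta) times it stays below the target plus eps; eta <= e bounds
     the missing probability. *)
  pose eta := Num.min e (eps / 2).
  have eta0 : 0 < eta by rewrite lt_min e0 divr_gt0.
  near=> l.
  have Hl : (prob (E l) [set w | ((1 + eta) * dFDR_target (E l) alpha <
      dFDP (F l) alpha w)%R] <= eta%:E)%E by near: l; exact: tail.
  set X := [set w | _] in Hl *.
  have fX : prob (E l) [set w | dFDP (F l) alpha w < dFDR_target (E l) alpha + eps] \is a fin_num.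
    exact: fin_num_measure.
  have le1 : (prob (E l) [set w | (dFDP (F l) alpha w < dFDR_target (E l) alpha + eps)%R] <= 1)%E.
    exact: probability_le1.
  have ge1 : (1 - eta%:E <= prob (E l)
      [set w | (dFDP (F l) alpha w < dFDR_target (E l) alpha + eps)%R])%E.
    have mX : measurable X by apply: measurable_dFDP_gt => //; exact: F_sym.
    apply: (@le_trans _ _ (prob (E l) (~` X))).
      by rewrite probability_setC// leeB.
    apply: le_measure; rewrite ?inE//; first exact: measurableC.
    move=> w /= /negP; rewrite -leNgt => h; apply: (le_lt_trans h).
    rewrite mulrDl mul1r ltrD2l.
    have h1 : eta <= eps / 2 by rewrite ge_min lexx orbT.
    have := dFDR_target_le1 (E l) alpha01; have := T0 l; clear -h1 eta0 eps0; nra.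
  move: le1 ge1; rewrite -(fineK fX) /= -EFinB !lee_fin => le1 ge1.
  have h1 : eta <= e by rewrite ge_min lexx.
  rewrite ger0_norm ?subr_ge0//; lra.
Unshelve. all: by end_near.
Qed.
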